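(* Let $\Gamma$ be a connected, compact metric graph. (1) For each $k\geq 2$ and $\alpha>0$ there exists a $k$-partition $\mathcal{P}_k^\alpha$ of $\Gamma$ such that $$\mathcal{L}^{\alpha}_k(\Gamma) = \Lambda^\alpha(\mathcal{P}_k^\alpha).$$ (2) For each $k \geq 2$, the function $\alpha \mapsto \mathcal{L}^\alpha_k(\Gamma)$ is a continuous and strictly monotonically increasing function of $\alpha>0$.
   Context: **Metric graphs.** $\Gamma=(\mathcal V,\mathcal E)$ is a compact, connected metric graph with finite vertex set $\mathcal V(\Gamma)$ and finite edge set $\mathcal E(\Gamma)$; each edge is identified with a compact interval of finite positive length; multiple parallel edges and loops are allowed; $\Gamma$ is regarded as a compact metric space with the path metric. Any point of $\Gamma$ may be regarded as a (dummy, degree-two) vertex. $\deg_\Gamma(v)$ is the number of edge ends at $v$ (loops counted twice). **Subgraphs and descendants.** A subgraph $\Omega$ of $\Gamma$ is a closed subset of $\Gamma$ consisting of finitely many closed (sub)intervals of edges, together with a connectivity at its boundary points which may differ from that of $\Gamma$: at a boundary point $v$ the subgraph may be cut, i.e. $v$ is replaced by $m\ge 1$ points $v_1,\dots,v_m$ of $\Omega$, called the descendants of $v$ in $\Omega$, with each edge end of $\Omega$ at $v$ attached to exactly one $v_i$ (each $v_i$ receiving at least one). The case $m=1$ means the connectivity is unchanged. Boundary points are the points of the topological boundary of $\Omega$ as a subset of $\Gamma$, together with any points at which $\Omega$ is cut ($m\geq 2$). At all other points $\Omega$ has the connectivity of $\Gamma$. Thus $\Omega$ is itself a metric graph, and connectedness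 of $\Omega$ and continuity of functions on $\Omega$ are meant with respect to this graph structure. $\partial\Omega$ denotes the set of all descendants in $\Omega$ of the boundary points. **Effective degree.** For a descendant $v_i\in\partial\Omega$ of $v\in\Gamma$, $\deg_\Omega(v_i)$ is the number of connected components of $B_\varepsilon(v_i)\setminus\{v_i\}$ for $\varepsilon>0$ small, where $B_\varepsilon(v_i)$ is the open ball in $\Omega$, and $$\operatorname{eff\,deg}_\Omega(v_i) := \min\{\deg_\Omega(v_i),\ \deg_\Gamma(v)-\deg_\Omega(v_i)\}.$$ **Partitions.** A $k$-partition of $\Gamma$ is a collection $\mathcal P=(\Omega_1,\dots,\Omega_k)$ of $k$ connected subgraphs of $\Gamma$ with nonempty interiors such that for all $i\ne j$ the intersection $\Omega_i\cap\Omega_j$ (as subsets of $\Gamma$) is a finite set consisting of common boundary points of $\Omega_i$ and $\Omega_j$. It is not required that $\bigcup_i\Omega_i=\Gamma$. **Robin energies.** $H^1(\Omega)=\{f\in C(\Omega): f|_e\in H^1(e)\ \forall e\in\mathcal E(\Omega)\}$. For $\alpha>0$, $$\lambda_1^\alpha(\Omega)=\inf\left\{\frac{\int_\Omega|f'|^2\,dx+\sum_{v\in\partial\Omega}\alpha\,\operatorname{eff\,deg}_\Omega(v)|f(v)|^2}{\int_\Omega|f|^2\,dx}: 0\ne f\in H^1(\Omega)\right\}.$$ For a partition $\mathcal P=(\Omega_1,\dots,\Omega_k)$, $\Lambda^\alpha(\mathcal P)=\max_{i}\lambda_1^\alpha(\Omega_i)$, and $$\mathcal L^\alpha_k(\Gamma)=\inf\{\Lambda^\alpha(\mathcal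 P_k):\mathcal P_k\text{ is a $k$-partition of }\Gamma\}.$$ *)

(* Defs.v *)
From HB Require Import structures.
From mathcomp Require Import all_boot all_order all_algebra.
From mathcomp Require Import all_classical all_reals all_analysis.
Set Implicit Arguments.
Unset Strict Implicit.
Unset Printing Implicit Defensive.
Import Order.TTheory GRing.Theory Num.Theory.
Import numFieldNormedType.Exports.
Local Open Scope classical_set_scope.
Local Open Scope ring_scope.

(* The edge e is a copy of the interval [0, len e], with 0 glued to src e and
   len e to tgt e; the orientation is only a parametrization. An edgeless graph
   (a single point, when connected) is not a metric graph. *)
Record mgraph (R : realType) := MGraph {
  vertex : finType;
  edge : finType;
  src : edge -> vertex;
  tgt : edge -> vertex;
  len : edge -> R;
  len_gt0 : forall e, 0 < len e;
  edge_ex : (0 < #|edge|)%N }.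

Section Points.
Context {R : realType}.
Implicit Type G : mgraph R.

Definition gpoint G : Type :=
  (vertex G + {p : edge G * R | 0 < p.2 < len p.1})%type.

HB.instance Definition _ G := Choice.on (gpoint G).

(* The point at distance x from the origin of e; x is clamped to [0, len e]. *)
Definition loc G (e : edge G) (x : R) : gpoint G :=
  if insub (e, x) is Some q then inr q
  else inl (if x <= 0 then src e else tgt e).

(* walk p q l: a path from p to q of length l, made of segments of edges. *)
Inductive walk G : gpoint G -> gpoint G -> R -> Prop :=
| walk_nil p : walk p p 0
| walk_cons e (x y : R) q l : x \in `[0, len e] -> y \in `[0, len e] ->
    walk (loc e y) q l -> walk (loc e x) q (`|x - y| + l).

(* The path distance is the infimum of the lengths of the walks, so this is its
   open ball. *)
Definition gball G (p : gpoint G) (r : R) (q : gpoint G) : Prop :=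
  exists2 l, walk p q l & l < r.

Lemma walk_cat G (p q s : gpoint G) l m :
  walk p q l -> walk q s m -> walk p s (l + m).
Proof.
move=> w; elim: w m => {p q l} [p m|e x y q l xe ye _ IH m qs].
  by rewrite add0r.
by rewrite -addrA; apply: walk_cons => //; exact: IH.
Qed.

Lemma walk_rev G (p q : gpoint G) l : walk p q l -> walk q p l.
Proof.
elim=> {p q l} [p|e x y q l xe ye _ IH]; first exact: walk_nil.
rewrite addrC; apply: (walk_cat IH).
by rewrite -[`|_|]addr0 distrC; apply: walk_cons => //; exact: walk_nil.
Qed.

Lemma gball_center G (p : gpoint G) (r : R) : 0 < r -> gball p r p.
Proof. by move=> r0; exists 0 => //; exact: walk_nil. Qed.

Lemma gball_sym G (p q : gpoint G) (r : R) : gball p r q -> gball q r p.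
Proof. by case=> l w lr; exists l => //; exact: walk_rev. Qed.

Lemma gball_triangle G (p q s : gpoint G) (r1 r2 : R) :
  gball p r1 q -> gball q r2 s -> gball p (r1 + r2) s.
Proof.
move=> [l w lr] [m w' mr]; exists (l + m); first exact: walk_cat w w'.
exact: ltrD.
Qed.

HB.instance Definition _ G := hasNbhs.Build (gpoint G)
  (nbhs_ (entourage_ (@gball G))).

HB.instance Definition _ G := @Nbhs_isPseudoMetric.Build R (gpoint G)
  (entourage_ (@gball G)) erefl (@gball G)
  (@gball_center G) (@gball_sym G) (@gball_triangle G) erefl.

Definition deg G (p : gpoint G) : nat :=
  match p with
  | inl v => (#|[pred e | src e == v]| + #|[pred e | tgt e == v]|)%N
  | inr _ => 2%N
  end.

Definition components (T : topologicalType) (A : set T) : set (set T) :=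
  [set connected_component A x | x in A].

Definition local_deg G (p : gpoint G) : nat :=
  xget 0%N [set n : nat | \forall e \near (0 : R)^'+,
    (components (ball p e `\ p) #= `I_n)%card].

End Points.

(* The subgraph is a metric graph of its own, whose edges are the intervals
   and whose vertices over a point p are the descendants of p (or p itself when
   p is not cut). sproj maps it onto the underlying subset; it carries the edge e
   onto the interval [off e, off e + len e] of the edge host e. Intervals may
   only overlap at their ends, and every descendant receives an edge end. *)
Record subgraph (R : realType) (G : mgraph R) := Subgraph {
  sgraph :> mgraph R;
  host : edge sgraph -> edge G;
  off : edge sgraph -> R;
  sproj : gpoint sgraph -> gpoint G;
  off_ge0 : forall e, 0 <= off e;
  off_le : forall e, off e + len e <= len (host e);
  sproj_loc : forall e (x : R), x \in `[0, len e] ->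
    sproj (loc e x) = loc (host e) (off e + x);
  sproj_inj : forall p q, sproj (inr p) = sproj (inr q) -> p = q;
  vertex_end : forall v : vertex sgraph, exists e, src e = v \/ tgt e = v }.

Section Subgraphs.
Context {R : realType} {G : mgraph R}.
Implicit Type O : subgraph G.

Definition carrier O : set (gpoint G) := range (@sproj R G O).

Definition cut_points O : set (gpoint G) :=
  [set p | exists v w : gpoint O, [/\ v <> w, sproj v = p & sproj w = p]].

Definition boundary O : set (gpoint G) :=
  (closure (carrier O) `\` interior (carrier O)) `|` cut_points O.

Definition descendants O : set (gpoint O) := @sproj R G O @^-1` boundary O.

Definition effdeg O (v : gpoint O) : nat :=
  minn (local_deg v) (deg (sproj v) - local_deg v).

Local Notation mu := (@lebesgue_measure R).

(* u is in H^1(0, l) and has weak derivative u'. *)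
Definition H1_interval (l : R) (u u' : R -> R) : Prop :=
  [/\ measurable_fun `[0, l] u',
      mu.-integrable `[0, l] (fun x : R => (u' x ^+ 2)%:E) &
      forall x : R, x \in `[0, l] -> u x = u 0 + \int[mu]_(t in `[0, x]) u' t].

Definition H1 O (f : gpoint O -> R) (f' : edge O -> R -> R) : Prop :=
  continuous f /\ forall e, H1_interval (len e) (fun x => f (loc e x)) (f' e).

Definition rayleigh (a : R) O (f : gpoint O -> R) (f' : edge O -> R -> R) : R :=
  (\sum_(e : edge O) \int[mu]_(x in `[0, len e]) (f' e x ^+ 2)
   + \sum_(v \in @descendants O) a * (effdeg v)%:R * f v ^+ 2)
  / \sum_(e : edge O) \int[mu]_(x in `[0, len e]) (f (loc e x) ^+ 2).

Definition lambda1 (a : R) O : R :=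
  inf [set r | exists f f',
    [/\ @H1 O f f', exists p, f p != 0 & r = rayleigh a f f']].

Definition is_partition (k : nat) (P : 'I_k -> subgraph G) : Prop :=
  (forall i, connected [set: gpoint (P i)] /\
             interior (carrier (P i)) !=set0) /\
  (forall i j, i != j ->
     finite_set (carrier (P i) `&` carrier (P j)) /\
     carrier (P i) `&` carrier (P j) `<=` boundary (P i) `&` boundary (P j)).

(* The default value 0 of the maximum is harmless: lambda1 >= 0 for a > 0. *)
Definition Lambda (a : R) (k : nat) (P : 'I_k -> subgraph G) : R :=
  \big[Num.max/0]_(i < k) lambda1 a (P i).

End Subgraphs.

Definition optimal_energy (R : realType) (G : mgraph R) (k : nat) (a : R) : R :=
  inf [set r | exists2 P : 'I_k -> subgraph G, is_partition P & r = Lambda a P].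

(* Main.v *)
Require Import Defs.
From mathcomp Require Import all_boot all_order all_algebra.
From mathcomp Require Import all_classical all_reals all_analysis measurable_realfun.
From mathcomp Require Import ring lra zify.

(** Existence and monotonicity of optimal partitions both rest on a reduction
of the Robin energies to finite sums. If a function of class H^1 on a graph is
replaced by the piecewise linear interpolation of its absolute value on a fine
mesh, then its boundary term is kept, its energy does not increase, and almost
all of its mass remains. Hence lambda1 is determined by nonnegative piecewise
linear functions (lambda1_le and lambda1_approx), for which rescaling an edge,
concatenating edges or adding a constant are elementary. On the topological
side, the local degree of a vertex is its number of edge ends, so that the
effective degree is min(d, D - d) with d and D the degrees in the subgraph and
in the graph, and a family of connected subgraphs is a partition if and only if
their segments do not overlap (effdeg_inl, sum_descendants, is_partitionP).

Existence is proved by compactness. Merging the two segments at every dummy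
vertex does not increase the energy (normal_form), and after that a connected
subgraph has at most two segments in each edge of G (slot_inj). So there are
finitely many combinatorial types, and within a type the subgraph depends only
on the positions of finitely many free ends. Along a minimizing sequence these
converge, after the passage to an ultrafilter. The difficulty is that some
segments may shrink to points. Such a segment has a free end, whose boundary
term has weight 1 and becomes a boundary term at the other end of the segment
(pendant_bound); on the other hand, deleting m ends at a vertex raises
min(d, D - d) by at most m. Hence the energy of the limit, from which the
vanishing segments have been removed, is at most the limit of the energies
(limit_subgraph). Not all the segments of a piece can vanish, as its energy
would blow up.

For the dependence on the parameter, let a < b. The energy for b is at most
b / a times the energy for a, so that the optimal energy L satisfies
L b <= b / a * L a; together with monotonicity this gives continuity. For the
strict inequality it suffices that lambda1 is strictly increasing for each piece
of a minimizer for b (lambda1_strict). Since k >= 2 and G is connected, each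
piece has a vertex of positive effective degree (boundary_vertex_ex), so its
lambda1 is positive (lambda1_gt0). If lambda1 did not increase from a to b,
near-minimizers for b would have almost no boundary term; adding to them a small
positive constant would then increase the mass at first order but the numerator
only at second order, and produce a Rayleigh quotient below lambda1. *)

Set Implicit Arguments.
Unset Strict Implicit.
Unset Printing Implicit Defensive.
Import Order.TTheory GRing.Theory Num.Theory.
Import numFieldNormedType.Exports.
Local Open Scope classical_set_scope.
Local Open Scope ring_scope.


(** * Points, walks and balls *)

Section Points.
Context {R : realType} (H : mgraph R).
Implicit Types (e : edge H) (v : vertex H) (p q : gpoint H) (z : edge H * bool).

Lemma loc0 e : loc e 0 = inl (src e).
Proof. by rewrite /loc; case: insubP => [u /=|_]; rewrite ?ltxx ?lexx. Qed.

Lemma loc_len e : loc e (len e) = inl (tgt e).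
Proof.
rewrite /loc; case: insubP => [u /=|_]; first by rewrite ltxx andbF.
by rewrite leNgt len_gt0.
Qed.

Lemma loc_in e (x : R) (h : 0 < x < len e) :
  loc e x = inr (exist (fun p : edge H * R => 0 < p.2 < len p.1) (e, x) h).
Proof.
rewrite /loc; case: insubP => [u hu eu|]; last by rewrite /= h.
by congr inr; apply: val_inj.
Qed.

Lemma loc_inl e (x : R) v : 0 <= x <= len e -> loc e x = inl v ->
  (x = 0 /\ src e = v) \/ (x = len e /\ tgt e = v).
Proof.
move=> /andP[x0 xl]; case: (ltgtP 0 x) x0 => // [x0 _|<- _]; last first.
  by rewrite loc0 => -[]; left.
case: (ltgtP x (len e)) xl => // [xl _|-> _].
  have h : 0 < x < len e by rewrite x0.
  by rewrite (loc_in h).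
by rewrite loc_len => -[]; right.
Qed.

Lemma loc_inr e (x : R) e' (y : R) : 0 < x < len e -> 0 <= y <= len e' ->
  loc e x = loc e' y -> e = e' /\ x = y.
Proof.
move=> hx /andP[y0 yl]; rewrite (loc_in hx).
case: (ltgtP 0 y) y0 => // [y0 _|<- _]; last by rewrite loc0.
case: (ltgtP y (len e')) yl => // [yl _|-> _]; last by rewrite loc_len.
have h : 0 < y < len e' by rewrite y0.
by rewrite (loc_in h) => -[-> ->].
Qed.

Lemma point_inr (q : {p : edge H * R | 0 < p.2 < len p.1}) :
  exists e (x : R), 0 < x < len e /\ inr q = loc e x.
Proof.
case: q => -[e x] /= h; exists e, x; split=> //; rewrite (loc_in h).
by congr inr; apply: val_inj.
Qed.

Lemma pointP p : (exists v, p = inl v) \/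
  exists e (x : R), 0 < x < len e /\ p = loc e x.
Proof. by case: p => [v|q]; [left; exists v|right; exact: point_inr]. Qed.

Definition endv z : vertex H := if z.2 then tgt z.1 else src z.1.
Definition endx z : R := if z.2 then len z.1 else 0.

Lemma loc_endx z : loc z.1 (endx z) = inl (endv z).
Proof. by rewrite /endx /endv; case: z.2; rewrite ?loc0 ?loc_len. Qed.

(** Measuring from the end z treats both ends of an edge alike. *)
Definition from_end z (t : R) : gpoint H :=
  loc z.1 (if z.2 then len z.1 - t else t).

Lemma walk_seg e (x y : R) : 0 <= x <= len e -> 0 <= y <= len e ->
  walk (loc e x) (loc e y) `|x - y|.
Proof.
move=> hx hy; rewrite -[`|_|]addr0.
by apply: walk_cons; rewrite ?in_itv//; exact: walk_nil.
Qed.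

Lemma deg_ends v : deg (inl v : gpoint H) = #|[pred z | endv z == v]|.
Proof.
rewrite /deg.
have -> : #|[pred e | src e == v]| = #|[pred z : edge H * bool | ~~ z.2 && (src z.1 == v)]|.
  have /fintype.card_image <- : injective (fun e : edge H => (e, false)) by move=> ? ? [].
  apply: eq_card => -[e b]; rewrite !inE /=; apply/fintype.imageP/idP => /=.
    by move=> [e' h [-> ->]]; rewrite inE in h.
  by case: b => //= h; exists e.
have -> : #|[pred e | tgt e == v]| = #|[pred z : edge H * bool | z.2 && (tgt z.1 == v)]|.
  have /fintype.card_image <- : injective (fun e : edge H => (e, true)) by move=> ? ? [].
  apply: eq_card => -[e b]; rewrite !inE /=; apply/fintype.imageP/idP => /=.
    by move=> [e' h [-> ->]]; rewrite inE in h.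
  by case: b => //= h; exists e.
rewrite addnC -cardUI [X in (_ + X)%N]eq_card0 ?addn0; last first.
  by move=> [e []]; rewrite !inE //= andbF.
by apply: eq_card => -[e []]; rewrite !inE /= ?orbF.
Qed.

Lemma half_min_len : exists2 r : R, 0 < r & forall e, r + r <= len e.
Proof.
pose r := \big[Num.min/1]_(e : edge H) (len e / 2).
exists r; first by apply: lt_bigmin => // e _; rewrite divr_gt0// len_gt0.
by move=> e; rewrite (splitr (len e)); apply: lerD; exact: bigmin_le.
Qed.

(** To leave its edge a walk must first reach one of the two ends: small
balls around interior points are intervals. *)
Lemma walk_interior p q l : walk p q l -> forall e (x : R),
  p = loc e x -> l < x -> l < len e - x -> 
  exists y : R, q = loc e y /\ `|x - y| <= l.
Proof.
elim=> {p q l} [p e x -> _ _|e0 x0 y0 q l xe ye w IH e x].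
  by exists x; rewrite subrr normr0.
move=> E h1 h2; rewrite !in_itv/= in xe ye.
have l0 : 0 <= l by elim: (w) => //= *; rewrite addr_ge0.
have a0 := normr_ge0 (x0 - y0).
have hx : 0 < x < len e by apply/andP; split; lra.
case: (loc_inr hx xe (esym E)) => ? ?; subst e0 x0.
have := ler_norm (x - y0); have := ler_norm (y0 - x); rewrite (distrC y0) => n1 n2.
case: (IH e y0 erefl); [lra|lra|move=> y [qy yl]].
by exists y; split=> //; apply: le_trans (ler_distD y0 _ _) _; rewrite lerD2l.
Qed.

Lemma walk_ge0 p q l : walk p q l -> 0 <= l.
Proof. by elim=> // *; rewrite addr_ge0. Qed.

Definition star v (r : R) p := p = inl v \/
  exists z (t : R), [/\ endv z = v, 0 < t <= r & p = from_end z t].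

(** Below half of the shortest edge, a segment of length d that starts in the
star of radius r stays on its branch or crosses the centre, hence stops in the
star of radius r + d. *)
Lemma star_walk (r0 : R) v p q l : (forall e, r0 + r0 <= len e) ->
  walk p q l -> forall r, 0 <= r -> star v r p -> r + l < r0 -> star v (r + l) q.
Proof.
move=> hr0; elim=> {p q l} [p r|e x y q l xe ye w IH r r_ge0].
  by rewrite addr0.
rewrite addrA => sx h; apply: IH => //; first by rewrite addr_ge0.
have l0 := walk_ge0 w.
rewrite !in_itv/= in xe ye; have he := hr0 e.
case/andP: (xe) => x0 xl; case/andP: (ye) => y0 yl.
have := ler_norm (x - y); have := ler_norm (y - x); rewrite (distrC y) => n1 n2.
case: sx => [/(loc_inl xe) [[? sv]|[? sv]]|[[e' b] [t [zv /andP[t0 tr] E]]]].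
- subst x; case: (ltgtP 0 y) y0 => // [y0 _|<- _].
    right; exists (e, false), y; split => //; rewrite y0/=.
    by move: n1 n2; lra.
  by left; rewrite loc0 sv.
- subst x; case: (ltgtP y (len e)) yl => // [yl _|-> _].
    right; exists (e, true), (len e - y); split => //; last by rewrite /from_end/= subKr.
    by rewrite subr_gt0 yl/=; lra.
  by left; rewrite loc_len sv.
- have he' := hr0 e'; move: zv E; rewrite /from_end; case: b; rewrite /endv/= => zv E.
    have i1 : 0 < len e' - t < len e' by apply/andP; split; lra.
    case: (loc_inr i1 xe (esym E)) => ? ?; subst e' x.
    case: (ltgtP y (len e)) yl => // [yl _|-> _].
      right; exists (e, true), (len e - y); split => //; last by rewrite /from_end/= subKr.
      by rewrite subr_gt0 yl/=; lra.
    by left; rewrite loc_len zv.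
  have i1 : 0 < t < len e' by apply/andP; split; lra.
  case: (loc_inr i1 xe (esym E)) => ? ?; subst e' t.
  case: (ltgtP 0 y) y0 => // [y0 _|<- _].
    right; exists (e, false), y; split => //; rewrite y0/=.
    by lra.
  by left; rewrite loc0 zv.
Qed.

Lemma ball_star (r0 : R) v p (r : R) : (forall e, r0 + r0 <= len e) -> r <= r0 ->
  ball (inl v : gpoint H) r p -> p = inl v \/
  exists z (t : R), [/\ endv z = v, 0 < t < r & p = from_end z t].
Proof.
move=> hr0 rr0 [l w lr].
have := star_walk hr0 w (lexx 0) (or_introl erefl).
rewrite add0r => /(_ (lt_le_trans lr rr0)) [->|[z [t [zv /andP[t0 tl] ->]]]].
  by left.
by right; exists z, t; split => //; rewrite t0/= (le_lt_trans tl lr).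
Qed.

Lemma ball_interior e (x : R) q (r : R) : r <= x -> r <= len e - x ->
  ball (loc e x) r q -> exists y : R, q = loc e y /\ `|x - y| < r.
Proof.
move=> h1 h2 [l w lr].
case: (walk_interior w erefl (lt_le_trans lr h1) (lt_le_trans lr h2)) => y [-> yl].
by exists y; split=> //; apply: le_lt_trans lr.
Qed.

Lemma ball_seg e (x y r : R) : 0 <= x <= len e -> 0 <= y <= len e ->
  `|x - y| < r -> ball (loc e x) r (loc e y).
Proof. by move=> xe ye h; exists `|x - y| => //; exact: walk_seg. Qed.

Lemma ball_from_end z (t r : R) : 0 <= t <= len z.1 -> t < r ->
  ball (inl (endv z) : gpoint H) r (from_end z t).
Proof.
move=> /andP[t0 tl] tr; rewrite -loc_endx /from_end /endx.
have n0 := ltW (len_gt0 z.1); case: z.2.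
  apply: ball_seg; rewrite ?n0 ?lexx//; first by apply/andP; split; lra.
  by rewrite subKr ger0_norm.
by apply: ball_seg; rewrite ?n0 ?lexx ?t0 ?tl// sub0r normrN ger0_norm.
Qed.

Lemma open_gpoint (A : set (gpoint H)) :
  (forall p, A p -> exists2 r : R, 0 < r & ball p r `<=` A) -> open A.
Proof.
move=> hA; rewrite openE => p /hA[r r0 hr]; rewrite /interior nbhs_ballP.
by exists r.
Qed.

(** The increments of f along the segments of a walk add up to at most K times
the length of the walk. *)
Lemma lipschitz_continuous (f : gpoint H -> R) (K : R) :
  (forall e (x y : R), 0 <= x <= len e -> 0 <= y <= len e ->
     `|f (loc e x) - f (loc e y)| <= K * `|x - y|) ->
  continuous f.
Proof.
move=> hf p.
have wf q s l : walk q s l -> `|f q - f s| <= K * l.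
  elim=> {q s l} [q|e x y q l xe ye _ IH]; first by rewrite subrr normr0 mulr0.
  rewrite mulrDr; apply: le_trans (ler_distD (f (loc e y)) _ _) _.
  by rewrite lerD// hf.
apply/(@cvgrPdist_lt _ _ _ (nbhs p) (nbhs_filter p)) => eps eps0.
have K1 : 0 < `|K| + 1 by rewrite ltr_wpDl.
apply/nbhs_ballP; exists (eps / (`|K| + 1)); first by rewrite /= divr_gt0.
move=> q [l w lr]; apply: le_lt_trans (wf _ _ _ w) _.
move: lr; rewrite ltr_pdivlMr// => lr.
apply: le_lt_trans lr; rewrite mulrC ler_wpM2l ?(walk_ge0 w)//.
by apply: le_trans (ler_norm K) _; rewrite lerDl.
Qed.

Lemma loc_continuous e : {within `[0, len e], continuous (loc e)}.
Proof.
apply/subspace_continuousP => x /=; rewrite in_itv/= => xe A.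
move=> /nbhs_ballP[r /= r0 hr]; rewrite /= /within /=; apply/nbhs_ballP; exists r => //.
move=> y xy /=; rewrite in_itv /= => ye; apply: hr; exact: ball_seg.
Qed.

End Points.

(** * Components, connectedness and local degrees *)

Lemma card_setT_fin (I : finType) : ([set: I] #= `I_#|I|)%card.
Proof.
pose g (i : I) : nat := enum_rank i.
have -> : `I_#|I| = g @` [set: I].
  apply/seteqP; split=> [k /= hk|_ [i _ <-]]; last exact: ltn_ord.
  by exists (enum_val (Ordinal hk)) => //; rewrite /g enum_valK.
apply: card_esym; apply: inj_card_eq => i j _ _.
by move=> /val_inj; exact: enum_rank_inj.
Qed.

Section Components.
Context {T : topologicalType} {I : finType} (A : I -> set T).
Hypothesis A_ex : forall i, A i !=set0.
Hypothesis A_con : forall i, connected (A i).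
Hypothesis A_open : forall i, open (A i).
Hypothesis A_disj : forall i j x, A i x -> A j x -> i = j.

(** A connected set covered by disjoint open sets meets only one of them. *)
Lemma component_of_open_partition i x : A i x ->
  connected_component (\bigcup_(i in setT) A i) x = A i.
Proof.
move=> Aix; set U := \bigcup_(i in _) _.
have AU j : A j `<=` U by move=> y Ajy; exists j.
apply/seteqP; split; last by apply: connected_component_max.
set C := connected_component U x.
have CU : C `<=` U by exact: connected_component_sub.
have Cx : C x by apply: connected_component_refl; exact: AU Aix.
suff <- : C `&` A i = C by move=> y [].
apply: (@component_connected _ U x (C `&` A i)); first by exists x.
  by exists (A i).
exists (~` \bigcup_(j in [set j | j != i]) A j).
  by apply: open_closedC; apply: bigcup_open => j _.
apply/seteqP; split=> y [Cy hy]; split=> //.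
  by case=> j /= /eqP ji Ajy; exact: ji (A_disj Ajy hy).
have [j _ Ajy] := CU _ Cy.
have [<-//|ji] := eqVneq j i.
by exfalso; apply: hy; exists j.
Qed.

Lemma card_components_of_open_partition :
  (components (\bigcup_(i in setT) A i) #= `I_#|I|)%card.
Proof.
have -> : components (\bigcup_(i in setT) A i) = A @` setT.
  apply/seteqP; split=> [_ [x [i _ Aix] <-]|_ [i _ <-]].
    by exists i => //; rewrite (component_of_open_partition Aix).
  have [x Aix] := A_ex i.
  by exists x; [exists i|exact: component_of_open_partition].
apply: card_eq_trans (card_setT_fin I).
apply: inj_card_eq => i j _ _ E; have [x Aix] := A_ex i.
by apply: (A_disj Aix); rewrite -E.
Qed.

End Components.

Section Local.
Context {R : realType} (H : mgraph R).
Implicit Types (e : edge H) (v : vertex H) (p q : gpoint H) (z : edge H * bool).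

(** Connectedness of the underlying combinatorial graph. It is expressed by
invariant properties rather than by paths, because it has to be transferred
between graphs whose vertices and edges differ. *)
Definition gconn := forall X : vertex H -> Prop,
  (forall e, X (src e) <-> X (tgt e)) -> forall u v, X u -> X v.

(** The points attached to the vertices satisfying X form a set that no walk
enters or leaves; such a set is clopen. *)
Lemma connected_gconn : connected [set: gpoint H] -> gconn.
Proof.
move=> cH X hX u v Xu.
pose B p := match p with inl w => X w | inr q => X (src (val q).1) end.
have Bloc e (x : R) : 0 <= x <= len e -> B (loc e x) <-> X (src e).
  case/andP; case: (ltgtP 0 x) => // [x0 _|<- _ _]; last by rewrite loc0.
  case: (ltgtP x (len e)) => // [xl _|-> _]; last by rewrite loc_len /= -hX.
  have h : 0 < x < len e by rewrite x0.
  by rewrite (loc_in h).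
have Bwalk p q l : walk p q l -> B p <-> B q.
  elim=> {p q l} // e x y q l; rewrite !in_itv /= => xe ye _ <-.
  by rewrite !Bloc.
have oB (C : set (gpoint H)) : (forall p q l, walk p q l -> C p -> C q) -> open C.
  move=> hC; apply: open_gpoint => p Cp; exists 1 => // q [l w _].
  exact: hC w Cp.
suff BT : B = setT by have : B (inl v) by rewrite BT.
apply: cH; first by exists (inl u).
  exists B; last by rewrite setTI.
  by apply: oB => p q l /Bwalk ->.
exists B; last by rewrite setTI.
rewrite -[B]setCK; apply: open_closedC; apply: oB => p q l /Bwalk w.
by rewrite /setC /= w.
Qed.

Lemma edge_connected e : connected (loc e @` `[0, len e]).
Proof.
apply: connected_continuous_connected; first exact: segment_connected.
exact: loc_continuous.
Qed.

(** A clopen set contains all or nothing of each edge. *)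
Lemma gconn_connected : gconn -> connected [set: gpoint H].
Proof.
move=> gc B [b Bb] [C oC BC] [D cD BD].
rewrite setTI in BC; rewrite setTI in BD.
have Be e (x y : R) : 0 <= x <= len e -> 0 <= y <= len e ->
    B (loc e x) -> B (loc e y).
  move=> xe ye Bx.
  have /(_ (loc e @` `[0, len e] `&` B)) E := @edge_connected e.
  suff : (loc e @` `[0, len e]) (loc e y) by rewrite -E => [[]|||] //;
    [exists (loc e x); split=> //; exists x => //; rewrite /= in_itv|
     exists C => //; rewrite BC| exists D => //; rewrite BD].
  by exists y => //; rewrite /= in_itv.
have l0 e : 0 <= 0 <= len e by rewrite lexx ltW// len_gt0.
have ll e : 0 <= len e <= len e by rewrite lexx ltW// len_gt0.
have Bv v : B (inl v).
  have hX e : B (inl (src e)) <-> B (inl (tgt e)).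
    by rewrite -loc0 -loc_len; split; exact: Be.
  case: (pointP b) => [[u bu]|[e [x [xe bx]]]].
    by apply: (gc (fun v => B (inl v)) hX u); rewrite -bu.
  apply: (gc (fun v => B (inl v)) hX (src e)); rewrite -loc0.
  apply: (Be e x) => //; last by rewrite -bx.
  by case/andP: xe => /ltW-> /ltW->.
apply/seteqP; split=> // p _; case: (pointP p) => [[u ->]|[e [x [xe ->]]]] //.
apply: (Be e 0) => //; last by rewrite loc0.
by case/andP: xe => /ltW-> /ltW->.
Qed.

(** The local degree can be read off any description of the small punctured
balls as disjoint unions of open connected branches. *)
Lemma local_degE p (I : finType) (A : R -> I -> set (gpoint H)) (r0 : R) : 0 < r0 ->
  (forall r, 0 < r < r0 -> [/\ ball p r `\ p = \bigcup_(i in setT) A r i,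
     forall i, A r i !=set0, forall i, connected (A r i),
     forall i, open (A r i) & forall i j x, A r i x -> A r j x -> i = j]) ->
  local_deg p = #|I|.
Proof.
move=> r00 hA.
have h : \forall r \near (0 : R)^'+, (components (ball p r `\ p) #= `I_#|I|)%card.
  near=> r; have [|-> ? ? ? ?] := hA r; last exact: card_components_of_open_partition.
  by apply/andP; split; near: r; [exact: nbhs_right_gt|exact: nbhs_right_lt].
rewrite /local_deg; case: xgetP => [n _ hn|/(_ #|I|)//].
have [r [h1 h2]] := filter_ex (filterI h hn).
apply/card_eq_II; apply: card_eq_trans h1; exact: card_esym.
Unshelve. all: by end_near.
Qed.

Lemma open_loc_itv e (a b : R) : 0 <= a -> b <= len e -> open (loc e @` `]a, b[).
Proof.
move=> a0 bl; apply: open_gpoint => _ [x + <-]; rewrite /= in_itv/= => /andP[ax xb].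
exists (Num.min (x - a) (b - x)); first by rewrite lt_min !subr_gt0 ax.
move=> q /ball_interior[||y [-> xy]].
- by rewrite ge_min; apply/orP; left; lra.
- by rewrite ge_min; apply/orP; right; lra.
exists y => //=; rewrite in_itv/=.
move: xy; rewrite lt_min !ltr_norml => /andP[/andP[h1 h2] /andP[h3 h4]].
by apply/andP; split; lra.
Qed.

Lemma connected_loc_itv e (a b : R) : 0 <= a -> b <= len e ->
  connected (loc e @` `]a, b[).
Proof.
move=> a0 bl; apply: connected_continuous_connected.
  by apply/connected_intervalP; exact: interval_is_interval.
apply: continuous_subspaceW (@loc_continuous _ H e) => x /=; rewrite !in_itv/=.
by move=> /andP[/ltW ax /ltW xb]; rewrite (le_trans a0 ax) (le_trans xb bl).
Qed.

(** The branches at v are the initial pieces of the ends of edges at v; a loop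
contributes two of them. *)
Lemma local_deg_inl v : local_deg (inl v : gpoint H) = deg (inl v : gpoint H).
Proof.
rewrite deg_ends -card_sig.
have [r0 r00 hr0] := half_min_len H.
pose A (r : R) (i : {z | [pred z | endv z == v] z}) : set (gpoint H) :=
  from_end (val i) @` `]0, r[.
apply: (@local_degE _ _ A r0 r00) => r /andP[r_gt0 rr0].
have AE (i : {z | [pred z | endv z == v] z}) : A r i =
    loc (val i).1 @` [set` if (val i).2 then `]len (val i).1 - r, len (val i).1[%R else `]0, r[%R].
  rewrite /A /from_end; case: (val i) => e [] //=; apply/seteqP; split=> _ [t +<-];
    rewrite /= in_itv/= => /andP[h1 h2]; exists (len e - t); rewrite ?subKr//=;
    by rewrite in_itv/=; apply/andP; split; lra.
split.
- apply/seteqP; split=> [q [qb qv]|q [[z /= zv] _ [t]]].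
    case: (ball_star hr0 (ltW rr0) qb) => [//|[z [t [zv tr qz]]]].
    have zP : [pred z | endv z == v] z by rewrite /= zv.
    by exists (exist _ z zP) => //; exists t => //; rewrite /= in_itv.
  rewrite /= in_itv/= => /andP[t0 tr] <-; have hz := hr0 z.1.
  split; first by rewrite -(eqP zv); apply: ball_from_end; rewrite ?(ltW t0)//=; lra.
  rewrite /= /from_end => E.
  have [|[+ _]|[+ _]] := loc_inl _ E.
  + by case: z.2; apply/andP; split; lra.
  + by case: z.2; lra.
  + by case: z.2; lra.
- move=> i; exists (from_end (val i) (r / 2)); exists (r / 2) => //=.
  by rewrite in_itv/=; apply/andP; split; lra.
- move=> i; rewrite AE; have hz := hr0 (val i).1.
  by case: ifP => _; apply: connected_loc_itv; lra.
- move=> i; rewrite AE; have hz := hr0 (val i).1.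
  by case: ifP => _; apply: open_loc_itv; lra.
- move=> [[e b] hi] [[e' b'] hj] x [t +<-] [t' +]; rewrite /= !in_itv/= /from_end/=.
  move=> /andP[t0 tr] /andP[t0' tr'] E; apply: val_inj => /=.
  have he := hr0 e; have he' := hr0 e'.
  have [] := @loc_inr _ H e' (if b' then len e' - t' else t') e (if b then len e - t else t) _ _ E.
  + by case: (b'); apply/andP; split; lra.
  + by case: (b); apply/andP; split; lra.
  by move=> ?; subst e'; case: (b); case: (b') => // h; exfalso; lra.
Qed.

Lemma local_deg_inr e (x : R) : 0 < x < len e -> local_deg (loc e x) = 2%N.
Proof.
move=> /andP[x0 xl]; rewrite -card_bool.
pose A (r : R) (b : bool) : set (gpoint H) :=
  loc e @` [set` if b then `]x, x + r[%R else `]x - r, x[%R].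
apply: (@local_degE _ _ A (Num.min x (len e - x))); first by rewrite lt_min x0 subr_gt0.
move=> r /andP[r0]; rewrite lt_min => /andP[rx rl]; split.
- apply/seteqP; split=> [q [/ball_interior[||y [->]]]|].
  + exact: ltW.
  + exact: ltW.
  + rewrite ltr_norml => /andP[h1 h2] h3.
    case: (ltgtP x y) h3 => [xy _|yx _|<- h3]; last by case: h3.
      2: {
      by exists false => //; exists y => //=; rewrite in_itv/= yx andbT; lra. }
    by exists true => //; exists y => //=; rewrite in_itv/= xy/=; lra.
  + move=> q [b _ [y + <-]] => hy.
    have {hy} [h1 h2 h3] : [/\ x - r < y, y < x + r & x <> y].
      by case: b hy => /=; rewrite in_itv/= => /andP[h1 h2]; split; lra.
    split; last first.
      move=> /= E; have [||_ ?] := loc_inr _ _ E; last by apply: h3.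
      by apply/andP; split; lra.
    by apply/andP; split; lra.
    apply: ball_seg; try by apply/andP; split; lra.
    by rewrite ltr_norml; apply/andP; split; lra.
- case; [exists (loc e (x + r / 2)); exists (x + r / 2) => //|
         exists (loc e (x - r / 2)); exists (x - r / 2) => //] => /=;
    by rewrite in_itv/=; apply/andP; split; lra.
- by case; apply: connected_loc_itv; lra.
- by case; apply: open_loc_itv; lra.
- move=> i j q [y hy <-] [y' hy' E].
  have [] := @loc_inr _ H e y' e y _ _ E.
  + by case: (j) hy' => /=; rewrite in_itv/= => /andP[h1 h2]; apply/andP; split; lra.
  + by case: (i) hy => /=; rewrite in_itv/= => /andP[h1 h2]; apply/andP; split; lra.
  move=> _ ?; subst y'; case: i hy; case: j hy' => //=;
    by rewrite !in_itv/= => /andP[h1 h2] /andP[h3 h4]; exfalso; lra.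
Qed.

End Local.

(** * Effective degrees and partitions *)

Section Subgraphs.
Context {R : realType} {G : mgraph R}.
Implicit Types O : subgraph G.

Lemma seg_in O (e : edge O) (x : R) : 0 < x < len e ->
  0 < off e + x < len (host e).
Proof. by have := off_ge0 e; have := off_le e; lra. Qed.

Lemma seg_sub O (e : edge O) (x : R) : 0 <= x <= len e ->
  0 <= off e + x <= len (host e).
Proof. by have := off_ge0 e; have := off_le e; lra. Qed.

Lemma endx_in (H : mgraph R) (z : edge H * bool) : 0 <= endx z <= len z.1.
Proof. by rewrite /endx; have := len_gt0 z.1; case: z.2; lra. Qed.

Lemma sproj_locE O (e : edge O) (x : R) : 0 <= x <= len e ->
  sproj (loc e x) = loc (host e) (off e + x).
Proof. by move=> xe; apply: sproj_loc; rewrite in_itv. Qed.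

Lemma sproj_endv O (z : edge O * bool) :
  sproj (inl (endv z)) = loc (host z.1) (off z.1 + endx z).
Proof. by rewrite -loc_endx sproj_locE// endx_in. Qed.

Lemma vertex_endv O (v : vertex O) : exists z : edge O * bool, endv z = v.
Proof.
by have [e [<-|<-]] := vertex_end v; [exists (e, false)|exists (e, true)].
Qed.

Lemma effdeg_inr O (e : edge O) (x : R) : 0 < x < len e -> effdeg (loc e x) = 0%N.
Proof.
move=> xe; rewrite /effdeg local_deg_inr// sproj_locE; last first.
  by case/andP: xe => /ltW-> /ltW->.
by rewrite (loc_in (seg_in xe)).
Qed.

Lemma effdeg_inl O (v : vertex O) : effdeg (inl v : gpoint O) =
  minn (deg (inl v : gpoint O)) (deg (sproj (inl v)) - deg (inl v : gpoint O)).
Proof. by rewrite /effdeg local_deg_inl. Qed.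

(** The points near sproj v in the direction (e, b) lie on a segment of O, and
a point closer than all the other ends of segments lies on a segment having an
end exactly at sproj v. As v is not cut, this end belongs to v. *)
Lemma germ_cover O (v : vertex O) (e : edge G) (x0 : R) (b : bool) :
  ~ descendants (inl v : gpoint O) -> 0 <= x0 <= len e ->
  loc e x0 = sproj (inl v) -> (if b then 0 < x0 else x0 < len e) ->
  exists z : edge O * bool, [/\ endv z = v, host z.1 = e & z.2 = b].
Proof.
move=> ndv xe pv hb.
have ncut (p : gpoint O) : sproj p = sproj (inl v) -> p = inl v.
  move=> pE; apply: contrapT => pv'; apply: ndv; right.
  by exists p, (inl v).
have [r r0 hr] : exists2 r : R, 0 < r & ball (sproj (inl v : gpoint O)) r `<=` carrier O.
  apply: contrapT => hr; apply: ndv; left; split.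
    by apply: subset_closure; exists (inl v).
  by move=> /nbhs_ballP[r r0 hb']; apply: hr; exists r.
pose room := if b then x0 else len e - x0.
have room0 : 0 < room by rewrite /room; case: (b) hb => ?; lra.
pose d := \big[Num.min/Num.min r room]_(z : edge O * bool |
   off z.1 + endx z != x0) `|off z.1 + endx z - x0|.
have d0 : 0 < d.
  by apply: lt_bigmin => [|z hz]; rewrite ?lt_min ?r0// normr_gt0 subr_eq0.
have dr : d <= Num.min r room by exact: bigmin_le_id.
have dz (z : edge O * bool) : off z.1 + endx z != x0 -> d <= `|off z.1 + endx z - x0|.
  by move=> hz; rewrite /d; exact: bigmin_le_cond.
move: dr; rewrite le_min => /andP[dr droom].
pose y := if b then x0 - d / 2 else x0 + d / 2.
have yx : `|y - x0| = d / 2.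
  rewrite /y; case: (b); last by rewrite addrAC subrr add0r ger0_norm//; lra.
  by rewrite addrAC subrr add0r normrN ger0_norm//; lra.
have yb (z : edge O * bool) : y <> off z.1 + endx z.
  move=> yE; have [zx|zx] := eqVneq (off z.1 + endx z) x0.
    by move: yx; rewrite yE zx subrr normr0; lra.
  by have := dz _ zx; rewrite -yE yx; lra.
have ye : 0 < y < len e.
  by move: droom; rewrite /y /room; case: (b) => h; apply/andP; split; lra.
have [q _ qy] : carrier O (loc e y).
  apply: hr; rewrite -pv; apply: ball_seg => //.
    by case/andP: ye => /ltW-> /ltW->.
  by rewrite distrC yx; lra.
case: (pointP q) => [[w qw]|[e' [t [te qt]]]].
  have [z zw] := vertex_endv w; move: qy; rewrite qw -zw sproj_endv => /esym qy.
  case: (loc_inr ye (seg_sub (endx_in z)) qy) => _ /yb [].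
have te' : 0 <= t <= len e' by case/andP: te => /ltW-> /ltW->.
move: qy; rewrite qt sproj_locE// => /(loc_inr (seg_in te))[].
  by case/andP: ye => /ltW-> /ltW->.
move=> he ty.
have out (b' : bool) (u : R) : u = off e' + endx (e', b') ->  u <> x0 ->
    u < x0 - d / 2 \/ u < x0 /\ u <= x0 - d \/ x0 + d / 2 < u /\ x0 + d <= u.
  move=> -> /eqP /(dz (e', b')) /=; rewrite ler_normr => /orP[] ?; lra.
have lo := out false (off e'); have hi := out true (off e' + len e').
rewrite /endx/= addr0 in lo hi; have {}lo := lo erefl; have {}hi := hi erefl.
have t1 : off e' < y by case/andP: te; lra.
have t2 : y < off e' + len e' by case/andP: te; lra.
have nin : ~ (off e' < x0 < off e' + len e').
  move=> /andP[h1 h2]; have h : 0 < x0 - off e' < len e' by apply/andP; split; lra.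
  have /ncut : sproj (loc e' (x0 - off e') : gpoint O) = sproj (inl v).
    by rewrite sproj_locE ?he -?pv ?[off e' + _]addrC ?subrK//; case/andP: h => /ltW-> /ltW->.
  by rewrite (loc_in h).
exists (e', b); split=> //=; have b0 := @sproj_endv O (e', b).
have := ncut (inl (endv (e', b))); rewrite b0 => /(_ _) hv.
suff : inl (endv (e', b)) = inl v :> gpoint O by case.
apply: hv; rewrite -pv /= he; congr loc.
apply: contrapT; rewrite /endx/=; move: t1 t2 nin; rewrite /y.
case: (b) => /= t1 t2 nin hx.
  have {}hi := hi hx; apply: nin; apply/andP; split; lra.
rewrite addr0 in hx; have {}lo := lo hx; apply: nin; apply/andP; split; lra.
Qed.

Lemma effdeg_out O (v : vertex O) : ~ descendants (inl v : gpoint O) ->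
  effdeg (inl v : gpoint O) = 0%N.
Proof.
move=> ndv; rewrite effdeg_inl; apply/eqP; rewrite -leqn0 geq_min; apply/orP; right.
rewrite leqn0 subn_eq0 [X in (_ <= X)%N]deg_ends.
case E : (sproj (inl v : gpoint O)) => [u|q].
  rewrite deg_ends.
  pose h (z : edge O * bool) := (host z.1, z.2).
  apply: leq_trans (leq_image_card h _); apply: subset_leq_card.
  apply/fintype.subsetP => -[e b]; rewrite inE => /eqP zu.
  have [||z [zv he zb]] := @germ_cover _ v e (endx (e, b)) b ndv (endx_in _).
  - by rewrite -[e]/((e, b).1) loc_endx zu E.
  - by rewrite /endx; have := len_gt0 e; case: (b).
  by apply/fintype.imageP; exists z; [rewrite inE zv|rewrite /h he zb].
have [e [x [xe qx]]] := point_inr q.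
have -> : deg (inr q : gpoint G) = #|{: bool}| by rewrite card_bool.
have xe' : 0 <= x <= len e by case/andP: xe => /ltW-> /ltW->.
apply: leq_trans (leq_image_card snd _); apply: subset_leq_card.
apply/fintype.subsetP => b _.
have [||z [zv he zb]] := @germ_cover _ v e x b ndv xe'.
- by rewrite E qx.
- by case/andP: xe; case: (b).
by apply/fintype.imageP; exists z; [rewrite inE zv|].
Qed.

(** The sum may run over all vertices: those that are not descendants of
boundary points, and the interior points of edges, have effective degree 0. *)
Lemma sum_descendants O (a : R) (f : gpoint O -> R) :
  \sum_(v \in @descendants R G O) a * (effdeg v)%:R * f v ^+ 2 =
  \sum_(v : vertex O) a * (effdeg (inl v : gpoint O))%:R * f (inl v) ^+ 2.
Proof.
pose r : seq (gpoint O) := [seq inl v | v <- enum (vertex O)].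
rewrite (@fsbig_widen _ _ _ _ _ setT) //; last first.
  move=> p [_ /=]; case: (pointP p) => [[v ->]|[e [x [xe ->]]]].
    by move=> /effdeg_out ->; rewrite mulr0 mul0r.
  by rewrite effdeg_inr// mulr0 mul0r.
rewrite -(@fsbig_widen _ _ _ _ [set` r] setT) //; last first.
  move=> p [_ /=]; case: (pointP p) => [[v ->]|[e [x [xe ->]]] _].
    by case; rewrite map_f// mem_enum.
  by rewrite effdeg_inr// mulr0 mul0r.
rewrite -fsbig_seq; first by rewrite big_map big_enum.
by rewrite map_inj_uniq ?enum_uniq// => ? ? [].
Qed.

(** The metric content of the intersection condition on partitions; a closed
condition on the positions of the segments, hence one that survives limits. *)
Definition nov O O' := forall (e : edge O) (e' : edge O'), host e = host e' ->
  off e + len e <= off e' \/ off e' + len e' <= off e.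

Lemma nov_sym O O' : nov O O' -> nov O' O.
Proof. by move=> h e e' /esym /h; tauto. Qed.

Lemma nov_self O (e e' : edge O) : e <> e' -> host e = host e' ->
  off e + len e <= off e' \/ off e' + len e' <= off e.
Proof.
move=> ee' hh; apply: contrapT => no; apply: ee'.
have := len_gt0 e; have := len_gt0 e' => l1 l2.
pose a := Num.max (off e) (off e'); pose b := Num.min (off e + len e) (off e' + len e').
have ab : a < b.
  by rewrite /a /b gt_max !lt_min; apply/andP; split; apply/andP; split; lra.
have ha : off e <= a /\ off e' <= a by rewrite /a !le_max !lexx orbT.
have hb : b <= off e + len e /\ b <= off e' + len e'.
  by rewrite /b !ge_min !lexx orbT.
pose x := (a + b) / 2.
have i1 : 0 < x - off e < len e by rewrite /x; apply/andP; split; lra.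
have i2 : 0 < x - off e' < len e' by rewrite /x; apply/andP; split; lra.
have E : sproj (loc e (x - off e)) = sproj (loc e' (x - off e')).
  rewrite !sproj_locE; first by rewrite hh; congr loc; ring.
    by case/andP: i2 => /ltW-> /ltW->.
  by case/andP: i1 => /ltW-> /ltW->.
by move: E; rewrite (loc_in i1) (loc_in i2) => /sproj_inj[].
Qed.

(** Also the ends of segments are excluded: near an end, its segment would
overlap the one through the point. *)
Lemma nov_carrier O O' (e : edge O) (x : R) (q : gpoint O') : nov O O' ->
  0 < x < len e -> sproj (loc e x) <> sproj q.
Proof.
move=> no xe; rewrite sproj_locE; last by case/andP: xe => /ltW-> /ltW->.
case: (pointP q) => [[w ->]|[e' [y [ye ->]]]].
  have [z <-] := vertex_endv w; rewrite sproj_endv => E.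
  have [he xz] := loc_inr (seg_in xe) (seg_sub (endx_in z)) E.
  have := endx_in z; have := no _ _ he; have := len_gt0 z.1; have := len_gt0 e.
  by clear E he; case/andP: xe => ? ? ? ? ? /andP[? ?]; lra.
rewrite sproj_locE; last by case/andP: ye => /ltW-> /ltW->.
move=> /(loc_inr (seg_in xe)) [|he xy].
  by apply: seg_sub; case/andP: ye => /ltW-> /ltW->.
by have := no _ _ he; clear he; case/andP: xe => ? ?; case/andP: ye => ? ? ?; lra.
Qed.

(** The points of O' near the common point, other than it, are not in O. *)
Lemma nov_boundary O O' (v : vertex O) (w : vertex O') : nov O O' ->
  sproj (inl v) = sproj (inl w) -> boundary O (sproj (inl v)).
Proof.
move=> no vw; left; split; first by apply: subset_closure; exists (inl v).
rewrite vw; move=> /nbhs_ballP[r /= r0 hr].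
have [z zw] := vertex_endv w; have l0 := len_gt0 z.1.
pose t := Num.min (r / 2) (len z.1 / 2).
have t0 : 0 < t by rewrite lt_min !divr_gt0.
have tr : t <= r / 2 by rewrite ge_min lexx.
have tl : t <= len z.1 / 2 by rewrite ge_min lexx orbT.
pose y := if z.2 then len z.1 - t else t.
have y0 : 0 < y < len z.1 by rewrite /y; case: z.2; apply/andP; split; lra.
have y0' : 0 <= y <= len z.1 by case/andP: y0 => /ltW-> /ltW->.
have [q _ qE] : carrier O (sproj (loc z.1 y)).
  apply: hr; rewrite -zw sproj_endv sproj_locE//; apply: ball_seg.
  - by apply: seg_sub; exact: endx_in.
  - exact: seg_sub.
  rewrite /y /endx; case: z.2.
    by have -> : off z.1 + len z.1 - (off z.1 + (len z.1 - t)) = t; [ring|rewrite gtr0_norm//; lra].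
  have -> : off z.1 + 0 - (off z.1 + t) = - t by ring.
  by rewrite normrN gtr0_norm//; lra.
by have := @nov_carrier _ _ _ _ q (nov_sym no) y0; rewrite qE.
Qed.

Lemma itv_infinite (a b : R) : a < b -> ~ finite_set `]a, b[.
Proof.
move=> ab /finite_set_countable /countable_lebesgue_measure0.
rewrite lebesgue_measure_itv /= lte_fin ab -EFinB => -[].
by move/eqP; rewrite subr_eq0 gt_eqF.
Qed.

Lemma finite_carrier_nov O O' : finite_set (carrier O `&` carrier O') -> nov O O'.
Proof.
move=> fin e e' hh; apply: contrapT => no.
have := len_gt0 e; have := len_gt0 e' => l1 l2.
pose a := Num.max (off e) (off e'); pose b := Num.min (off e + len e) (off e' + len e').
have ab : a < b.
  by rewrite /a /b gt_max !lt_min; apply/andP; split; apply/andP; split; lra.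
have ha : off e <= a /\ off e' <= a by rewrite /a !le_max !lexx orbT.
have hb : b <= off e + len e /\ b <= off e' + len e'.
  by rewrite /b !ge_min !lexx orbT.
apply: (itv_infinite ab); have := off_ge0 e; have := off_le e => o1 o2.
have sub : loc (host e) @` `]a, b[ `<=` carrier O `&` carrier O'.
  move=> _ [x + <-]; rewrite /= in_itv/= => /andP[ax xb].
  split.
    exists (loc e (x - off e)) => //; rewrite sproj_locE; first by congr loc; ring.
    by apply/andP; split; lra.
  exists (loc e' (x - off e')) => //; rewrite sproj_locE; first by rewrite hh; congr loc; ring.
  by apply/andP; split; lra.
have := sub_finite_set sub fin.
suff inj : {in `]a, b[%classic &, injective (loc (host e))}.
  by rewrite (eq_finite_set (inj_card_eq inj)).
move=> x y; rewrite !inE /= !in_itv/= => /andP[ax xb] /andP[ay yb].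
by move=> E; have [||] := loc_inr _ _ E => //; apply/andP; split; lra.
Qed.

(** Overlapping segments share infinitely many points; without overlap the
carriers meet only in images of vertices, which are boundary points. *)
Lemma is_partitionP (k : nat) (P : 'I_k -> subgraph G) : is_partition P <->
  (forall i, connected [set: gpoint (P i)]) /\
  (forall i j, i != j -> nov (P i) (P j)).
Proof.
split=> [[h1 h2]|[h1 h2]].
  by split=> [i|i j ij]; [have [] := h1 i|apply: finite_carrier_nov; have [] := h2 _ _ ij].
split=> [i|i j ij]; first split=> //.
  have /card_gt0P[e _] := edge_ex (P i); have l0 := len_gt0 e.
  have le2 : 0 < len e / 2 < len e by apply/andP; split; lra.
  exists (sproj (loc e (len e / 2))).
  have o : open (loc (host e) @` `]off e, off e + len e[).
    by apply: open_loc_itv; [exact: off_ge0|exact: off_le].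
  have hin : (loc (host e) @` `]off e, off e + len e[) (sproj (loc e (len e / 2))).
    exists (off e + len e / 2); last by rewrite sproj_locE// ?(ltW l0)//; apply/andP; split; lra.
    by rewrite /= in_itv/=; apply/andP; split; lra.
  apply: (@filterS _ (nbhs _) _ _ _ _ (open_nbhs_nbhs (conj o hin))).
  {  move=> _ [x + <-]; rewrite /= in_itv/= => /andP[ax xb].
    exists (loc e (x - off e)) => //; rewrite sproj_locE; first by congr loc; ring.
    by apply/andP; split; lra. }
have no := h2 _ _ ij.
have inlE p : (carrier (P i) `&` carrier (P j)) p ->
    exists v w, p = sproj (inl v : gpoint (P i)) /\ p = sproj (inl w : gpoint (P j)).
  move=> [[q _ <-] [q' _ qq']].
  case: (pointP q) qq' => [[v ->]|[e [x [xe ->]]]]; last first.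
    by move=> /esym /(@nov_carrier _ _ _ _ _ no xe).
  case: (pointP q') => [[w ->]|[e [x [xe ->]]]]; last first.
    by move=> /(@nov_carrier _ _ _ _ _ (nov_sym no) xe).
  by move=> vw; exists v, w.
split.
  apply: (@sub_finite_set _ _ ((fun v => sproj (inl v : gpoint (P i))) @` setT)).
    by move=> p /inlE[v [w [-> _]]]; exists v.
  by apply: finite_image; apply: finite_finset.
move=> p /inlE[v [w [pv pw]]]; split.
  by rewrite pv; apply: (nov_boundary no); rewrite -pv pw.
by rewrite pw; apply: (nov_boundary (nov_sym no)); rewrite -pw pv.
Qed.

End Subgraphs.

(** * Piecewise linear functions on an interval *)

Section Integrals.
Context {R : realType}.
Local Notation mu := (@lebesgue_measure R).
Implicit Types (f g : R -> R) (a b c : R).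

Lemma Rint_cst a b (k : R) : a <= b -> \int[mu]_(x in `[a, b]) k = k * (b - a).
Proof.
move=> ab; rewrite Rintegral_cst//= lebesgue_measure_itv/= lte_fin.
by case: ltgtP ab => // -> _; rewrite subrr.
Qed.

Lemma bounded_integrable a b f (K : R) : measurable_fun `[a, b] f ->
  (forall x, a <= x <= b -> `|f x| <= K) -> mu.-integrable `[a, b] (EFin \o f).
Proof.
move=> mf hK; apply: measurable_bounded_integrable => //.
  have := leey (mu `[a, b]); rewrite /= lebesgue_measure_itv/=.
  by case: ifP => // _ _; rewrite -EFinB ltry.
exists K; split; first exact: num_real.
by move=> y Ky x /=; rewrite in_itv/= => /hK h; apply: le_trans h (ltW Ky).
Qed.

Lemma cst_integrable a b (k : R) : mu.-integrable `[a, b] (EFin \o cst k).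
Proof. by apply: (@bounded_integrable _ _ _ `|k|) => // *; exact: measurable_cst. Qed.

Lemma integrable_sub a b a' b' f : a <= a' -> b' <= b ->
  mu.-integrable `[a, b] (EFin \o f) -> mu.-integrable `[a', b'] (EFin \o f).
Proof.
move=> aa bb; apply: integrableS => //= x /=; rewrite !in_itv/= => /andP[h1 h2].
by rewrite (le_trans aa h1) (le_trans h2 bb).
Qed.

Lemma Rint_split f a b c : a <= b -> b <= c -> mu.-integrable `[a, c] (EFin \o f) ->
  \int[mu]_(x in `[a, c]) f x =
  \int[mu]_(x in `[a, b]) f x + \int[mu]_(x in `[b, c]) f x.
Proof.
move=> ab bc fi; apply/eqP; rewrite addrC -subr_eq; apply/eqP.
rewrite Rintegral_itvB ?bnd_simp//.
rewrite Rintegral_itv_obnd_cbnd//; apply: integrableS fi => //= x /=.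
by rewrite !in_itv/= => /andP[h1 h2]; rewrite h2 (le_trans ab (ltW h1)).
Qed.

Lemma eq_Rint_oc f g a b : mu.-integrable `[a, b] (EFin \o f) ->
  mu.-integrable `[a, b] (EFin \o g) -> (forall x, a < x <= b -> f x = g x) ->
  \int[mu]_(x in `[a, b]) f x = \int[mu]_(x in `[a, b]) g x.
Proof.
move=> fi gi fg.
have sub : `]a, b] `<=` (`[a, b] : set R).
  by move=> x /=; rewrite !in_itv/= => /andP[/ltW -> ->].
rewrite -Rintegral_itv_obnd_cbnd; last exact: integrableS fi.
rewrite -[RHS]Rintegral_itv_obnd_cbnd; last exact: integrableS gi.
by apply: eq_Rintegral => x; rewrite inE/= in_itv/= => /fg.
Qed.

Lemma le_Rint f g a b : mu.-integrable `[a, b] (EFin \o f) ->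
  mu.-integrable `[a, b] (EFin \o g) -> (forall x, a <= x <= b -> f x <= g x) ->
  \int[mu]_(x in `[a, b]) f x <= \int[mu]_(x in `[a, b]) g x.
Proof.
by move=> fi gi fg; apply: le_Rintegral => // x /=; rewrite in_itv/= => /fg.
Qed.

Lemma int_sqr_ge0 f a b : 0 <= \int[mu]_(x in `[a, b]) (f x ^+ 2).
Proof. by apply: Rintegral_ge0 => x _; exact: sqr_ge0. Qed.

End Integrals.

Section PL.
Context {R : realType}.
Local Notation mu := (@lebesgue_measure R).
Implicit Types (s : seq (R * R)) (p c : R).

(** A piecewise linear function on an interval is encoded by its first
value and the sequence of its pieces, a piece being the pair of its length
and of the value at its right end. *)
Fixpoint plen s : R := if s is q :: s' then q.1 + plen s' else 0.
Definition plast c s : R := last c [seq q.2 | q <- s].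
Fixpoint penergy c s : R :=
  if s is q :: s' then (q.2 - c) ^+ 2 / q.1 + penergy q.2 s' else 0.

(** A lower bound for the integral of the square of a nonnegative piecewise
linear function, which becomes exact as the mesh is refined. It is easier to
handle than the integral, and as good for computing an infimum. *)
Fixpoint pmass c s : R :=
  if s is q :: s' then q.1 * Num.min c q.2 ^+ 2 + pmass q.2 s' else 0.

Definition plwf s := all (fun q => (0 < q.1) && (0 <= q.2)) s.

(** The interval starts at p; keeping p as an argument spares translations of
integrals in inductions on the pieces. *)
Fixpoint pl p c s x : R := if s is q :: s' then
  if x <= p + q.1 then c + (q.2 - c) / q.1 * (x - p) else pl (p + q.1) q.2 s' x
  else c.
Fixpoint dpl p c s x : R := if s is q :: s' then
  if x <= p + q.1 then (q.2 - c) / q.1 else dpl (p + q.1) q.2 s' x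
  else 0.

Lemma plen_ge0 s : plwf s -> 0 <= plen s.
Proof.
by elim: s => //= -[h d] s IH /andP[/andP[h0 _] /IH ?]; rewrite addr_ge0// ltW.
Qed.

Lemma penergy_ge0 c s : plwf s -> 0 <= penergy c s.
Proof.
elim: s c => //= -[h d] s IH c /andP[/andP[/= h0 _] /IH ?].
by rewrite addr_ge0// divr_ge0 ?sqr_ge0// ltW.
Qed.

Lemma pmass_ge0 c s : plwf s -> 0 <= pmass c s.
Proof.
elim: s c => //= -[h d] s IH c /andP[/andP[/= h0 _] /IH ?].
by rewrite addr_ge0// mulr_ge0 ?sqr_ge0// ltW.
Qed.

Lemma measurable_le (k : R) : measurable_fun setT (fun x : R => x <= k).
Proof. by apply: measurable_realfun.measurable_fun_ler => //; exact: measurable_cst. Qed.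

Lemma measurable_dpl p c s : measurable_fun setT (dpl p c s).
Proof.
elim: s p c => [|q s IH] p c /=; first exact: measurable_cst.
apply: measurable_fun_ifT; [exact: measurable_le|exact: measurable_cst|exact: IH].
Qed.

Lemma measurable_pl p c s : measurable_fun setT (pl p c s).
Proof.
elim: s p c => [|q s IH] p c /=; first exact: measurable_cst.
apply: measurable_fun_ifT; [exact: measurable_le| |exact: IH].
apply: measurable_funD; first exact: measurable_cst.
apply: measurable_funM; first exact: measurable_cst.
by apply: measurable_funB => //; exact: measurable_cst.
Qed.

Lemma dpl_bounded p c s : exists2 K : R, 0 <= K & forall x, `|dpl p c s x| <= K.
Proof.
elim: s p c => [|q s IH] p c /=; first by exists 0 => // x; rewrite normr0.
have [K K0 hK] := IH (p + q.1) q.2.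
exists (`|(q.2 - c) / q.1| + K); first by rewrite addr_ge0.
by move=> x; case: ifP => _; [rewrite lerDl|apply: le_trans (hK x) _; rewrite lerDr].
Qed.

Lemma dpl_integrable p c s a b : mu.-integrable `[a, b] (EFin \o dpl p c s).
Proof.
have [K _ hK] := dpl_bounded p c s.
apply: (@bounded_integrable _ _ _ _ K) => //.
exact: measurable_funS (measurable_dpl p c s).
Qed.

Lemma dpl2_integrable p c s a b :
  mu.-integrable `[a, b] (EFin \o (fun x => dpl p c s x ^+ 2)).
Proof.
have [K K0 hK] := dpl_bounded p c s.
apply: (@bounded_integrable _ _ _ _ (K ^+ 2)).
  by apply: measurable_funX; exact: measurable_funS (measurable_dpl p c s).
by move=> x _; rewrite normrX lerXn2r ?nnegrE.
Qed.

Lemma pl_start p c s : plwf s -> pl p c s p = c.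
Proof.
case: s => //= -[h d] s /andP[/andP[/= h0 _] _].
by rewrite lerDl (ltW h0) subrr mulr0 addr0.
Qed.

Lemma pl_ftc s p c x : plwf s -> p <= x <= p + plen s ->
  pl p c s x = c + \int[mu]_(t in `[p, x]) dpl p c s t.
Proof.
elim: s p c => [|[h d] s IH] p c /= => [_|/andP[/andP[/= h0 d0] ws]] /andP[px xl].
  by rewrite Rint_cst// mul0r addr0.
case: leP => xh.
  rewrite (@eq_Rintegral _ _ _ _ _ (cst ((d - c) / h))) ?Rint_cst//.
  by move=> t; rewrite inE/= in_itv/= => /andP[_ tx]; rewrite (le_trans tx xh).
rewrite IH//; last by rewrite (ltW xh)/= -addrA.
rewrite [in RHS](@Rint_split _ _ _ (p + h)) ?lerDl ?ltW//; last exact: (@dpl_integrable p c ((h, d) :: s)).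
rewrite addrA; congr (_ + _).
  rewrite (@eq_Rintegral _ _ _ _ _ (cst ((d - c) / h))) ?Rint_cst ?lerDl ?ltW//.
    by rewrite addrAC subrr add0r divfK ?gt_eqF// addrC subrK.
  by move=> t; rewrite inE/= in_itv/= => /andP[_ ->].
apply: eq_Rint_oc; first exact: dpl_integrable.
  exact: (@dpl_integrable p c ((h, d) :: s)).
by move=> t /andP[ht _]; rewrite leNgt ht.
Qed.

Lemma int_dpl2 s p c : plwf s ->
  \int[mu]_(t in `[p, p + plen s]) (dpl p c s t ^+ 2) = penergy c s.
Proof.
elim: s p c => [|[h d] s IH] p c /= => [_|/andP[/andP[/= h0 d0] ws]].
  by rewrite Rint_cst ?addr0// subrr mulr0.
have l0 := plen_ge0 ws.
rewrite (@Rint_split _ _ _ (p + h)) ?lerD2l ?lerDl ?(ltW h0)//; last exact: (@dpl2_integrable p c ((h, d) :: s)).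
congr (_ + _).
  rewrite (@eq_Rintegral _ _ _ _ _ (cst (((d - c) / h) ^+ 2))) ?Rint_cst ?lerDl ?ltW//.
    by rewrite addrAC subrr add0r; field; rewrite gt_eqF.
  by move=> t; rewrite inE/= in_itv/= => /andP[_ ->].
rewrite -(IH (p + h))// addrA; apply: eq_Rint_oc; first exact: (@dpl2_integrable p c ((h, d) :: s)).
  exact: dpl2_integrable.
by move=> t /andP[ht _]; rewrite leNgt ht.
Qed.

Lemma pl_bounds h c d x p : 0 < h -> p <= x <= p + h ->
  Num.min c d <= c + (d - c) / h * (x - p) <= Num.max c d.
Proof.
move=> h0 /andP[px xh].
have t0 : 0 <= (x - p) / h by rewrite divr_ge0 ?subr_ge0// ltW.
have t1 : (x - p) / h <= 1 by rewrite ler_pdivrMr// mul1r; lra.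
have -> : c + (d - c) / h * (x - p) = c + (d - c) * ((x - p) / h) by ring.
by move: ((x - p) / h) t0 t1 => t t0 t1; case: (leP c d) => cd; apply/andP; split; nra.
Qed.

Lemma pl_bounded s p c : plwf s -> exists2 K : R, 0 <= K &
  forall x, p <= x <= p + plen s -> `|pl p c s x| <= K.
Proof.
elim: s p c => [|[h d] s IH] p c /= => [_|/andP[/andP[/= h0 d0] ws]].
  by exists `|c|.
have [K K0 hK] := IH (p + h) d ws.
exists (`|c| + `|d| + K); first by rewrite !addr_ge0.
move=> x /andP[px xl]; case: (leP x (p + h)) => xh.
  have := @pl_bounds h c d x p h0; rewrite px xh => /(_ isT) /andP[b1 b2].
  have := ler_norm c; have := ler_norm (- c); have := ler_norm d; have := ler_norm (- d).
  rewrite !normrN => n1 n2 n3 n4; rewrite ler_norml; apply/andP.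
  by move: b1 b2; rewrite ge_min le_max => /orP[] ? /orP[] ?; split; lra.
by apply: le_trans (hK x _) _; rewrite ?(ltW xh) ?lerDr ?addr_ge0//= -addrA.
Qed.

Lemma pl2_integrable s p c a b : plwf s -> p <= a -> b <= p + plen s ->
  mu.-integrable `[a, b] (EFin \o (fun x => pl p c s x ^+ 2)).
Proof.
move=> ws pa bp; have [K K0 hK] := pl_bounded p c ws.
apply: (@bounded_integrable _ _ _ _ (K ^+ 2)).
  by apply: measurable_funX; exact: measurable_funS (measurable_pl p c s).
move=> x /andP[ax xb]; rewrite normrX lerXn2r ?nnegrE// hK//.
by rewrite (le_trans pa ax) (le_trans xb bp).
Qed.

Lemma int_pl2 s p c : 0 <= c -> plwf s ->
  pmass c s <= \int[mu]_(t in `[p, p + plen s]) (pl p c s t ^+ 2).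
Proof.
elim: s p c => [|[h d] s IH] p c c0 /= => [_|/andP[/andP[/= h0 d0] ws]].
  by rewrite Rint_cst ?addr0// subrr mulr0.
have l0 := plen_ge0 ws.
have ws' : plwf ((h, d) :: s) by rewrite /= h0 d0.
have pi := @pl2_integrable ((h, d) :: s) p c _ _ ws'.
rewrite (@Rint_split _ _ _ (p + h)) ?lerD2l ?lerDl ?(ltW h0)//; last exact: pi.
apply: lerD.
  have -> : h * Num.min c d ^+ 2 = \int[mu]_(t in `[p, p + h]) (cst (Num.min c d ^+ 2) t).
    by rewrite Rint_cst ?lerDl ?ltW//; ring.
  apply: le_Rint; first exact: cst_integrable.
    by apply: pi => //=; lra.
  move=> x /andP[px xh]; rewrite xh.
  have := @pl_bounds h c d x p h0; rewrite px xh => /(_ isT) /andP[b1 _].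
  have m0 : 0 <= Num.min c d by rewrite le_min c0 d0.
  by rewrite lerXn2r ?nnegrE//; lra.
apply: le_trans (IH (p + h) d d0 ws) _; rewrite addrA le_eqVlt; apply/orP; left; apply/eqP.
apply: eq_Rint_oc; first exact: pl2_integrable.
  by apply: pi => /=; lra.
by move=> t /andP[ht _]; rewrite leNgt ht.
Qed.

Lemma pl_last s p c : plwf s -> pl p c s (p + plen s) = plast c s.
Proof.
elim: s p c => [|[h d] s IH] p c //= /andP[/andP[/= h0 d0] ws].
have l0 := plen_ge0 ws; rewrite /plast /= -/(plast d s) -(IH (p + h))// addrA.
case: leP => // hl; have E : plen s = 0 by lra.
rewrite E addr0 pl_start//; by field; rewrite gt_eqF.
Qed.

Lemma pl_lipschitz s p c : plwf s -> exists2 K : R, 0 <= K &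
  forall x y, p <= x <= p + plen s -> p <= y <= p + plen s ->
    `|pl p c s x - pl p c s y| <= K * `|x - y|.
Proof.
move=> ws; have [K K0 hK] := dpl_bounded p c s; exists K => // x y.
wlog xy : x y / x <= y.
  move=> h hx hy; have [xy|/ltW yx] := leP x y; first exact: h.
  by rewrite distrC (distrC x); exact: h.
move=> hx hy; rewrite !pl_ftc//; case/andP: hx => px xl; case/andP: hy => py yl.
rewrite (@Rint_split _ _ _ x _ px xy); last exact: dpl_integrable.
rewrite opprD addrA opprD addrACA addrA [X in `|X|](_ : _ = - \int[mu]_(t in `[x, y]) dpl p c s t); last by ring.
rewrite normrN distrC (@ger0_norm _ (y - x)) ?subr_ge0//.
apply: le_trans (@le_normr_Rintegral _ _ _ _ _ _ _ _) _ => //; first exact: dpl_integrable.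
have -> : K * (y - x) = \int[mu]_(t in `[x, y]) (cst K t) by rewrite Rint_cst.
apply: le_Rint => //; [|exact: cst_integrable].
apply: (@bounded_integrable _ _ _ _ K).
  apply: measurableT_comp => //; exact: measurable_funS (measurable_dpl p c s).
by move=> t _; rewrite normr_id.
Qed.

End PL.

(** * Testing lambda1 with piecewise linear functions *)

Section PLGraph.
Context {R : realType} (H : mgraph R).
Implicit Types (phi : vertex H -> R) (s : edge H -> seq (R * R)).

(** Nonnegativity is what makes pmass a lower bound for the mass; no generality
is lost, since |f| has the same Rayleigh quotient as f. *)
Definition plok phi s := (forall v, 0 <= phi v) /\ forall e,
  [/\ plwf (s e), plen (s e) = len e & plast (phi (src e)) (s e) = phi (tgt e)].

Definition gmass phi s := \sum_(e : edge H) pmass (phi (src e)) (s e).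
Definition gnum (c : vertex H -> R) phi s :=
  \sum_(e : edge H) penergy (phi (src e)) (s e) + \sum_(v : vertex H) c v * phi v ^+ 2.

Lemma gmass_ge0 phi s : plok phi s -> 0 <= gmass phi s.
Proof. by move=> [_ h]; apply: sumr_ge0 => e _; apply: pmass_ge0; have [] := h e. Qed.

Lemma gnum_ge0 c phi s : plok phi s -> (forall v, 0 <= c v) -> 0 <= gnum c phi s.
Proof.
move=> [_ h] c0; apply: addr_ge0; apply: sumr_ge0 => i _.
  by apply: penergy_ge0; have [] := h i.
by rewrite mulr_ge0// sqr_ge0.
Qed.

Definition pfun phi s : gpoint H -> R := fun p => match p with
  | inl v => phi v
  | inr q => pl 0 (phi (src (val q).1)) (s (val q).1) (val q).2
  end.

Lemma pfun_loc phi s e (x : R) : plok phi s -> 0 <= x <= len e ->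
  pfun phi s (loc e x) = pl 0 (phi (src e)) (s e) x.
Proof.
move=> [_ /(_ e)[ws ls es]] /andP[x0 xl].
case: (ltgtP 0 x) x0 => // [x0 _|<- _]; last by rewrite loc0 /= pl_start.
case: (ltgtP x (len e)) xl => // [xl _|-> _].
  have h : 0 < x < len e by rewrite x0.
  by rewrite (loc_in h).
by rewrite loc_len /= -ls -[plen _]add0r pl_last// es.
Qed.

Lemma pfun_continuous phi s : plok phi s -> continuous (pfun phi s).
Proof.
move=> ok.
have lip e : exists K : R, 0 <= K /\ forall x y : R, 0 <= x <= len e -> 0 <= y <= len e ->
    `|pfun phi s (loc e x) - pfun phi s (loc e y)| <= K * `|x - y|.
  have [ws ls _] := ok.2 e; have [K K0 hK] := pl_lipschitz 0 (phi (src e)) ws.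
  by exists K; split=> // x y hx hy; rewrite !pfun_loc// hK// add0r ls.
have [K hK] := choice lip.
apply: (@lipschitz_continuous _ _ _ (\sum_e K e)) => e x y hx hy.
apply: le_trans (proj2 (hK e) x y hx hy) _; rewrite ler_wpM2r//.
rewrite (bigD1 e)//= lerDl; apply: sumr_ge0 => i _; exact: (proj1 (hK i)).
Qed.

End PLGraph.

Section Lambda1.
Context {R : realType} {G : mgraph R}.
Implicit Types (O : subgraph G) (a r : R).
Local Notation mu := (@lebesgue_measure R).

Definition bweight a O (v : vertex O) : R := a * (effdeg (inl v : gpoint O))%:R.

Lemma bweight_ge0 a O (v : vertex O) : 0 <= a -> 0 <= bweight a v.
Proof. by move=> a0; rewrite mulr_ge0. Qed.

Lemma rayleigh_ge0 a O (f : gpoint O -> R) f' : 0 <= a -> 0 <= rayleigh a f f'.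
Proof.
move=> a0; rewrite /rayleigh sum_descendants divr_ge0//; last first.
  by apply: sumr_ge0 => e _; apply: Rintegral_ge0 => x _; exact: sqr_ge0.
apply: addr_ge0; apply: sumr_ge0 => i _; last by apply: mulr_ge0; rewrite ?sqr_ge0 ?mulr_ge0.
by apply: Rintegral_ge0 => x _; exact: sqr_ge0.
Qed.

Lemma pfun_H1 O (phi : vertex O -> R) s : plok phi s ->
  H1 (pfun phi s) (fun e => dpl 0 (phi (src e)) (s e)).
Proof.
move=> ok; split=> [|e]; first exact: pfun_continuous.
have [ws ls es] := ok.2 e; have l0 := ltW (len_gt0 e).
split; first exact: measurable_funS (measurable_dpl _ _ _).
  exact: dpl2_integrable.
move=> x; rewrite in_itv/= => xe; rewrite !pfun_loc//; last by rewrite lexx.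
by rewrite pl_start// pl_ftc// add0r ls.
Qed.

Lemma gmass_le_int O (phi : vertex O -> R) s : plok phi s -> gmass phi s <=
  \sum_(e : edge O) \int[mu]_(x in `[0, len e]) (pfun phi s (loc e x) ^+ 2).
Proof.
move=> ok; apply: ler_sum => e _; have [ws ls _] := ok.2 e.
have -> : \int[mu]_(x in `[0, len e]) (pfun phi s (loc e x) ^+ 2) =
    \int[mu]_(x in `[0, len e]) (pl 0 (phi (src e)) (s e) x ^+ 2).
  by apply: eq_Rintegral => x; rewrite inE/= in_itv/= => xe; rewrite pfun_loc.
by rewrite -ls -[plen _]add0r; apply: int_pl2 => //; exact: ok.1.
Qed.

Lemma rayleigh_pfun a O (phi : vertex O -> R) s : 0 <= a -> plok phi s ->
  0 < gmass phi s ->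
  rayleigh a (pfun phi s) (fun e => dpl 0 (phi (src e)) (s e)) <=
  gnum (@bweight a O) phi s / gmass phi s.
Proof.
move=> a0 ok m0.
have -> : gnum (@bweight a O) phi s =
  \sum_(e : edge O) \int[mu]_(x in `[0, len e]) (dpl 0 (phi (src e)) (s e) x ^+ 2)
   + \sum_(v \in @descendants R G O) a * (effdeg v)%:R * pfun phi s v ^+ 2.
  rewrite sum_descendants; congr (_ + _); apply: eq_bigr => e _.
  by have [ws ls _] := ok.2 e; rewrite -ls -[plen _]add0r int_dpl2.
have mm := gmass_le_int ok.
rewrite /rayleigh ler_wpM2l ?lef_pV2 ?posrE//; last exact: lt_le_trans mm.
rewrite sum_descendants; apply: addr_ge0; apply: sumr_ge0 => i _.
  by apply: Rintegral_ge0 => x _; exact: sqr_ge0.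
by apply: mulr_ge0; rewrite ?sqr_ge0 ?mulr_ge0.
Qed.

Lemma pfun_neq0 O (phi : vertex O -> R) s : plok phi s -> 0 < gmass phi s ->
  exists p, pfun phi s p != 0.
Proof.
move=> ok m0; apply: contrapT => nz.
have z p : pfun phi s p = 0.
  by apply: contrapT => /eqP hp; apply: nz; exists p.
suff : gmass phi s <= 0 by rewrite leNgt m0.
have mm := gmass_le_int ok.
apply: le_trans mm _; rewrite big1// => e _.
rewrite (@eq_Rintegral _ _ _ _ _ (cst 0)) ?Rint_cst ?mul0r// ?(ltW (len_gt0 e))//.
by move=> x _; rewrite z expr0n.
Qed.

Lemma lambda1_has_inf a O : 0 <= a ->
  has_inf [set r | exists f f',
    [/\ @H1 R G O f f', exists p, f p != 0 & r = rayleigh a f f']].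
Proof.
move=> a0; split; last first.
  by exists 0 => r [f [f' [_ _ ->]]]; exact: rayleigh_ge0.
pose phi := fun _ : vertex O => 1 : R; pose s := fun e : edge O => [:: (len e, 1 : R)].
have ok : plok phi s.
  by split=> [v|e]; rewrite /s /= ?len_gt0 ?ler01 ?addr0.
exists (rayleigh a (pfun phi s) (fun e => dpl 0 (phi (src e)) (s e))).
exists (pfun phi s), (fun e => dpl 0 (phi (src e)) (s e)); split=> //.
  exact: pfun_H1.
have /card_gt0P[e _] := edge_ex O.
by exists (inl (src e)); rewrite /= oner_neq0.
Qed.

Lemma lambda1_ge0 a O : 0 <= a -> 0 <= lambda1 a O.
Proof.
move=> a0; apply: lb_le_inf; first by have [] := lambda1_has_inf O a0.
by move=> r [f [f' [_ _ ->]]]; exact: rayleigh_ge0.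
Qed.

Lemma lambda1_le a O (phi : vertex O -> R) s : 0 <= a -> plok phi s ->
  lambda1 a O * gmass phi s <= gnum (@bweight a O) phi s.
Proof.
move=> a0 ok; have := gmass_ge0 ok; rewrite le_eqVlt => /predU1P[<-|m0].
  by rewrite mulr0; apply: gnum_ge0 => // v; exact: bweight_ge0.
rewrite -ler_pdivlMr//; apply: le_trans (rayleigh_pfun a0 ok m0).
apply: ge_inf; first by have [] := lambda1_has_inf O a0.
by exists (pfun phi s), (fun e => dpl 0 (phi (src e)) (s e)); split=> //;
  [exact: pfun_H1|exact: pfun_neq0 m0].
Qed.

End Lambda1.

Section Interpolation.
Context {R : realType}.

Lemma sqr_dist_norm (x y : R) : (`|x| - `|y|) ^+ 2 <= (x - y) ^+ 2.
Proof.
rewrite -(real_normK (num_real (`|x| - `|y|))) -(real_normK (num_real (x - y))).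
by rewrite lerXn2r ?nnegrE//; exact: ler_dist_dist.
Qed.

Local Notation mu := (@lebesgue_measure R).
Context (l : R) (u u' : R -> R).
Hypothesis l0 : 0 < l.
Hypothesis uH : H1_interval l u u'.
Hypothesis u_int : mu.-integrable `[0, l] (EFin \o (fun x => u x ^+ 2)).

Let u'2i : mu.-integrable `[0, l] (EFin \o (fun x => u' x ^+ 2)).
Proof. by case: uH. Qed.

Let u'i : mu.-integrable `[0, l] (EFin \o u').
Proof.
have h : mu.-integrable `[0, l] (EFin \o (fun x => u' x ^+ 2 + 1)).
  rewrite (_ : EFin \o _ = (EFin \o (fun x => u' x ^+ 2)%R) \+ (EFin \o cst (1%R : R)))%E.
    by apply: integrableD => //; exact: cst_integrable.
  by apply/funext => x /=; rewrite EFinD.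
apply: le_integrable h => //; first by apply/measurable_EFinP; case: uH.
move=> x _ /=; rewrite lee_fin (@ger0_norm _ (_ + 1)) ?addr_ge0 ?sqr_ge0//.
rewrite -(real_normK (num_real (u' x))); have := normr_ge0 (u' x); nra.
Qed.

(** Integrate (u' - m) ^+ 2 >= 0, where m is the slope of the chord. *)
Lemma increment_energy x y : 0 <= x -> x <= y -> y <= l ->
  (u y - u x) ^+ 2 <= (y - x) * \int[mu]_(t in `[x, y]) (u' t ^+ 2).
Proof.
move=> x0 xy yl; have [_ _ ftc] := uH.
have E : u y - u x = \int[mu]_(t in `[x, y]) u' t.
  rewrite (ftc y) ?(ftc x) ?in_itv/= ?x0 ?(le_trans x0 xy) ?(le_trans xy yl)//.
  rewrite (@Rint_split _ _ 0 x y)//; first by ring.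
  exact: integrable_sub u'i.
case: (ltgtP x y) xy => // [xy _|<- _]; last by rewrite !subrr mul0r expr0n.
set J := \int[mu]_(t in _) _; have d0 : 0 < y - x by rewrite subr_gt0.
have ui := integrable_sub x0 yl u'i; have u2i := integrable_sub x0 yl u'2i.
pose m := (u y - u x) / (y - x).
have mE : \int[mu]_(t in `[x, y]) (2 * m * u' t - m ^+ 2) = m * (u y - u x).
  rewrite RintegralB//; last exact: cst_integrable.
    rewrite RintegralZl// Rint_cst ?ltW// -E /m; field; exact: lt0r_neq0.
  rewrite (_ : EFin \o _ = (fun t => (2 * m)%R%:E * (EFin \o u') t)%E).
    exact: integrableZl.
  by apply/funext => t /=; rewrite EFinM.
have : m * (u y - u x) <= J.
  rewrite -mE; apply: le_Rint => //.
    rewrite (_ : EFin \o _ = (fun t => (2 * m)%R%:E * (EFin \o u') t) \- (EFin \o cst (m ^+ 2)%R))%E.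
      by apply: integrableB => //; [exact: integrableZl|exact: cst_integrable].
    by apply/funext => t /=; rewrite EFinB EFinM.
  by move=> t _; have := sqr_ge0 (u' t - m); nra.
rewrite /m => h; have : (y - x) * ((u y - u x) / (y - x) * (u y - u x)) <= (y - x) * J.
  by apply: ler_wpM2l => //; exact: ltW.
apply: le_trans; rewrite le_eqVlt; apply/orP; left; apply/eqP; field; exact: lt0r_neq0.
Qed.

Let D := \int[mu]_(t in `[0, l]) (u' t ^+ 2).

Let D0 : 0 <= D.
Proof. by apply: Rintegral_ge0 => x _; exact: sqr_ge0. Qed.

Let sub_energy x y : 0 <= x -> x <= y -> y <= l ->
  \int[mu]_(t in `[x, y]) (u' t ^+ 2) <= D.
Proof.
move=> x0 xy yl; rewrite /D (@Rint_split _ _ 0 x l)//; last exact: le_trans yl.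
rewrite (@Rint_split _ _ x y l)//; last exact: integrable_sub u'2i.
by have := int_sqr_ge0 u' 0 x; have := int_sqr_ge0 u' y l; lra.
Qed.

Lemma increment_modulus x y : 0 <= x <= l -> 0 <= y <= l ->
  (u y - u x) ^+ 2 <= `|y - x| * D.
Proof.
wlog xy : x y / x <= y.
  move=> h hx hy; have [xy|/ltW yx] := leP x y; first exact: h.
  by rewrite -sqrrN opprB distrC; exact: h.
move=> /andP[x0 xl] /andP[y0 yl]; rewrite ger0_norm ?subr_ge0//.
apply: le_trans (increment_energy x0 xy yl) _.
by rewrite ler_wpM2l ?subr_ge0// sub_energy.
Qed.

Fixpoint interp (h x : R) (n : nat) : seq (R * R) :=
  if n is n'.+1 then (h, `|u (x + h)|) :: interp h (x + h) n' else [::].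

Lemma interp_wf h x n : 0 < h -> plwf (interp h x n).
Proof. by move=> h0; elim: n x => //= n IH x; rewrite h0 normr_ge0 IH. Qed.

Lemma interp_len h x n : plen (interp h x n) = n%:R * h.
Proof.
by elim: n x => [|n IH] x /=; rewrite ?mul0r// IH mulrSr mulrDl mul1r addrC.
Qed.

Lemma interp_last h x n : plast `|u x| (interp h x n) = `|u (x + n%:R * h)|.
Proof.
elim: n x => [|n IH] x /=; first by rewrite mul0r addr0.
by rewrite /plast /= -/(plast _ _) IH mulrSr mulrDl mul1r -addrA [h + _]addrC.
Qed.

Lemma interp_energy h x n : 0 < h -> 0 <= x -> x + n%:R * h <= l ->
  penergy `|u x| (interp h x n) <= \int[mu]_(t in `[x, x + n%:R * h]) (u' t ^+ 2).
Proof.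
move=> h0; elim: n x => [|n IH] x x0 xl /=.
  by apply: Rintegral_ge0 => t _; exact: sqr_ge0.
move: xl; have -> : x + n.+1%:R * h = x + h + n%:R * h by rewrite -natr1; ring.
move=> xl; have nh : 0 <= n%:R * h by apply: mulr_ge0 => //; exact: ltW.
rewrite (@Rint_split _ _ x (x + h)); [|lra|lra|by apply: integrable_sub u'2i; lra].
apply: lerD; last by apply: IH; lra.
rewrite ler_pdivrMr// mulrC.
have xh : x <= x + h by lra.
have xhl : x + h <= l by lra.
have I := increment_energy x0 xh xhl.
have hh : x + h - x = h by ring.
rewrite hh in I; apply: le_trans I; exact: sqr_dist_norm.
Qed.

(** By the modulus of continuity of u, |u| exceeds the smaller of its values at
the ends of a cell by at most eps on this cell. *)
Lemma interp_mass (K eps h x : R) n : 0 < h -> 0 <= eps -> h * D <= eps ^+ 2 ->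
  (forall t, 0 <= t <= l -> `|u t| <= K) -> 0 <= x -> x + n%:R * h <= l ->
  \int[mu]_(t in `[x, x + n%:R * h]) (u t ^+ 2) <=
  pmass `|u x| (interp h x n) + n%:R * h * (2 * eps * K + eps ^+ 2).
Proof.
move=> h0 eps0 hD hK; elim: n x => [|n IH] x x0 xl /=.
  by rewrite !mul0r !addr0 set_itv1 Rintegral_set1.
move: xl; have -> : x + n.+1%:R * h = x + h + n%:R * h by rewrite -natr1; ring.
move=> xl; have nh : 0 <= n%:R * h by apply: mulr_ge0 => //; exact: ltW.
rewrite (@Rint_split _ _ x (x + h)); [|lra|lra|by apply: integrable_sub u_int; lra].
have := IH (x + h); rewrite -natr1 => /(_ _ xl).
have i1 : 0 <= x + h by lra.
move=> /(_ i1).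
suff : \int[mu]_(t in `[x, x + h]) (u t ^+ 2) <=
    h * (Num.min `|u x| `|u (x + h)| ^+ 2 + (2 * eps * K + eps ^+ 2)) by lra.
set m := Num.min _ _; set k := m ^+ 2 + _.
have -> : h * k = \int[mu]_(t in `[x, x + h]) (cst k t).
  by rewrite Rint_cst ?lerDl ?ltW//; ring.
apply: le_Rint; [by apply: integrable_sub u_int; lra|exact: cst_integrable|].
move=> t /andP[xt th].
have xin : 0 <= x <= l by apply/andP; split; lra.
have xhin : 0 <= x + h <= l by apply/andP; split; lra.
have tin : 0 <= t <= l by apply/andP; split; lra.
have near_ y : 0 <= y <= l -> `|t - y| <= h -> `|u t| <= `|u y| + eps.
  move=> yin ty; rewrite -lerBlDl; apply: le_trans (lerB_dist _ _) _.
  rewrite -(ler_pXn2r (n := 2)) ?nnegrE// real_normK ?num_real//.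
  apply: le_trans (increment_modulus yin tin) _; apply: le_trans hD.
  by rewrite ler_wpM2r.
have n1 := near_ x xin; have n2 := near_ (x + h) xhin.
have {n1}n1 : `|u t| <= `|u x| + eps by apply: n1; rewrite ger0_norm; lra.
have {n2}n2 : `|u t| <= `|u (x + h)| + eps by apply: n2; rewrite ler0_norm; lra.
have tm : `|u t| <= m + eps by rewrite /m /Num.min; case: ifP.
have m0 : 0 <= m by rewrite le_min !normr_ge0.
have mK : m <= K by rewrite ge_min hK.
rewrite -(real_normK (num_real (u t))); have := normr_ge0 (u t); rewrite /k.
have e1 : eps * m <= eps * K by rewrite ler_wpM2l.
move: `|u t| tm => w tm w0.
have : w ^+ 2 <= (m + eps) ^+ 2 by rewrite lerXn2r ?nnegrE// addr_ge0.
by rewrite /=; nra.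
Qed.

(** By the two previous lemmas, on a uniform mesh of step h with
h * D <= eps ^+ 2 for a small eps. *)
Lemma interpolation (eta : R) : 0 < eta -> exists s : seq (R * R),
  [/\ plwf s, plen s = l, plast `|u 0| s = `|u l|,
      penergy `|u 0| s <= \int[mu]_(t in `[0, l]) (u' t ^+ 2) &
      \int[mu]_(t in `[0, l]) (u t ^+ 2) - eta <= pmass `|u 0| s].
Proof.
move=> eta0; pose K := `|u 0| + l * D + 1.
have lD0 : 0 <= l * D by rewrite mulr_ge0// ltW.
have K0 : 0 < K by rewrite /K; have := normr_ge0 (u 0); lra.
have hK t : 0 <= t <= l -> `|u t| <= K.
  move=> tin; have zin : (0 : R) <= 0 <= l by rewrite lexx (ltW l0).
  have := increment_modulus zin tin; rewrite subr0 => h.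
  have {}h : (u t - u 0) ^+ 2 <= l * D.
    apply: le_trans h _; rewrite ler_wpM2r//; case/andP: tin => t0 tl.
    by rewrite ger0_norm.
  have := ler_distD 0 (u t) (u 0); have := lerB_dist (u t) (u 0).
  have := normr_ge0 (u t - u 0); rewrite -(real_normK (num_real (u t - u 0))) in h.
  by move: `|u t - u 0| h => w h w0 h1 _; rewrite /K; nra.
pose eps := Num.min 1 (eta / (l * (2 * K + 1))).
have q0 : 0 < l * (2 * K + 1) by rewrite mulr_gt0//; lra.
have eps0 : 0 < eps by rewrite lt_min ltr01 divr_gt0.
have eps1 : eps <= 1 by rewrite ge_min lexx.
have epsl : eps * (l * (2 * K + 1)) <= eta by rewrite -ler_pdivlMr// ge_min lexx orbT.
pose N := (Num.trunc (l * D / eps ^+ 2)).+1.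
have e20 : 0 < eps ^+ 2 by rewrite exprn_gt0.
have hN : l * D < N%:R * eps ^+ 2.
  rewrite -ltr_pdivrMr// /N; apply: truncnS_gt.
have N0 : 0 < N%:R :> R by rewrite ltr0n.
pose h := l / N%:R; have h0 : 0 < h by rewrite divr_gt0.
have Nh : N%:R * h = l by rewrite /h mulrC divfK ?gt_eqF.
have hD : h * D <= eps ^+ 2.
  by rewrite /h mulrAC ler_pdivrMr// mulrC [leRHS]mulrC ltW// mulrC.
exists (interp h 0 N); split.
- exact: interp_wf.
- by rewrite interp_len.
- by rewrite interp_last Nh add0r.
- by have := @interp_energy h 0 N h0 (lexx _); rewrite add0r Nh => /(_ (lexx _)).
have := @interp_mass K eps h 0 N h0 (ltW eps0) hD hK (lexx _).
rewrite add0r Nh => /(_ (lexx _)).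
suff : l * (2 * eps * K + eps ^+ 2) <= eta by lra.
apply: le_trans epsl; rewrite mulrCA ler_wpM2l ?(ltW l0)//; nra.
Qed.

(** u stays away from 0 on an interval around x0. *)
Lemma int_sqr_gt0 x0 : 0 <= x0 <= l -> u x0 != 0 ->
  0 < \int[mu]_(t in `[0, l]) (u t ^+ 2).
Proof.
move=> xin ux; have c0 : 0 < `|u x0| by rewrite normr_gt0.
set c := `|u x0| in c0.
have D1 : 0 < D + 1 by rewrite ltr_wpDl.
pose d := Num.min (c ^+ 2 / 4 / (D + 1)) l.
have d0 : 0 < d by rewrite lt_min l0 !divr_gt0 ?exprn_gt0.
have dD : d * (D + 1) <= c ^+ 2 / 4 by rewrite -ler_pdivlMr// ge_min lexx.
pose a := Num.max 0 (x0 - d); pose b := Num.min l (x0 + d).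
case/andP: (xin) => x00 xl.
have [a0 ax ax'] : [/\ 0 <= a, x0 - d <= a & a <= x0].
  by rewrite /a !le_max ge_max !lexx orbT; split=> //; apply/andP; split; lra.
have [bl bx bx'] : [/\ b <= l, b <= x0 + d & x0 <= b].
  by rewrite /b !ge_min le_min !lexx orbT; split=> //; apply/andP; split; lra.
have ab : a < b.
  rewrite /a /b gt_max !lt_min; apply/and3P; split; [apply/andP; split=> //; apply: ltr_wpDl => // | apply: lt_le_trans xl; rewrite ltrBlDr ltrDl // | by rewrite ltrBlDr -addrA ltrDl addr_gt0 ].
rewrite (@Rint_split _ _ 0 a l)//; [|lra].
rewrite (@Rint_split _ _ a b l)//; [|lra|by apply: integrable_sub u_int; lra].
suff : (c / 2) ^+ 2 * (b - a) <= \int[mu]_(t in `[a, b]) (u t ^+ 2).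
  have : 0 < (c / 2) ^+ 2 * (b - a) by rewrite mulr_gt0 ?exprn_gt0 ?divr_gt0// subr_gt0.
  by have := int_sqr_ge0 u 0 a; have := int_sqr_ge0 u b l; lra.
have -> : (c / 2) ^+ 2 * (b - a) = \int[mu]_(t in `[a, b]) (cst ((c / 2) ^+ 2) t).
  by rewrite Rint_cst//; exact: ltW.
apply: le_Rint; [exact: cst_integrable|by apply: integrable_sub u_int|].
move=> t /andP[at_ tb]; have tin : 0 <= t <= l by apply/andP; split; lra.
have := increment_modulus xin tin => h.
have td : `|t - x0| <= d by rewrite ler_norml; apply/andP; split; lra.
have {}h : `|u t - u x0| ^+ 2 <= (c / 2) ^+ 2.
  rewrite real_normK ?num_real//; apply: le_trans h _.
  have := ler_wpM2r D0 td; have := dD; rewrite expr2; nra.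
have c2 : 0 <= c / 2 by rewrite divr_ge0 ?(ltW c0).
rewrite ler_pXn2r ?nnegrE// in h.
rewrite -[u t ^+ 2](real_normK (num_real _)) /= lerXn2r ?nnegrE//.
have := lerB_dist (u x0) (u t); rewrite distrC -/c.
by lra.
Qed.

End Interpolation.

(** * Approximation by piecewise linear functions *)

Section Approx.
Context {R : realType} {G : mgraph R}.
Implicit Types (O : subgraph G) (a r : R).
Local Notation mu := (@lebesgue_measure R).

Lemma sqr_integrable O (f : gpoint O -> R) (e : edge O) : continuous f ->
  mu.-integrable `[0, len e] (EFin \o (fun x => f (loc e x) ^+ 2)).
Proof.
move=> fc; apply: continuous_compact_integrable; first exact: segment_compact.
have c : {within `[0, len e], continuous (fun x => f (loc e x))}.
  apply/subspace_continuousP => x xe.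
  apply: (@cvg_comp _ _ _ (loc e) f _ (nbhs (loc e x))); last exact: fc.
  by move: xe; apply: (proj1 (@subspace_continuousP _ _ _ _)); exact: loc_continuous.
by move=> x; exact: (cvgM (c x) (c x)).
Qed.

(** Interpolating |f| on a fine mesh keeps the boundary term, does not increase
the energy, and almost preserves the mass. Together with lambda1_le this
reduces every question about lambda1 to finite sums. *)
Lemma lambda1_approx a O r : 0 <= a -> lambda1 a O < r ->
  exists (phi : vertex O -> R) s, [/\ plok phi s, 0 < gmass phi s &
    gnum (@bweight _ _ a O) phi s < r * gmass phi s].
Proof.
move=> a0 lr; have [ne _] := lambda1_has_inf O a0.
have [f [f' [[fc fH] [p fp] fr]]] : exists f f', [/\ @H1 R G O f f', exists p, f p != 0 &
    rayleigh a f f' < r].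
  apply: contrapT => no; have : r <= lambda1 a O.
    apply: lb_le_inf => // q [f [f' [h1 h2 ->]]]; rewrite leNgt; apply/negP => h3.
    by apply: no; exists f, f'.
  by rewrite leNgt lr.
have fi e := @sqr_integrable O f e fc.
move: fr; rewrite /rayleigh sum_descendants.
set N := (_ + _); set M := (\sum_(e : edge O) _) => fr.
have M0 : 0 < M.
  have [e [x [xe px]]] : exists (e : edge O) x, 0 <= x <= len e /\ p = loc e x.
    case: (pointP p) => [[v ->]|[e [x [/andP[x0 xl] ->]]]]; last first.
      by exists e, x; rewrite !ltW.
    have [z <-] := vertex_endv v.
    by exists z.1, (endx z); rewrite endx_in loc_endx.
  have h := @int_sqr_gt0 R (len e) _ _ (len_gt0 e) (fH e) (fi e) x xe.
  rewrite /M (bigD1 e)//= ltr_wpDr//; last by apply: h; rewrite -px.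
  by apply: sumr_ge0 => i _; exact: (int_sqr_ge0 (fun x => f (loc i x))).
have N0 : 0 <= N.
  apply: addr_ge0; apply: sumr_ge0 => i _; first exact: int_sqr_ge0.
  by apply: mulr_ge0; rewrite ?sqr_ge0 ?mulr_ge0.
rewrite ltr_pdivrMr// in fr.
have r0 : 0 < r by rewrite -(pmulr_lgt0 _ M0); exact: le_lt_trans fr.
pose n : R := #|edge O|%:R; have n0 : 0 < n by rewrite ltr0n edge_ex.
pose eta := (r * M - N) / (2 * r).
have eta0 : 0 < eta by rewrite divr_gt0 ?subr_gt0// mulr_gt0.
have en0 : 0 < eta / n by rewrite divr_gt0.
have /choice[s hs] : forall e : edge O, exists s : seq (R * R),
  [/\ plwf s, plen s = len e, plast `|f (inl (src e))| s = `|f (inl (tgt e))|,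
      penergy `|f (inl (src e))| s <= \int[mu]_(t in `[0, len e]) (f' e t ^+ 2) &
      \int[mu]_(t in `[0, len e]) (f (loc e t) ^+ 2) - eta / n <= pmass `|f (inl (src e))| s].
  move=> e; have [s] := interpolation (len_gt0 e) (fH e) (fi e) en0.
  by rewrite loc0 loc_len; exists s.
pose phi v := `|f (inl v)|.
have ok : plok phi s by split=> [v|e]; [exact: normr_ge0|have [] := hs e].
have gn : gnum (@bweight _ _ a O) phi s <= N.
  apply: lerD; first by apply: ler_sum => e _; have [] := hs e.
  by apply: ler_sum => v _; rewrite /bweight /phi real_normK ?num_real.
have gm : M - eta <= gmass phi s.
  have -> : eta = \sum_(e : edge O) eta / n.
    by rewrite sumr_const -[_ *+ _]mulr_natr -/n divfK ?gt_eqF.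
  by rewrite /M -sumrB; apply: ler_sum => e _; have [] := hs e.
have key : N < r * gmass phi s.
  have : r * (M - eta) <= r * gmass phi s by rewrite ler_wpM2l ?(ltW r0).
  have -> : r * (M - eta) = (r * M + N) / 2 by rewrite /eta; field; exact: lt0r_neq0.
  by move: fr; clear; lra.
exists phi, s; split=> //; last exact: le_lt_trans key.
by rewrite -(pmulr_rgt0 _ r0); exact: le_lt_trans key.
Qed.

End Approx.

(** * Gluing segments, and merging at dummy vertices *)

Section Builder.
Context {R : realType} (G : mgraph R) (E L : finType).
Context (hst : E -> edge G) (ofs ln : E -> R) (rho : E * bool -> L) (pos : L -> gpoint G).
Hypothesis E_ex : (0 < #|E|)%N.
Hypothesis ln_gt0 : forall e, 0 < ln e.
Hypothesis ofs_ge0 : forall e, 0 <= ofs e.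
Hypothesis ofs_le : forall e, ofs e + ln e <= len (hst e).
Hypothesis pos_rho : forall z, pos (rho z) = loc (hst z.1) (ofs z.1 + if z.2 then ln z.1 else 0).
Hypothesis nonoverlap : forall e e', e <> e' -> hst e = hst e' ->
  ofs e + ln e <= ofs e' \/ ofs e' + ln e' <= ofs e.

Definition glued_end z : {l | l \in codom rho} := Sub (rho z) (codom_f rho z).

Definition glued_graph : mgraph R :=
  MGraph (fun e => glued_end (e, false)) (fun e => glued_end (e, true)) ln_gt0 E_ex.

Definition glued_proj (p : gpoint glued_graph) : gpoint G := match p with
  | inl v => pos (val v)
  | inr q => loc (hst (val q).1) (ofs (val q).1 + (val q).2)
  end.

Lemma glued_proj_loc (e : edge glued_graph) (x : R) : x \in `[0, len e] ->
  glued_proj (loc e x) = loc (hst e) (ofs e + x).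
Proof.
rewrite in_itv/= => /andP[x0 xl].
case: (ltgtP 0 x) x0 => // [x0 _|<- _]; last by rewrite loc0 /= pos_rho.
case: (ltgtP x (ln e)) xl => // [xl _|-> _].
  have h : 0 < x < len (e : edge glued_graph) by rewrite x0.
  by rewrite (loc_in h).
by rewrite (@loc_len _ glued_graph e) /= pos_rho.
Qed.

Lemma glued_proj_inj p q : glued_proj (inr p) = glued_proj (inr q) -> p = q.
Proof.
case: p => -[e x] /= hx; case: q => -[e' y] /= hy.
have o1 := ofs_ge0 e; have o2 := ofs_le e; have o3 := ofs_ge0 e'; have o4 := ofs_le e'.
case/andP: (hx) => x0 xl; case/andP: (hy) => y0 yl.
have i1 : 0 < ofs e + x < len (hst e) by apply/andP; split; lra.
have i2 : 0 <= ofs e' + y <= len (hst e') by apply/andP; split; lra.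
move=> /(loc_inr i1 i2)[hh xy]; apply: val_inj => /=.
have [ee|/eqP ee] := eqVneq e e'; first by subst e'; congr (_, _); lra.
by have := nonoverlap ee hh; clear hh; move=> ?; exfalso; lra.
Qed.

Lemma glued_vertex_end (v : vertex glued_graph) :
  exists e : edge glued_graph, src e = v \/ tgt e = v.
Proof.
have /codomP[[e b] E0] := valP v.
by exists e; case: b E0 => E0; [right|left]; apply: val_inj; rewrite /= -E0.
Qed.

(** Segments of edges of G, whose ends are glued when they have the same label.
Labels carried by no end are dropped, so that deleting segments is harmless. *)
Definition glued : subgraph G :=
  @Subgraph R G glued_graph hst ofs glued_proj ofs_ge0 ofs_le glued_proj_loc
    glued_proj_inj glued_vertex_end.

Lemma glue_deg (v : vertex glued) :
  deg (inl v : gpoint glued) = #|[pred z : E * bool | rho z == val v]|.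
Proof.
rewrite deg_ends; apply: eq_card => -[e b]; rewrite !inE.
by rewrite -(inj_eq val_inj) /endv; case: b.
Qed.

Lemma glue_effdeg (v : vertex glued) : effdeg (inl v : gpoint glued) =
  (let d := #|[pred z : E * bool | rho z == val v]| in
   minn d (deg (pos (val v)) - d)).
Proof. by rewrite effdeg_inl glue_deg. Qed.

End Builder.

Section Merge.
Context {R : realType} {G : mgraph R}.
Implicit Types (O Q : subgraph G) (a : R).

(** Two ends on the same side of a point would belong to overlapping
segments. *)
Lemma ends_at_interior O (z z' : edge O * bool) q :
  sproj (inl (endv z) : gpoint O) = inr q -> endv z = endv z' -> z <> z' ->
  [/\ host z.1 = host z'.1, off z.1 + endx z = off z'.1 + endx z',
      z.2 <> z'.2 & z.1 <> z'.1].
Proof.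
move=> zq zz' nz; have [E [y [yE qE]]] := point_inr q.
have I (w : edge O * bool) : sproj (inl (endv w) : gpoint O) = inr q ->
    E = host w.1 /\ y = off w.1 + endx w.
  rewrite qE sproj_endv => /esym; apply: loc_inr => //.
  by apply: seg_sub; exact: endx_in.
have [h1 y1] := I _ zq; have [h2 y2] : E = host z'.1 /\ y = off z'.1 + endx z'.
  by apply: I; rewrite -zz'.
have hh : host z.1 = host z'.1 by rewrite -h1.
have b12 : z.2 <> z'.2.
  move=> b12; have e12 : z.1 <> z'.1.
    by move=> e12; apply: nz; rewrite [z]surjective_pairing [z']surjective_pairing e12 b12.
  have := nov_self e12 hh; have := len_gt0 z.1; have := len_gt0 z'.1.
  move: y1; rewrite y2 /endx b12; clear; case: z'.2 => ? ? ? ?; lra.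
split=> //; first by rewrite -y1.
move=> e12; have := len_gt0 z.1; move: y1 b12; rewrite y2 /endx -e12; clear.
by case: z'.2; case: z.2 => // ? _ ?; lra.
Qed.

Section MergeAt.
Context (O : subgraph G) (e e' : edge O) (q : {p : edge G * R | 0 < p.2 < len p.1}).
Hypothesis ev : tgt e = src e'.
Hypothesis vq : sproj (inl (tgt e) : gpoint O) = inr q.

Let ends_v z : endv z = tgt e -> z = (e, true) \/ z = (e', false).
Proof.
move=> zv; have [|n1] := pselect (z = (e, true)); first by left.
have [|n2] := pselect (z = (e', false)); first by right.
have [_ _ b1 _] := @ends_at_interior O (e, true) z q vq (esym zv) (fun h => n1 (esym h)).
have h2 : endv (e', false) = endv z by rewrite zv ev.
have [|_ _ b2 _] := @ends_at_interior O (e', false) z q _ h2 (fun h => n2 (esym h)).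
  by rewrite /endv /= -ev.
by exfalso; move: b1 b2; rewrite /=; case: z.2.
Qed.

Let joint : [/\ host e = host e', off e + len e = off e' & e <> e'].
Proof.
have h : endv (e, true) = endv (e', false) by rewrite /endv /= ev.
have [h1 h2 _ h3] := @ends_at_interior O (e, true) (e', false) q vq h (fun E => ltac:(by case: E)).
by split=> //; move: h2; rewrite /endx /= addr0.
Qed.

Let E := {x : edge O | x \in [pred x | x != e']}.
Let hst (x : E) := host (val x).
Let ofs (x : E) := off (val x).
Let ln (x : E) := if val x == e then len e + len e' else len (val x).
Let oldend (z : E * bool) : edge O * bool :=
  if z.2 && (val z.1 == e) then (e', true) else (val z.1, z.2).
Let rho z := endv (oldend z).
Let pos (v : vertex O) := sproj (inl v : gpoint O).

Let E_ex : (0 < #|{: E}|)%N.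
Proof.
have [_ _ ne] := joint.
have h : e \in [pred x | x != e'] by rewrite inE; apply/eqP.
by apply/card_gt0P; exists (exist _ e h).
Qed.

Let ln_gt0 x : 0 < ln x.
Proof. by rewrite /ln; case: ifP; rewrite ?addr_gt0 ?len_gt0. Qed.

Let ofs_ge0 x : 0 <= ofs x. Proof. exact: off_ge0. Qed.

Let ofs_le x : ofs x + ln x <= len (hst x).
Proof.
rewrite /ofs /ln /hst; case: eqP => [->|_]; last exact: off_le.
by have [-> h _] := joint; rewrite addrA h off_le.
Qed.

Let pos_rho z : pos (rho z) = loc (hst z.1) (ofs z.1 + if z.2 then ln z.1 else 0).
Proof.
case: z => x b; rewrite /pos /rho /oldend /= sproj_endv /hst /ofs /ln /endx.
have [hh j _] := joint.
case: b => //=; case: eqP => //= ->.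
by rewrite hh addrA j.
Qed.

Let nonoverlap x y : x <> y -> hst x = hst y ->
  ofs x + ln x <= ofs y \/ ofs y + ln y <= ofs x.
Proof.
move=> xy; rewrite /hst /ofs /ln => h.
have [hh j _] := joint.
have nxy : val x <> val y by move/val_inj.
have nx : val x <> e' by apply/eqP; exact: (valP x).
have ny : val y <> e' by apply/eqP; exact: (valP y).
have l0 := len_gt0 e; have l0' := len_gt0 e'.
have lx := len_gt0 (val x); have ly := len_gt0 (val y).
case: eqP => xe; case: eqP => ye.
- by case: nxy; rewrite xe ye.
- rewrite xe in h *; have n1 : e <> val y by move=> E1; case: ye.
  have := nov_self n1 h; rewrite hh in h; have := nov_self (fun E1 => ny (esym E1)) h.
  by case=> ?; case=> ?; [left; lra|right; lra|left; lra|right; lra].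
- rewrite ye in h *; have n1 : e <> val x by move=> E1; case: xe.
  have := nov_self n1 (esym h); rewrite hh in h; have := nov_self (fun E1 => nx (esym E1)) (esym h).
  by case=> ?; case=> ?; [right; lra|left; lra|right; lra|left; lra].
exact: nov_self.
Qed.

Let O' := glued E_ex ln_gt0 ofs_ge0 ofs_le pos_rho nonoverlap.

Let oldend_inj : injective oldend.
Proof.
move=> [x b] [y c]; rewrite /oldend /=.
have nx : val x <> e' by apply/eqP; exact: (valP x).
have ny : val y <> e' by apply/eqP; exact: (valP y).
case: ifP => [/andP[b1 /eqP xe]|_]; case: ifP => [/andP[c1 /eqP ye]|_].
- by move=> _; rewrite b1 c1; congr (_, _); apply: val_inj; exact: (etrans xe (esym ye)).
- by move=> [h _]; case: ny.
- by move=> [h _]; case: nx.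
- by move=> [/val_inj -> ->].
Qed.

Let oldend_onto z : z.1 <> e' \/ z = (e', true) -> z <> (e, true) ->
  exists w, oldend w = z.
Proof.
case: z => x b /= h1 h2; have [_ _ ne] := joint.
have [xe'|/eqP xe'] := eqVneq x e'.
  case: h1 => [//|[_ ->]].
  have h : e \in [pred x | x != e'] by rewrite inE; apply/eqP.
  by exists (exist _ e h, true); rewrite /oldend /= eqxx xe'.
have h : x \in [pred x | x != e'] by rewrite inE; apply/eqP.
exists (exist _ x h, b); rewrite /oldend /=; case: ifP => // /andP[b1 /eqP xe].
by case: h2; rewrite b1 xe.
Qed.

Let oldend_avoid w : oldend w <> (e, true) /\ oldend w <> (e', false).
Proof.
case: w => x b; rewrite /oldend/=; have [_ _ ne] := joint.
have nx : val x <> e' by apply/eqP; exact: (valP x).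
case: ifP => [_|/negP h]; split=> -[] //; first by move=> /esym.
by move=> xe b1; apply: h; rewrite xe eqxx b1.
Qed.

Let junction_gone (l : vertex O') : val l <> tgt e.
Proof.
have /codomP[w ->] := valP l => rv; have [a1 a2] := oldend_avoid w.
by case: (ends_v rv).
Qed.

Let glue_deg_old (l : vertex O') :
  deg (inl l : gpoint O') = deg (inl (val l) : gpoint O).
Proof.
rewrite glue_deg deg_ends; apply: esym.
rewrite -(fintype.card_image oldend_inj); apply: eq_card => z.
rewrite !inE; apply/eqP/fintype.imageP => [zl|[w]]; last by rewrite inE => /eqP <- ->.
have n1 : z <> (e, true) by move=> E1; apply: (@junction_gone l); rewrite -zl E1.
have n2 : z <> (e', false).
  by move=> E1; apply: (@junction_gone l); rewrite -zl E1 /endv /= -ev.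
have [|w wz] := oldend_onto _ n1; last by exists w; rewrite // inE /rho wz zl.
have [ze|] := pselect (z.1 = e'); last by left.
right; move: n2 ze; case: (z) => x [] /= n2 ze; first by rewrite ze.
by case: n2; rewrite ze.
Qed.

Let glue_effdeg_old (l : vertex O') :
  effdeg (inl l : gpoint O') = effdeg (inl (val l) : gpoint O).
Proof. by rewrite !effdeg_inl glue_deg_old. Qed.

(** Merging the two segments that meet at a dummy vertex changes neither the
energy nor the mass of a function, and the dummy vertex contributed nothing to
the boundary term, its effective degree being 0. *)
Lemma merge_at : gconn O ->
  [/\ gconn O', (#|edge O'| < #|edge O|)%N, forall Q, nov O Q -> nov O' Q &
     forall a, 0 <= a -> lambda1 a O' <= lambda1 a O].
Proof.
move=> gc; have [hh j ne] := joint.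
have old_label (v : vertex O) : v <> tgt e -> exists l : vertex O', val l = v.
  move=> nv; have [z zv] := vertex_endv v.
  have n1 : z <> (e, true) by move=> E1; apply: nv; rewrite -zv E1.
  have n2 : z <> (e', false) by move=> E1; apply: nv; rewrite -zv E1 /endv /= -ev.
  have [|w wz] := oldend_onto _ n1.
    have [ze|] := pselect (z.1 = e'); last by left.
    right; move: n2 ze; case: (z) => x [] /= n2 ze; first by rewrite ze.
    by case: n2; rewrite ze.
  by exists (glued_end rho w); rewrite /= /rho wz.
have old_edge (x : edge O) : x <> e' -> exists y : edge O', val y = x.
  move=> /eqP nx; have h : x \in [pred x | x != e'] by rewrite inE.
  by exists (exist _ x h).
have eE : e \in [pred x | x != e'] by rewrite inE; apply/eqP.
pose y0 : edge O' := exist _ e eE.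
have y0s : val (src y0) = src e by [].
have y0t : val (tgt y0) = tgt e' by rewrite /= /rho /oldend /= eqxx.
split.
- move=> X hX u w Xu.
  pose X' v := exists2 l : vertex O', val l = v & X l.
  have X'E l : X' (val l) <-> X l.
    by split=> [[k /val_inj ->]//|Xl]; exists l.
  (* the junction inherits the value of X at the start of e *)
  pose Y v := if v == tgt e then X' (src e) else X' v.
  have YE l : Y (val l) <-> X l.
    by rewrite /Y; case: eqP => [/junction_gone//|_]; exact: X'E.
  apply/YE; apply: (gc Y _ (val u)); last exact/YE.
  move=> x; have [->|/eqP xe] := eqVneq x e.
    by rewrite -y0s YE /Y eqxx -y0s X'E.
  have [->|/eqP xe'] := eqVneq x e'.
    by rewrite -ev -y0t YE /Y eqxx -y0s X'E; exact: hX.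
  have [y yx] := old_edge _ xe'.
  have -> : src x = val (src y) by rewrite -yx.
  have -> : tgt x = val (tgt y).
    rewrite -yx /= /rho /oldend /=; case: eqP => // ye; case: xe.
    by rewrite -yx.
  by rewrite !YE; exact: hX.
- have -> : #|edge O'| = #|predC1 e'| by rewrite card_sig; apply: eq_card => x.
  by rewrite (cardC1 e') prednK// edge_ex.
- move=> Q no x y h; change (host (val x) = host y) in h.
  change (off (val x) + ln x <= off y \/ off y + len y <= off (val x)); rewrite /ln.
  case: eqP => xe; last exact: no.
  rewrite xe in h *; have h1 := no _ _ h; have := no e' y; rewrite -hh => /(_ h).
  have l0 := len_gt0 e; have l0' := len_gt0 e'; have ly := len_gt0 y.
  by case: h1 => h1 [] h2; [left; lra|left; lra|right; lra|right; lra].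
move=> a a0; rewrite leNgt; apply/negP => lt.
have [phi [s [ok m0 N]]] := lambda1_approx a0 lt.
pose phi' (l : vertex O') := phi (val l).
pose s' (x : edge O') := if val x == e then s e ++ s e' else s (val x).
have sub_edges (F : edge O -> R) : \sum_(x : edge O) F x =
    \sum_(x : edge O') (if val x == e then F e + F e' else F (val x)).
  rewrite (bigD1 e')//= (bigD1 e)/=; last exact/eqP.
  rewrite addrA [F e' + F e]addrC.
  rewrite -(big_sub [pred x | x != e'] (fun x => if x == e then F e + F e' else F x)) /=.
  rewrite [RHS](bigD1 e)//= eqxx; congr (_ + _).
  by apply: eq_bigr => x /andP[_ /negPf ->].
have last_cat c t t' : plast c (t ++ t') = plast (plast c t) t'.
  by rewrite /plast map_cat last_cat.
have wf_cat t t' : plwf (t ++ t') = plwf t && plwf t' by rewrite /plwf all_cat.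
have len_cat t t' : plen (t ++ t') = plen t + plen t'.
  by elim: t => [|q' t IH] /=; rewrite ?add0r// IH addrA.
have en_cat c t t' : penergy c (t ++ t') = penergy c t + penergy (plast c t) t'.
  by elim: t c => [|q' t IH] c /=; rewrite ?add0r// IH addrA.
have ma_cat c t t' : pmass c (t ++ t') = pmass c t + pmass (plast c t) t'.
  by elim: t c => [|q' t IH] c /=; rewrite ?add0r// IH addrA.
have [we le_ ee] := ok.2 e; have [we' le' ee'] := ok.2 e'.
have srcE (x : edge O') : phi' (src x) = phi (src (val x)) by [].
have ok' : plok phi' s'.
  split=> [l|x]; first exact: ok.1.
  rewrite srcE /s' /phi' /len /= /ln /rho /oldend /=; case: eqP => [->|_]; last exact: ok.2.
  by rewrite wf_cat we we' len_cat le_ le' last_cat ee ev ee'.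
have mE : gmass phi' s' = gmass phi s.
  rewrite /gmass sub_edges; apply: eq_bigr => x _; rewrite srcE /s'; case: eqP => [->|//].
  by rewrite ma_cat ee ev.
have nE : gnum (@bweight _ _ a O') phi' s' <= gnum (@bweight _ _ a O) phi s.
  apply: lerD.
    rewrite sub_edges le_eqVlt; apply/orP; left; apply/eqP.
    apply: eq_bigr => x _; rewrite srcE /s'; case: eqP => [->|//].
    by rewrite en_cat ee ev.
  pose F v := bweight a v * phi v ^+ 2.
  have -> : \sum_(l : vertex O') bweight a l * phi' l ^+ 2 = \sum_(l : vertex O') F (val l).
    by apply: eq_bigr => l _; rewrite /bweight glue_effdeg_old.
  rewrite -(big_sub (mem (codom rho)) F) big_mkcond /=; apply: ler_sum => v _.
  by case: ifP => // _; apply: mulr_ge0; rewrite ?sqr_ge0 ?bweight_ge0.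
have := lambda1_le a0 ok'; rewrite mE; apply/negP; rewrite -ltNge.
exact: le_lt_trans N.
Qed.

End MergeAt.
End Merge.

(** * Normal forms have boundedly many edges *)

Section NormalForm.
Context {R : realType} {G : mgraph R}.
Implicit Types (O Q : subgraph G) (a : R).

(** A normal form: there are no dummy vertices. *)
Definition nform O := forall (v : vertex O) q, sproj (inl v : gpoint O) = inr q ->
  deg (inl v : gpoint O) = 1%N.

Lemma nform_unique O (z z' : edge O * bool) q : nform O ->
  sproj (inl (endv z) : gpoint O) = inr q -> endv z' = endv z -> z' = z.
Proof.
move=> nf zq zz'; have := nf _ _ zq; rewrite deg_ends => /eqP/card1P[w hw].
have : z \in pred1 w by rewrite -hw inE.
have : z' \in pred1 w by rewrite -hw inE zz'.
by rewrite !inE => /eqP -> /eqP ->.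
Qed.

(** Each merging removes one segment. *)
Lemma normal_form O : gconn O -> exists O', [/\ nform O', gconn O',
  forall Q, nov O Q -> nov O' Q & forall a, 0 <= a -> lambda1 a O' <= lambda1 a O].
Proof.
have [n] := ubnP #|edge O|; elim: n O => // n IH O On gc.
have [nf|nnf] := pselect (nform O); first by exists O.
have [v [q [vq dv]]] : exists v q, sproj (inl v : gpoint O) = inr q /\
    deg (inl v : gpoint O) <> 1%N.
  apply: contrapT => no; apply: nnf => v q vq; apply: contrapT => dv.
  by apply: no; exists v, q.
have [z0 z0v] := vertex_endv v.
have : (1 < #|[pred z : edge O * bool | endv z == v]|)%N.
  rewrite ltn_neqAle -deg_ends eq_sym; apply/andP; split; first exact/eqP.
  by rewrite deg_ends; apply/card_gt0P; exists z0; rewrite inE z0v.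
move=> /card_gt1P[z [z' []]]; rewrite !inE => /eqP zv /eqP zv' /eqP zz'.
wlog zt : z z' zv zv' zz' / z.2 = true.
  move=> h; case Ez : z.2; first exact: (h z z').
  have zq : sproj (inl (endv z) : gpoint O) = inr q by rewrite zv.
  have [_ _ b _] := ends_at_interior zq (etrans zv (esym zv')) zz'.
  apply: (h z' z) => //; first exact: nesym.
  by move: b; rewrite Ez; case: z'.2.
have zq : sproj (inl (endv z) : gpoint O) = inr q by rewrite zv.
have [_ _ b _] := ends_at_interior zq (etrans zv (esym zv')) zz'.
have ev : tgt z.1 = src z'.1.
  by move: zv zv' b; rewrite /endv zt; case: z'.2 => // -> ->.
have vq' : sproj (inl (tgt z.1) : gpoint O) = inr q.
  by rewrite -vq -zv /endv zt.
have [gc' card' no' la'] := merge_at ev vq' gc.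
have [|O2 [nf2 gc2 no2 la2]] := IH _ _ gc'.
  by rewrite -ltnS; apply: leq_trans On.
exists O2; split=> //; first by move=> Q /no' /no2.
by move=> a a0; apply: le_trans (la2 a a0) (la' a a0).
Qed.

(** Of two segments of one edge of G that do not start at its origin, the first
one would have two free ends, hence be isolated. *)
Lemma slot_inj O : nform O -> gconn O ->
  injective (fun e : edge O => (host e, off e == 0)).
Proof.
move=> nf gc.
have interior (e : edge O) b : (if b then off e + len e < len (host e) else 0 < off e) ->
    exists q, sproj (inl (endv (e, b)) : gpoint O) = inr q.
  have := off_ge0 e; have := off_le e; have := len_gt0 e => l0 o1 o0 hb.
  rewrite sproj_endv /endx /=.
  have h : 0 < off e + (if b then len e else 0) < len (host e).
    by move: hb; case: b => hb; apply/andP; split; lra.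
  by rewrite (loc_in h); eexists.
have pos (e : edge O) : (off e == 0) = false -> 0 < off e.
  by move=> h; rewrite lt_neqAle eq_sym h off_ge0.
suff key (e e' : edge O) : e <> e' -> host e = host e' -> 0 < off e -> 0 < off e' ->
    off e + len e <= off e' -> False.
  move=> e e' [hh oo]; apply: contrapT => ee.
  have l0 := len_gt0 e; have l0' := len_gt0 e'.
  case E : (off e == 0) oo => /esym oo.
    move/eqP: E => E; move/eqP: oo => oo.
    by case: (nov_self ee hh); rewrite E oo !add0r leNgt ?l0 ?l0'.
  have p0 := pos _ E; have p0' := pos _ oo.
  case: (nov_self ee hh); first exact: key ee hh p0 p0'.
  exact: key (nesym ee) (esym hh) p0' p0.
move=> ee hh o0 o0' le; have l0 := len_gt0 e; have l0' := len_gt0 e'.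
have o1 := off_le e'.
have [q1 hq1] := @interior e false o0.
have [|q2 hq2] := @interior e true; first by rewrite hh; lra.
have hX (x : edge O) : (src x = src e \/ src x = tgt e) <-> (tgt x = src e \/ tgt x = tgt e).
  have u1 z := @nform_unique O (e, false) z q1 nf hq1.
  have u2 z := @nform_unique O (e, true) z q2 nf hq2.
  split.
    move=> [/(u1 (x, false))[->]|/(u2 (x, false))//]; first by right.
  by move=> [/(u1 (x, true))//|/(u2 (x, true))[->]]; left.
have := gc (fun v => v = src e \/ v = tgt e) hX (src e) (src e') (or_introl erefl).
case=> [/(@nform_unique O (e, false) (e', false) q1 nf hq1)|
        /(@nform_unique O (e, true) (e', false) q2 nf hq2)] //.
by case=> /esym.
Qed.

Lemma edge_bound O : nform O -> gconn O -> (#|edge O| <= #|edge G| * 2)%N.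
Proof.
move=> nf gc; rewrite -card_bool -card_prod; exact: leq_card (slot_inj nf gc).
Qed.

Lemma vertex_bound O : (#|vertex O| <= #|edge O| * 2)%N.
Proof.
rewrite -card_bool -card_prod.
have [g hg] := choice (@vertex_endv _ _ O).
by apply: (@leq_card _ _ g) => v w E; rewrite -(hg v) -(hg w) E.
Qed.

End NormalForm.

(** * Estimates along an edge *)

Section PLEstimates.
Context {R : realType}.
Implicit Types (s : seq (R * R)) (c : R).

(** Cauchy-Schwarz inequality for two terms. *)
Lemma sqr_addr_le (u v T h E A : R) : 0 <= T -> 0 <= h -> 0 <= E -> 0 <= A ->
  u ^+ 2 <= T * E -> v ^+ 2 <= h * A -> (u + v) ^+ 2 <= (T + h) * (E + A).
Proof.
move=> T0 h0 E0 A0 uT vh.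
have key : 2 * (u * v) <= T * A + h * E.
  have r0 : 0 <= T * A + h * E by rewrite addr_ge0 ?mulr_ge0.
  apply: le_trans (ler_norm _) _; rewrite -(ler_pXn2r (n := 2)) ?nnegrE//.
  rewrite real_normK ?num_real//.
  have : u ^+ 2 * v ^+ 2 <= (T * E) * (h * A) by rewrite ler_pM ?sqr_ge0.
  have := sqr_ge0 (T * A - h * E); nra.
nra.
Qed.

Lemma step_energy (h c d : R) : 0 < h -> (d - c) ^+ 2 <= h * ((d - c) ^+ 2 / h).
Proof. by move=> h0; rewrite mulrC divfK ?gt_eqF. Qed.

Lemma step_energy_ge0 (h c d : R) : 0 < h -> 0 <= (d - c) ^+ 2 / h.
Proof. by move=> h0; rewrite divr_ge0 ?sqr_ge0// ltW. Qed.

Lemma penergy_plast c s : plwf s -> (plast c s - c) ^+ 2 <= plen s * penergy c s.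
Proof.
elim: s c => [|[h d] s IH] c /=; first by rewrite /plast /= subrr expr0n mul0r.
move=> /andP[/andP[/= h0 d0] ws]; have -> : plast c ((h, d) :: s) = plast d s by [].
have -> : plast d s - c = (d - c) + (plast d s - d) by ring.
apply: sqr_addr_le (IH d ws); rewrite ?(ltW h0) ?plen_ge0 ?penergy_ge0//.
  exact: step_energy_ge0.
exact: step_energy.
Qed.

(** Here x is a value of reference, and T and E bound the length and the energy
between the point where it is taken and the start of s; carrying them along
makes the induction on the pieces work. *)
Lemma pmass_le_from c s (x T E : R) : plwf s -> 0 <= c -> 0 <= T -> 0 <= E ->
  (c - x) ^+ 2 <= T * E ->
  pmass c s <= plen s * (2 * x ^+ 2 + 2 * ((T + plen s) * (E + penergy c s))).
Proof.
elim: s c T E => [|[h d] s IH] c T E /=; first by rewrite mul0r.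
move=> /andP[/andP[/= h0 d0] ws] c0 T0 E0 cx.
have A0 := @step_energy_ge0 h c d h0; have l0 := plen_ge0 ws.
have e0 := penergy_ge0 d ws; set A := (d - c) ^+ 2 / h in A0 *.
have dx : (d - x) ^+ 2 <= (T + h) * (E + A).
  have -> : d - x = (c - x) + (d - c) by ring.
  by apply: sqr_addr_le => //; [exact: ltW|exact: step_energy].
have := IH d (T + h) (E + A) ws d0 (addr_ge0 T0 (ltW h0)) (addr_ge0 E0 A0) dx.
rewrite -!addrA => H; rewrite mulrDl; apply: lerD => //.
rewrite ler_wpM2l ?(ltW h0)//.
have m0 : 0 <= Num.min c d by rewrite le_min c0.
have : Num.min c d ^+ 2 <= c ^+ 2 by rewrite lerXn2r ?nnegrE// ge_min lexx.
have := sqr_ge0 (c - 2 * x).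
have : T * E <= (T + (h + plen s)) * (E + (A + penergy d s)).
  by apply: ler_pM => //; rewrite lerDl addr_ge0// ltW.
by move: ((T + _) * _) => W; nra.
Qed.

Lemma pmass_ge_from c s (x T E : R) : plwf s -> 0 <= c -> 0 <= T -> 0 <= E ->
  (c - x) ^+ 2 <= T * E ->
  plen s * x ^+ 2 <= 2 * pmass c s + 2 * plen s * ((T + plen s) * (E + penergy c s)).
Proof.
elim: s c T E => [|[h d] s IH] c T E /=; first by rewrite !mulr0 !mul0r addr0.
move=> /andP[/andP[/= h0 d0] ws] c0 T0 E0 cx.
have A0 := @step_energy_ge0 h c d h0; have l0 := plen_ge0 ws.
have e0 := penergy_ge0 d ws; set A := (d - c) ^+ 2 / h in A0 *.
have dx : (d - x) ^+ 2 <= (T + h) * (E + A).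
  have -> : d - x = (c - x) + (d - c) by ring.
  by apply: sqr_addr_le => //; [exact: ltW|exact: step_energy].
have := IH d (T + h) (E + A) ws d0 (addr_ge0 T0 (ltW h0)) (addr_ge0 E0 A0) dx.
rewrite -!addrA.
have w1 : T * E <= (T + (h + plen s)) * (E + (A + penergy d s)).
  by apply: ler_pM => //; rewrite lerDl addr_ge0// ltW.
have w2 : (T + h) * (E + A) <= (T + (h + plen s)) * (E + (A + penergy d s)).
  by apply: ler_pM; rewrite ?addr_ge0 ?(ltW h0)//; rewrite addrA lerDl.
set W := (T + (h + plen s)) * _ in w1 w2 *.
have : x ^+ 2 <= 2 * Num.min c d ^+ 2 + 2 * W.
  rewrite /Num.min; case: ifP => _.
    by have := sqr_ge0 (x - 2 * c); have := le_trans cx w1; nra.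
  by have := sqr_ge0 (x - 2 * d); have := le_trans dx w2; nra.
move=> h1; have : h * x ^+ 2 <= h * (2 * Num.min c d ^+ 2 + 2 * W).
  by rewrite ler_wpM2l ?(ltW h0).
by move: (Num.min c d ^+ 2) => m; nra.
Qed.

(** For a pendant edge of small length t, with value y at its free end and x at
the other one: as (y - x) ^+ 2 <= t * e, the boundary term moves from y to x
almost for free, and the mass m is negligible. *)
Lemma pendant_bound (a r k t e m x y : R) : 0 < a -> 0 <= r -> 0 < k -> k < 1 ->
  0 <= t -> t <= 1 -> 0 <= e -> (y - x) ^+ 2 <= t * e ->
  m <= t * (2 * x ^+ 2 + 8 * (t * e)) ->
  t * (2 * a / k + 8 * r) <= 1 -> 2 * r * t <= a * k / 2 ->
  a * (1 - k) * x ^+ 2 <= e - r * m + a * y ^+ 2.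
Proof.
move=> a0 r0 k0 k1 t0 t1 e0 d1 m1 ht1 ht2.
have y1 : (1 - k / 2) * x ^+ 2 - 2 / k * (t * e) <= y ^+ 2.
  have : (1 - k / 2) * x ^+ 2 - 2 / k * (y - x) ^+ 2 <= y ^+ 2.
    have -> : 2 / k = (k / 2)^-1 by field; exact: lt0r_neq0.
    have q0 : 0 < k / 2 by rewrite divr_gt0.
    move: (k / 2) q0 => q q0.
    rewrite lerBlDr -subr_ge0.
    have -> : y ^+ 2 + q^-1 * (y - x) ^+ 2 - (1 - q) * x ^+ 2 =
      q^-1 * (q * x + (y - x)) ^+ 2 + (y - x) ^+ 2 by field; exact: lt0r_neq0.
    have i0 : 0 <= q^-1 by rewrite invr_ge0; exact: ltW.
    by apply: addr_ge0; rewrite ?sqr_ge0//; apply: mulr_ge0 => //; exact: sqr_ge0.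
  have : 2 / k * (y - x) ^+ 2 <= 2 / k * (t * e) by rewrite ler_wpM2l// divr_ge0// ltW.
  lra.
have : a * ((1 - k / 2) * x ^+ 2 - 2 / k * (t * e)) <= a * y ^+ 2 by rewrite ler_wpM2l ?(ltW a0).
have : r * m <= r * (t * (2 * x ^+ 2 + 8 * (t * e))) by rewrite ler_wpM2l.
have : 0 <= e * (1 - t * (2 * a / k + 8 * r)) by rewrite mulr_ge0// subr_ge0.
have : 0 <= x ^+ 2 * (a * k / 2 - 2 * r * t) by rewrite mulr_ge0 ?sqr_ge0// subr_ge0.
have : 0 <= r * t * e * (1 - t) by rewrite !mulr_ge0// subr_ge0.
have -> : 2 * a / k = 2 / k * a by ring.
move: (2 / k) => K; nra.
Qed.

Lemma pendant_start (a r k t : R) c s : 0 < a -> 0 <= r -> 0 < k -> k < 1 ->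
  0 <= c -> plwf s -> plen s = t -> t <= 1 ->
  t * (2 * a / k + 8 * r) <= 1 -> 2 * r * t <= a * k / 2 ->
  a * (1 - k) * c ^+ 2 <= penergy c s - r * pmass c s + a * plast c s ^+ 2.
Proof.
move=> a0 r0 k0 k1 c0 ws ls t1 ht1 ht2; have t0 : 0 <= t by rewrite -ls plen_ge0.
have e0 := penergy_ge0 c ws.
apply: (@pendant_bound _ _ _ t) => //; first by rewrite -ls; exact: penergy_plast.
have := @pmass_le_from c s c 0 0 ws c0 (lexx _) (lexx _).
rewrite subrr expr0n mul0r !add0r ls => /(_ (lexx _))/le_trans; apply.
have te : 0 <= t * penergy c s by rewrite mulr_ge0.
by rewrite ler_wpM2l// lerD2l; lra.
Qed.

Lemma pendant_end (a r k t : R) c s : 0 < a -> 0 <= r -> 0 < k -> k < 1 ->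
  0 <= c -> plwf s -> plen s = t -> t <= 1 ->
  t * (2 * a / k + 8 * r) <= 1 -> 2 * r * t <= a * k / 2 ->
  a * (1 - k) * plast c s ^+ 2 <= penergy c s - r * pmass c s + a * c ^+ 2.
Proof.
move=> a0 r0 k0 k1 c0 ws ls t1 ht1 ht2; have t0 : 0 <= t by rewrite -ls plen_ge0.
have e0 := penergy_ge0 c ws.
have cs : (c - plast c s) ^+ 2 <= t * penergy c s.
  by rewrite -sqrrN opprB -ls; exact: penergy_plast.
apply: (@pendant_bound _ _ _ t) => //.
apply: le_trans (pmass_le_from ws c0 t0 e0 cs) _; rewrite ls ler_wpM2l//.
by rewrite lerD2l; lra.
Qed.

End PLEstimates.

(** * Limits of subgraphs of one combinatorial type *)

(** Overlapping is an open condition. *)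
Lemma overlap_stable (R : realType) (o l o' l' d x y x' y' : R) :
  o' < o + l -> o < o' + l' -> d <= (o + l - o') / 3 -> d <= (o' + l' - o) / 3 ->
  `|x - o| < d -> `|y - l| < d -> `|x' - o'| < d -> `|y' - l'| < d ->
  ~ (x + y <= x' \/ x' + y' <= x).
Proof.
rewrite !ltr_norml => h1 h2 d1 d2.
move=> /andP[? ?] /andP[? ?] /andP[? ?] /andP[? ?] [] ?; lra.
Qed.

Section Limit.
Context {R : realType} {G : mgraph R}.
Implicit Types (O : subgraph G).

(** Two subgraphs of the same combinatorial type: they differ only by the
positions of their free ends. *)
Definition same_type O O1 (th : edge O -> edge O1) (ps : vertex O -> vertex O1) :=
  [/\ bijective th, bijective ps,
      forall z : edge O * bool, endv (th z.1, z.2) = ps (endv z),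
      forall e, host (th e) = host e &
      forall e, (off (th e) == 0) = (off e == 0) /\
        (off (th e) + len (th e) == len (host e)) = (off e + len e == len (host e))].

Definition near_type O (ofs ln : edge O -> R) (d : R) O1 := exists th ps,
  @same_type O O1 th ps /\
  forall e, `|off (th e) - ofs e| < d /\ `|len (th e) - ln e| < d.

Lemma same_type_deg O O1 th ps (v : vertex O) : @same_type O O1 th ps ->
  deg (inl (ps v) : gpoint O1) = deg (inl v : gpoint O).
Proof.
move=> [bt bp ends _ _]; rewrite !deg_ends.
have [ht htK thK] := bt.
have inj : injective (fun z : edge O * bool => (th z.1, z.2)).
  by move=> [x b] [y c] [/(can_inj htK) -> ->].
rewrite -(fintype.card_image inj); apply: eq_card => z; rewrite inE.
apply/eqP/fintype.imageP => [zv|[w + ->]]; last by rewrite inE => /eqP <-; rewrite ends.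
exists (ht z.1, z.2); last by rewrite /= thK; case: (z).
rewrite inE; apply/eqP/(bij_inj bp); rewrite -ends /= thK -zv; by case: (z).
Qed.

Lemma same_type_inl O O1 th ps (v : vertex O) u : @same_type O O1 th ps ->
  sproj (inl v : gpoint O) = inl u -> sproj (inl (ps v) : gpoint O1) = inl u.
Proof.
move=> [_ _ ends hs kd]; have [[e b] <-] := vertex_endv v.
rewrite -ends !sproj_endv /= hs; have [k0 k1] := kd e.
have i := seg_sub (endx_in (e, b)).
move=> /(loc_inl i)[|][] /=; rewrite /endx /=; case: b {i} => /=.
- have : 0 < off e + len e by apply: ltr_wpDl; [exact: off_ge0|exact: len_gt0].
  by move=> /[swap] ->; rewrite ltxx.
- by rewrite !addr0 => /eqP; rewrite -k0 => /eqP -> <-; rewrite loc0.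
- by move=> /eqP; rewrite -k1 => /eqP -> <-; rewrite loc_len.
- by rewrite addr0 => E; have := off_le e; rewrite -E gerDl leNgt len_gt0.
Qed.

Lemma same_type_inr O O1 th ps (v : vertex O) q : @same_type O O1 th ps ->
  sproj (inl v : gpoint O) = inr q -> exists q', sproj (inl (ps v) : gpoint O1) = inr q'.
Proof.
move=> [_ _ ends hs kd]; have [[e b] <-] := vertex_endv v.
rewrite -ends !sproj_endv /= hs; have [k0 k1] := kd e.
have o0 := off_ge0 (th e); have o1 := off_le (th e); have l0 := len_gt0 (th e).
rewrite hs in o1.
case: b; rewrite /endx /= ?addr0 => E.
  have n1 : off e + len e != len (host e).
    by apply/eqP => n1; move: E; rewrite n1 loc_len.
  have h : 0 < off (th e) + len (th e) < len (host e).
    rewrite -k1 in n1; rewrite [X in _ && X]lt_neqAle n1 o1 /= andbT.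
    exact: ltr_wpDl.
  by rewrite (loc_in h); eexists.
have n0 : off e != 0 by apply/eqP => n0; move: E; rewrite n0 loc0.
have h : 0 < off (th e) < len (host e).
  rewrite -k0 in n0; rewrite lt_neqAle eq_sym n0 o0 /=; apply: lt_le_trans o1.
  by rewrite ltrDl.
by rewrite (loc_in h); eexists.
Qed.

Lemma same_type_effdeg_inr O O1 th ps (v : vertex O) q : @same_type O O1 th ps ->
  nform O -> sproj (inl v : gpoint O) = inr q -> effdeg (inl (ps v) : gpoint O1) = 1%N.
Proof.
move=> st nf vq; rewrite effdeg_inl (same_type_deg _ st) (nf _ _ vq).
by have [q' ->] := same_type_inr st vq.
Qed.

Definition scale (c : R) (s : seq (R * R)) := [seq (c * q.1, q.2) | q <- s].

Lemma scale_wf c s : 0 < c -> plwf s -> plwf (scale c s).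
Proof.
by move=> c0; elim: s => //= q s IH /andP[/andP[q0 ->] /IH ->]; rewrite mulr_gt0.
Qed.

Lemma scale_len c s : plen (scale c s) = c * plen s.
Proof. by elim: s => [|q s IH] /=; rewrite ?mulr0// IH mulrDr. Qed.

Lemma scale_last c x s : plast x (scale c s) = plast x s.
Proof. by rewrite /plast -map_comp. Qed.

Lemma scale_energy c x s : 0 < c -> plwf s -> penergy x s = c * penergy x (scale c s).
Proof.
move=> c0; elim: s x => [|[h d] s IH] x /=; first by rewrite mulr0.
move=> /andP[/andP[/= h0 d0] ws]; rewrite mulrDr -IH//; congr (_ + _).
by field; rewrite !lt0r_neq0.
Qed.

Lemma scale_mass c x s : pmass x (scale c s) = c * pmass x s.
Proof. by elim: s x => [|q s IH] x /=; rewrite ?mulr0// IH mulrDr mulrA. Qed.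

Section LimitOf.
Context (O : subgraph G) (ofs ln : edge O -> R) (a r : R).
Hypothesis nf : nform O.
Hypothesis gc : gconn O.
Hypothesis a0 : 0 < a.
Hypothesis approx : forall d : R, 0 < d ->
  exists2 O1, near_type ofs ln d O1 & lambda1 a O1 < r + d.

Let lim_contra : (exists2 d : R, 0 < d & forall (O1 : subgraph G) th ps,
    @same_type O O1 th ps ->
    (forall e, `|off (th e) - ofs e| < d /\ `|len (th e) - ln e| < d) -> False) -> False.
Proof.
move=> [d d0 h]; case: (approx d0) => O1 [th [ps [st cl]]] _.
exact: (h O1 th ps st cl).
Qed.

Let lofs_ge0 e : 0 <= ofs e.
Proof.
rewrite leNgt; apply/negP => h; apply: lim_contra.
exists (- ofs e); first by rewrite oppr_gt0.
move=> O1 th ps _ /(_ e)[+ _]; rewrite ltr_norml => /andP[_].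
by have := off_ge0 (th e); move=> h1 h2; lra.
Qed.

Let lofs_le e : ofs e + ln e <= len (host e).
Proof.
rewrite leNgt; apply/negP => h; apply: lim_contra.
exists ((ofs e + ln e - len (host e)) / 2); first by rewrite divr_gt0// subr_gt0.
move=> O1 th ps [_ _ _ hh _] /(_ e)[]; rewrite !ltr_norml => /andP[h1 _] /andP[h2 _].
by have := off_le (th e); rewrite hh; clear hh; move=> h3; lra.
Qed.

Let lnonoverlap e e' : e <> e' -> host e = host e' ->
  ofs e + ln e <= ofs e' \/ ofs e' + ln e' <= ofs e.
Proof.
move=> ee hh.
have [h1|h1] := leP (ofs e + ln e) (ofs e'); first by left.
have [h2|h2] := leP (ofs e' + ln e') (ofs e); first by right.
exfalso; apply: lim_contra.
pose d := Num.min ((ofs e + ln e - ofs e') / 3) ((ofs e' + ln e' - ofs e) / 3).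
have dA : d <= (ofs e + ln e - ofs e') / 3 by rewrite ge_min lexx.
have dB : d <= (ofs e' + ln e' - ofs e) / 3 by rewrite ge_min lexx orbT.
exists d; first by rewrite lt_min !divr_gt0// subr_gt0.
move=> O1 th ps [bt _ _ hs _] cl.
have tt : th e <> th e' by move=> /(bij_inj bt).
have [c1 c2] := cl e; have [c3 c4] := cl e'.
have := nov_self tt; rewrite !hs => /(_ hh).
exact: overlap_stable h1 h2 dA dB c1 c2 c3 c4.
Qed.

Let lofs_start e : off e = 0 -> ofs e = 0.
Proof.
move=> /eqP e0; apply: contrapT => /eqP h; apply: lim_contra.
exists `|ofs e|; first by rewrite normr_gt0.
move=> O1 th ps [_ _ _ _ k] /(_ e)[]; have [k1 _] := k e.
by move: e0; rewrite -k1 => /eqP ->; rewrite sub0r normrN ltxx.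
Qed.

Let lofs_end e : off e + len e = len (host e) -> ofs e + ln e = len (host e).
Proof.
move=> /eqP e0; apply/eqP; rewrite eq_le lofs_le /= leNgt; apply/negP => h.
apply: lim_contra.
exists ((len (host e) - (ofs e + ln e)) / 2); first by rewrite divr_gt0// subr_gt0.
move=> O1 th ps [_ _ _ hh k] /(_ e)[]; have [_ k1] := k e.
move: e0; rewrite -k1 => /eqP; rewrite !ltr_norml => E /andP[_ h1] /andP[_ h2].
by clear hh k k1; lra.
Qed.

(** A segment without a free end is a whole edge of G, and does not vanish. *)
Let free_end_ex e : exists b, ln e <= 0 ->
  exists q, sproj (inl (endv (e, b)) : gpoint O) = inr q.
Proof.
have [l1|l1] := ltP 0 (ln e); first by exists true.
have o0 := off_ge0 e; have o1 := off_le e; have l0 := len_gt0 e.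
have [E0|E0] := eqVneq (off e) 0; last first.
  exists false => _; rewrite sproj_endv /endx /= addr0.
  have h : 0 < off e < len (host e).
    by rewrite lt_neqAle eq_sym E0 o0 /=; lra.
  by rewrite (loc_in h); eexists.
have [E1|E1] := eqVneq (off e + len e) (len (host e)).
  have := lofs_end E1; rewrite (lofs_start E0) add0r => h.
  by move: l1; rewrite h leNgt len_gt0.
exists true => _; rewrite sproj_endv /endx /=.
have h : 0 < off e + len e < len (host e).
  by rewrite [X in _ && X]lt_neqAle E1 o1 andbT; lra.
by rewrite (loc_in h); eexists.
Qed.

Let fb : edge O -> bool := projT1 (choice free_end_ex).
Let fbP e : ln e <= 0 -> exists q, sproj (inl (endv (e, fb e)) : gpoint O) = inr q.
Proof. exact: (projT2 (choice free_end_ex)). Qed.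

Let leaf e := endv (e, fb e).
Let base e := endv (e, ~~ fb e).

Let leaf_uniq e z : ln e <= 0 -> endv z = leaf e -> z = (e, fb e).
Proof. by move=> /fbP[q hq]; exact: nform_unique nf hq. Qed.

Let E := {e | e \in [pred e | 0 < ln e]}.
Let hst (x : E) := host (val x).
Let lo (x : E) := ofs (val x).
Let ll (x : E) := ln (val x).
Let rho (z : E * bool) := endv (val z.1, z.2).
(** Vertices over vertices of G do not move; a free end follows its limit. *)
Let pos (v : vertex O) : gpoint G :=
  if sproj (inl v : gpoint O) is inl u then inl u
  else if [pick z | endv z == v] is Some z then
    loc (host z.1) (ofs z.1 + if z.2 then ln z.1 else 0)
  else sproj (inl v : gpoint O).

Let ll_gt0 x : 0 < ll x. Proof. exact: (valP x). Qed.
Let lo_ge0 x : 0 <= lo x. Proof. exact: lofs_ge0. Qed.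
Let lo_le x : lo x + ll x <= len (hst x). Proof. exact: lofs_le. Qed.

Let pos_rho z : pos (rho z) = loc (hst z.1) (lo z.1 + if z.2 then ll z.1 else 0).
Proof.
case: z => x b; rewrite /pos /rho /hst /lo /ll /=; set e := val x.
case Ev : (sproj _) => [u|q]; last first.
  case: pickP => [z /eqP zE|/(_ (e, b))]; last by rewrite eqxx.
  by rewrite (nform_unique nf Ev zE).
have := Ev; rewrite sproj_endv => /loc_inl[|[]|[]].
- by apply: seg_sub; exact: endx_in.
- rewrite /endx /=; case: b Ev => Ev E0 <-; last first.
    by move: E0; rewrite addr0 => /lofs_start ->; rewrite add0r loc0.
  have : 0 < off e + len e by apply: ltr_wpDl; [exact: off_ge0|exact: len_gt0].
  by rewrite E0 ltxx.
- rewrite /endx /=; case: b Ev => Ev E0 <-; first by rewrite (lofs_end E0) loc_len.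
  by have := off_le e; rewrite -E0 addr0 gerDl leNgt len_gt0.
Qed.

Let nonoverlap x y : x <> y -> hst x = hst y ->
  lo x + ll x <= lo y \/ lo y + ll y <= lo x.
Proof. by move=> xy; apply: lnonoverlap => /val_inj. Qed.

Let leaf_gone e : ln e <= 0 -> leaf e \notin codom rho.
Proof.
move=> e0; apply/negP => /codomP[z /esym /(leaf_uniq e0)] -[h _].
have := ll_gt0 z.1; rewrite /ll (_ : val z.1 = e); last exact: h.
by rewrite ltNge e0.
Qed.

(** Restriction of the energy inequality: the vanishing segments, together
with the boundary terms of their free ends, are replaced by boundary terms at
the vertices that they leave. *)
Let trial (O1 : subgraph G) th ps (phi1 : vertex O1 -> R) s1 (r' k d : R) :
  @same_type O O1 th ps ->
  (forall e, `|off (th e) - ofs e| < d /\ `|len (th e) - ln e| < d) ->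
  plok phi1 s1 -> gnum (@bweight _ _ a O1) phi1 s1 < r' * gmass phi1 s1 ->
  0 <= r' -> 0 < k -> k < 1 -> d <= 1 ->
  d * (2 * a / k + 8 * r') <= 1 -> 2 * r' * d <= a * k / 2 ->
  \sum_(e | 0 < ln e) (penergy (phi1 (ps (src e))) (s1 (th e)) -
     r' * pmass (phi1 (ps (src e))) (s1 (th e))) +
  a * (1 - k) * (\sum_(e | ln e <= 0) phi1 (ps (base e)) ^+ 2 +
     \sum_(v | v \in codom rho) (effdeg (inl (ps v) : gpoint O1))%:R * phi1 (ps v) ^+ 2) < 0.
Proof.
move=> [bt bp ends hs kd] cl ok lt r'0 k0 k1 d1 hd1 hd2.
pose F e := penergy (phi1 (ps (src e))) (s1 (th e)) -
     r' * pmass (phi1 (ps (src e))) (s1 (th e)).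
pose w v : R := (effdeg (inl (ps v) : gpoint O1))%:R * phi1 (ps v) ^+ 2.
have w0 v : 0 <= w v by apply: mulr_ge0 => //; exact: sqr_ge0.
have srcE e : src (th e) = ps (src e) := ends (e, false).
have tgtE e : tgt (th e) = ps (tgt e) := ends (e, true).
have {}lt : \sum_e F e + a * \sum_v w v < 0.
  move: lt; rewrite -subr_lt0 /gnum /gmass (reindex th) /=; last exact: onW_bij.
  rewrite [X in _ + X - _](reindex ps) /=; last exact: onW_bij.
  rewrite [X in _ - _ * X](reindex th) /=; last exact: onW_bij.
  rewrite mulr_sumr mulr_sumr addrAC -sumrB.
  congr (_ < _); congr (_ + _); apply: eq_bigr => e _; first by rewrite srcE.
  by rewrite /bweight /w mulrA.
(* the free ends of the vanishing segments are distinct and disappear *)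
have leaves : \sum_(e | ln e <= 0) phi1 (ps (leaf e)) ^+ 2 <=
    \sum_(v | v \notin codom rho) w v.
  pose A := finset (fun e => ln e <= 0).
  have inj : {in A &, injective leaf}.
    by move=> x y; rewrite !inE => x0 y0 /(leaf_uniq y0) [].
  have -> : \sum_(e | ln e <= 0) phi1 (ps (leaf e)) ^+ 2 = \sum_(e in A) w (leaf e).
    apply: eq_big => [e|e e0]; first by rewrite inE.
    have [q hq] := fbP e0.
    by rewrite /w (same_type_effdeg_inr (And5 bt bp ends hs kd) nf hq) mul1r.
  rewrite -(big_imset _ inj) big_mkcond [leRHS]big_mkcond; apply: ler_sum => v _.
  case: imsetP => [[e e0 ->]|_]; first by rewrite leaf_gone//; move: e0; rewrite inE.
  by case: ifP.
have pend e : ln e <= 0 ->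
    a * (1 - k) * phi1 (ps (base e)) ^+ 2 <= F e + a * phi1 (ps (leaf e)) ^+ 2.
  move=> e0; have [ws ls es] := ok.2 (th e).
  have ld : len (th e) <= d.
    have [_] := cl e; rewrite ltr_norml => /andP[_ h]; lra.
  have l0 := ltW (len_gt0 (th e)).
  have m1 : len (th e) * (2 * a / k + 8 * r') <= 1.
    apply: le_trans hd1; rewrite ler_wpM2r//.
    by apply: addr_ge0; rewrite ?divr_ge0 ?mulr_ge0 ?(ltW a0) ?(ltW k0).
  have m2 : 2 * r' * len (th e) <= a * k / 2.
    by apply: le_trans hd2; rewrite ler_wpM2l// mulr_ge0.
  have l1 := le_trans ld d1.
  have := pendant_start a0 r'0 k0 k1 (ok.1 (src (th e))) ws ls l1 m1 m2.
  have := pendant_end a0 r'0 k0 k1 (ok.1 (src (th e))) ws ls l1 m1 m2.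
  rewrite es tgtE srcE /F /base /leaf /endv; case: (fb e) => /=; lra.
rewrite (bigID (fun e => 0 < ln e)) /= in lt.
rewrite [X in _ + _ * X](bigID (fun v => v \in codom rho)) /= in lt.
have nn e : (~~ (0 < ln e)) = (ln e <= 0) by rewrite leNgt.
rewrite [X in _ + X + _](eq_bigl _ _ nn) in lt.
have := ler_wpM2l (ltW a0) leaves; rewrite mulr_sumr => h1.
have h2 : \sum_(e | ln e <= 0) a * (1 - k) * phi1 (ps (base e)) ^+ 2 <=
   \sum_(e | ln e <= 0) (F e + a * phi1 (ps (leaf e)) ^+ 2) by exact: ler_sum.
rewrite -mulr_sumr big_split /= in h2.
have h3 : 0 <= \sum_(v | v \in codom rho) w v by exact: sumr_ge0.
have h4 : a * (1 - k) * (\sum_(v | v \in codom rho) w v) <= a * \sum_(v | v \in codom rho) w v.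
  rewrite -mulrA ler_wpM2l ?(ltW a0)// ler_piMl//; lra.
rewrite mulrDr.
move: lt h1 h2 h3 h4.
set A1 := \sum_(i | 0 < ln i) F i; set A2 := \sum_(i | ln i <= 0) F i.
set B1 := \sum_(i | i \in codom rho) w i; set B2 := \sum_(i | i \notin codom rho) w i.
set C1 := \sum_(e | ln e <= 0) a * _; set C2 := \sum_(i | _) phi1 (ps (base i)) ^+ 2.
by rewrite mulrDr; lra.
Qed.

Let r_ge0 : 0 <= r.
Proof.
rewrite leNgt; apply/negP => h; have [|O1 _] := approx (d := - r); first by rewrite oppr_gt0.
by rewrite subrr ltNge lambda1_ge0// ltW.
Qed.

(** The parameter k measures the error; it bounds the relative change of the
lengths that do not vanish, and the loss in pendant_bound. *)
Let trial_ex (k : R) : 0 < k -> k < 1 -> exists O1 th ps (phi1 : vertex O1 -> R) s1,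
  [/\ @same_type O O1 th ps, plok phi1 s1,
     forall e, 0 < ln e -> `|len (th e) - ln e| <= k * ln e &
  \sum_(e | 0 < ln e) (penergy (phi1 (ps (src e))) (s1 (th e)) -
     (r + k) * pmass (phi1 (ps (src e))) (s1 (th e))) +
  a * (1 - k) * (\sum_(e | ln e <= 0) phi1 (ps (base e)) ^+ 2 +
     \sum_(v | v \in codom rho) (effdeg (inl (ps v) : gpoint O1))%:R * phi1 (ps v) ^+ 2) < 0].
Proof.
move=> k0 k1; have r'0 : 0 <= r + k by rewrite addr_ge0// ltW.
have q1 : 0 < 2 * a / k + 8 * (r + k).
  by apply: ltr_wpDr; [apply: mulr_ge0|rewrite divr_gt0// mulr_gt0].
have q2 : 0 < 2 * (r + k) + 1 by rewrite ltr_wpDl// mulr_ge0.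
pose d0 := Num.min (Num.min 1 k)
  (Num.min (1 / (2 * a / k + 8 * (r + k))) (a * k / 2 / (2 * (r + k) + 1))).
pose d := \big[Num.min/d0]_(e | 0 < ln e) (k * ln e).
have d00 : 0 < d0 by rewrite !lt_min ltr01 k0 !divr_gt0 ?mulr_gt0.
have dpos : 0 < d by apply: lt_bigmin => // e e0; rewrite mulr_gt0.
have dd0 : d <= d0 by exact: bigmin_le_id.
move: dd0; rewrite !le_min => /andP[/andP[d1 dk] /andP[h1 h2]].
case: (approx dpos) => O1 [th [ps [st cl]]] lt.
have lt' : lambda1 a O1 < r + k by apply: lt_le_trans lt _; rewrite lerD2l.
have [phi1 [s1 [ok m0 N]]] := lambda1_approx (ltW a0) lt'.
exists O1, th, ps, phi1, s1; split=> //.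
  move=> e e0; have [_ h] := cl e; apply: le_trans (ltW h) _.
  by rewrite /d (bigmin_le_cond _ (fun e => k * ln e)).
apply: (trial st cl ok N) => //.
  by rewrite -ler_pdivlMr.
apply: le_trans (_ : d * (2 * (r + k) + 1) <= _); first by have := ltW dpos; nra.
by rewrite -ler_pdivlMr.
Qed.

(** If all the segments vanished, the inequality of trial_ex would bound a sum
of squares by a negative number. *)
Let kept_ex : (0 < #|{: E}|)%N.
Proof.
rewrite lt0n; apply/eqP => /card0_eq none.
have dead e : ln e <= 0.
  rewrite leNgt; apply/negP => e0.
  by have := none (exist _ e e0).
case: (@trial_ex (1 / 2)); [lra|lra|move=> O1 [th [ps [phi1 [s1 [_ ok _]]]]]].
rewrite big_pred0; last by move=> e; rewrite ltNge dead.
rewrite add0r; apply/negP; rewrite -leNgt; apply: mulr_ge0; first by rewrite mulr_ge0 ?(ltW a0)//; lra.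
by apply: addr_ge0; apply: sumr_ge0 => i _; rewrite ?sqr_ge0// mulr_ge0 ?sqr_ge0.
Qed.

Let O' := glued kept_ex ll_gt0 lo_ge0 lo_le pos_rho nonoverlap.

Let lost v : nat := #|[pred e | (ln e <= 0) && (base e == v)]|.

Let lost_deg (l : vertex O') : exists2 x, (x <= lost (val l))%N &
  deg (inl (val l) : gpoint O) = (#|[pred z : E * bool | rho z == val l]| + x)%N.
Proof.
rewrite deg_ends -(cardID [pred z : edge O * bool | 0 < ln z.1]).
set A := [predI _ & _]; set B := [predD _ & _]; exists #|B|.
  apply: leq_trans (leq_image_card (fun e => (e, ~~ fb e)) _); apply: subset_leq_card.
  apply/fintype.subsetP => -[e b]; rewrite !inE /= -leNgt => /andP[e0 /eqP ev].
  have bE : b = ~~ fb e.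
    apply: contrapT => nb; have bb : b = fb e by move: nb; case: b {ev}; case: (fb e).
    by have := leaf_gone e0; rewrite /leaf -bb ev (valP l).
  by apply/fintype.imageP; exists e; rewrite ?inE ?e0 ?bE//= /base -bE ev eqxx.
congr (_ + _)%N; pose g (z : E * bool) := (val z.1, z.2).
have inj : injective g by move=> [x b] [y c] [/val_inj -> ->].
rewrite -(fintype.card_image inj); apply: eq_card => -[e b]; rewrite !inE /=.
apply/andP/fintype.imageP => [[/eqP ev e0]|[[y c] + [-> ->]]].
  by exists (exist _ e e0, b); rewrite // inE /rho /= ev.
by rewrite inE /= => wv; split=> //; exact: (ll_gt0 y).
Qed.

(** Removing x ends at a vertex of degree d changes min(d, D - d) by at most x.
A free end has effective degree 1 before the limit, and at most 1 after. *)
Let effdeg_limit (l : vertex O') O1 th ps : @same_type O O1 th ps ->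
  (effdeg (inl l : gpoint O') <= effdeg (inl (ps (val l)) : gpoint O1) + lost (val l))%N.
Proof.
move=> st; rewrite glue_effdeg /=; have [x xl dE] := lost_deg l.
case vE : (sproj (inl (val l) : gpoint O)) => [u|q].
  have -> : pos (val l) = inl u by rewrite /pos vE.
  rewrite effdeg_inl (same_type_deg _ st) (same_type_inl st vE) dE.
  move: (lost (val l)) xl (#|[pred z : E * bool | rho z == val l]|) (deg _).
  move=> m xm d D; lia.
rewrite (same_type_effdeg_inr st nf vE).
have := nf vE; rewrite dE.
move: (lost (val l)) xl (#|[pred z : E * bool | rho z == val l]|) (deg _).
move=> m xm d D; lia.
Qed.

Let boundary_limit O1 th ps (phi : vertex O -> R) : @same_type O O1 th ps ->
  \sum_(l : vertex O') (effdeg (inl l : gpoint O'))%:R * phi (val l) ^+ 2 <=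
  \sum_(e | ln e <= 0) phi (base e) ^+ 2 +
  \sum_(v | v \in codom rho) (effdeg (inl (ps v) : gpoint O1))%:R * phi v ^+ 2.
Proof.
move=> st.
have : \sum_(l : vertex O') (effdeg (inl l : gpoint O'))%:R * phi (val l) ^+ 2 <=
    \sum_(l : vertex O') ((lost (val l))%:R * phi (val l) ^+ 2 +
      (effdeg (inl (ps (val l)) : gpoint O1))%:R * phi (val l) ^+ 2).
  apply: ler_sum => l _; rewrite -mulrDl ler_wpM2r ?sqr_ge0// -natrD ler_nat.
  by apply: leq_trans (effdeg_limit l st) _; rewrite addnC.
move=> /le_trans; apply.
rewrite -(big_sub (mem (codom rho)) (fun v => (lost v)%:R * phi v ^+ 2 +
      (effdeg (inl (ps v) : gpoint O1))%:R * phi v ^+ 2)) big_split lerD2r.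
rewrite (partition_big base predT) //= [leLHS]big_mkcond; apply: ler_sum => v _.
have -> : \sum_(e | (ln e <= 0) && (base e == v)) phi (base e) ^+ 2 = (lost v)%:R * phi v ^+ 2.
  rewrite (eq_bigr (fun _ => phi v ^+ 2)); last by move=> e /andP[_ /eqP ->].
  by rewrite sumr_const mulr_natl.
by case: ifP => // _; rewrite mulr_ge0 ?sqr_ge0.
Qed.

Let limit_gconn : gconn O'.
Proof.
move=> X hX u w Xu.
(* a vertex takes over the value of the vertices onto which it collapses *)
pose to (v : vertex O) (l : vertex O') := val l = v \/
  exists z, [/\ endv z = v, ln z.1 <= 0 & val l = endv (z.1, ~~ z.2)].
pose Y v := forall l, to v l -> X l.
have absent (l : vertex O') e : ln e <= 0 -> val l <> leaf e.
  by move=> e0 lE; have := leaf_gone e0; rewrite -lE (valP l).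
have YE l : Y (val l) <-> X l.
  split=> [h|Xl l']; first by apply: h; left.
  case=> [/val_inj ->//|[[e b] [/= zv e0 zw]]].
  have [bb|bb] := eqVneq b (fb e).
    by case: (absent l _ e0); exact: etrans (esym zv) (congr1 (fun c => endv (e, c)) bb).
  case: (absent l' _ e0); apply: (etrans zw); rewrite /leaf; congr endv; congr (_, _).
  by move: bb; case: (b); case: (fb e).
suff hY e : Y (src e) <-> Y (tgt e) by apply/YE; apply: (gc hY (u := val u)); exact/YE.
have [e0|e0] := ltP 0 (ln e).
  pose y : edge O' := exist _ e e0.
  by rewrite -[src e]/(val (src y)) -[tgt e]/(val (tgt y)) !YE; exact: hX.
have leafY : Y (leaf e) <-> forall l, val l = base e -> X l.
  split=> h l lE; apply: h.
    by right; exists (e, fb e).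
  case: lE => [/(absent _ _ e0)//|[z [zv _ ->]]].
  by rewrite (leaf_uniq e0 zv).
have baseY : Y (base e) <-> forall l, val l = base e -> X l.
  split=> [h l lE|h l]; first by apply: h; left.
  case=> [|[[e1 b1] [/= zv e10 zw]]]; first exact: h.
  have [bb|bb] := eqVneq b1 (fb e1); last first.
    case: (absent l _ e10); apply: (etrans zw); rewrite /leaf; congr endv; congr (_, _).
    by move: bb; case: (b1); case: (fb e1).
  have [q hq] := fbP e10; rewrite -bb in hq.
  case: (nform_unique nf hq (esym zv)) => ee bE.
  by case: (absent l _ e0); apply: (etrans zw); rewrite -ee -bE negbK.
by move: leafY baseY; rewrite /leaf /base; case: (fb e) => /= -> ->.
Qed.

(** Rescaling the remaining segments to their limit lengths turns the trial
function into one on the limit, at the price of factors 1 - k and 1 + k. *)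
Let limit_lambda1 : lambda1 a O' <= r.
Proof.
rewrite leNgt; apply/negP => rL; set L := lambda1 a O' in rL.
have L0 : 0 <= L by apply: lambda1_ge0; exact: ltW.
pose K := 2 * (r + 2 + L); have K0 : 0 < K by rewrite /K; have := r_ge0; lra.
pose k := Num.min (1 / 2) ((L - r) / K).
have k0 : 0 < k by rewrite lt_min !divr_gt0 ?subr_gt0.
have k1 : k <= 1 / 2 by rewrite ge_min lexx.
have kK : k * K <= L - r by rewrite -ler_pdivlMr// ge_min lexx orbT.
have [|O1 [th [ps [phi1 [s1 [st ok cl lt]]]]]] := @trial_ex k k0; first by lra.
have key : (r + k) * (1 + k) < L * (1 - k).
  by have := r_ge0; rewrite /K in kK; nra.
case: (st) => bt bp ends hs _.
have srcE e : src (th e) = ps (src e) := ends (e, false).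
have tgtE e : tgt (th e) = ps (tgt e) := ends (e, true).
pose c (e : edge O) := ln e / len (th e).
have cP e : 0 < ln e -> [/\ 0 < c e, 1 - k <= c e & 1 <= (1 + k) * c e].
  move=> e0; have l0 := len_gt0 (th e); split; first by rewrite divr_gt0.
    rewrite ler_pdivlMr//; have := cl e e0; rewrite ler_norml => /andP[h1 h2].
    have h3 : len (th e) <= (1 + k) * ln e by rewrite mulrDl mul1r -lerBlDl.
    have h4 : 0 <= 1 - k by lra.
    apply: le_trans (ler_wpM2l h4 h3) _; rewrite mulrA ler_piMl ?(ltW e0)//.
    by rewrite -subr_sqr expr1n lerBlDr lerDl sqr_ge0.
  rewrite mulrA ler_pdivlMr// mul1r.
  have := cl e e0; rewrite ler_norml => /andP[_ h2].
  by rewrite mulrDl mul1r -lerBlDl.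
pose phi (l : vertex O') := phi1 (ps (val l)).
pose s (x : edge O') := scale (c (val x)) (s1 (th (val x))).
have okO : plok phi s.
  split=> [l|x]; first exact: ok.1.
  have [ws ls es] := ok.2 (th (val x)); have [c0 _ _] := cP _ (valP x).
  split; first exact: scale_wf.
    by rewrite scale_len ls divfK// gt_eqF// len_gt0.
  by rewrite scale_last /phi /= /rho -!ends.
have srcO (x : edge O') : phi (src x) = phi1 (ps (src (val x))) by [].
pose F e := penergy (phi1 (ps (src e))) (s1 (th e)) -
  (r + k) * pmass (phi1 (ps (src e))) (s1 (th e)).
have edges : (1 - k) * \sum_(x : edge O') penergy (phi (src x)) (s x)
    - (r + k) * (1 + k) * gmass phi s <= \sum_(e | 0 < ln e) F e.
  rewrite (big_sub [pred e | 0 < ln e] F) /gmass !mulr_sumr -sumrB.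
  apply: ler_sum => x _; rewrite !srcO /F /s.
  have [ws _ _] := ok.2 (th (val x)); have [c0 c1 c2] := cP _ (valP x).
  rewrite (scale_energy (phi1 (ps (src (val x)))) c0 ws) scale_mass.
  have m0 := pmass_ge0 (phi1 (ps (src (val x)))) ws.
  have e0 := penergy_ge0 (phi1 (ps (src (val x)))) (scale_wf c0 ws).
  apply: lerB; first by rewrite ler_wpM2r.
  rewrite -mulrA ler_wpM2l ?addr_ge0 ?r_ge0 ?(ltW k0)//.
  by rewrite mulrA; apply: ler_peMl.
have bd := boundary_limit (fun v => phi1 (ps v)) st.
have N : (1 - k) * gnum (@bweight _ _ a O') phi s < (r + k) * (1 + k) * gmass phi s.
  rewrite /gnum mulrDr.
  have -> : \sum_(v : vertex O') bweight a v * phi v ^+ 2 =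
      a * \sum_(l : vertex O') (effdeg (inl l : gpoint O'))%:R * phi1 (ps (val l)) ^+ 2.
    by rewrite mulr_sumr; apply: eq_bigr => l _; rewrite /bweight mulrA.
  have ak : 0 <= a * (1 - k) by rewrite mulr_ge0 ?(ltW a0)//; lra.
  have := ler_wpM2l ak bd; move: edges lt; rewrite -/F.
  rewrite mulrA [_ * a]mulrC.
  move: (a * (1 - k) * _) => B1; move: (a * (1 - k) * _) => B2.
  by lra.
have := lambda1_le (ltW a0) okO; rewrite -/L => le.
have m0 := gmass_ge0 okO.
have : L * (1 - k) * gmass phi s <= (1 - k) * gnum (@bweight _ _ a O') phi s.
  by rewrite mulrAC mulrC ler_wpM2l//; lra.
move=> /le_lt_trans/(_ N); apply/negP; rewrite -leNgt.
by apply: ler_wpM2r => //; exact: ltW.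
Qed.

(** Lower semicontinuity of the energy on a combinatorial type completed by its
degenerate limits: Ol consists of the segments that do not vanish. *)
Lemma limit_subgraph : exists (Ol : subgraph G) (i : edge Ol -> edge O),
  [/\ gconn Ol, lambda1 a Ol <= r &
     forall x, [/\ host x = host (i x), off x = ofs (i x) & len x = ln (i x)]].
Proof. by exists O', val; split. Qed.

End LimitOf.
End Limit.

(** * Existence of minimizing partitions *)

Section Codes.
Context {R : realType} {G : mgraph R}.
Implicit Types (O : subgraph G).

Let M := (#|edge G| * 2)%N.

(** The combinatorial type of a subgraph in normal form, as an element of a
finite type: edges and vertices are named by their ranks. *)
Definition code_entry := ('I_(M * 2).+1 * 'I_(M * 2).+1 * edge G * bool * bool)%type.

Definition code O : 'I_M.+1 * 'I_(M * 2).+1 * {ffun 'I_M -> option code_entry} :=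
  (inord #|edge O|, inord #|vertex O|,
   [ffun i : 'I_M => omap (fun j : 'I_#|edge O| => let e := enum_val j in
      (inord (enum_rank (src e)), inord (enum_rank (tgt e)), host e,
       off e == 0, off e + len e == len (host e)) : code_entry) (insub (val i))]).

Definition nth_off O (j : nat) : R :=
  if insub j is Some i then off (enum_val (i : 'I_#|edge O|)) else 0.
Definition nth_len O (j : nat) : R :=
  if insub j is Some i then len (enum_val (i : 'I_#|edge O|)) else 0.

(** Elements of equal rank correspond to each other. *)
Lemma code_same_type O O1 : nform O -> gconn O -> nform O1 -> gconn O1 ->
  code O = code O1 -> exists th ps, @same_type _ _ O O1 th ps /\
  forall e, off (th e) = nth_off O1 (enum_rank e) /\ len (th e) = nth_len O1 (enum_rank e).
Proof.
move=> nf gc nf1 gc1 [].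
have eM := edge_bound nf gc; have eM1 := edge_bound nf1 gc1.
have vM : (#|vertex O| <= M * 2)%N.
  by apply: leq_trans (vertex_bound O) _; rewrite leq_mul2r eM orbT.
have vM1 : (#|vertex O1| <= M * 2)%N.
  by apply: leq_trans (vertex_bound O1) _; rewrite leq_mul2r eM1 orbT.
move=> /(congr1 val); rewrite /= !inordK ?ltnS// => eE.
move=> /(congr1 val); rewrite /= !inordK ?ltnS// => vE /ffunP tab.
pose th e : edge O1 := enum_val (cast_ord eE (enum_rank e)).
pose ps v : vertex O1 := enum_val (cast_ord vE (enum_rank v)).
have th_inj : injective th by move=> x y /enum_val_inj /cast_ord_inj /enum_rank_inj.
have ps_inj : injective ps by move=> x y /enum_val_inj /cast_ord_inj /enum_rank_inj.
have bt : bijective th by apply: inj_card_bij => //; rewrite eE.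
have bp : bijective ps by apply: inj_card_bij => //; rewrite vE.
have nthE e (h : (enum_rank e < #|edge O1|)%N) : enum_val (Ordinal h) = th e.
  by rewrite /th; congr enum_val; apply: val_inj.
have rankE v : enum_rank (ps v) = enum_rank v :> nat by rewrite enum_valK.
have vinj (v : vertex O) (w : vertex O1) : inord (enum_rank v) = inord (enum_rank w) :> 'I_(M * 2).+1 ->
    w = ps v.
  move=> /(congr1 val); rewrite /= !inordK.
  - by rewrite -rankE => /val_inj /enum_rank_inj.
  - by rewrite ltnS; apply: leq_trans vM1; apply: ltnW.
  - by rewrite ltnS; apply: leq_trans vM; apply: ltnW.
have tabE e : [/\ src (th e) = ps (src e), tgt (th e) = ps (tgt e), host (th e) = host e,
    (off (th e) == 0) = (off e == 0) &
    (off (th e) + len (th e) == len (host (th e))) = (off e + len e == len (host e))].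
  have iM : (enum_rank e < M)%N by apply: leq_trans (ltn_ord _) eM.
  have i1 : (enum_rank e < #|edge O1|)%N by rewrite -eE.
  have E0 : insub (enum_rank e : nat) = Some (enum_rank e) :> option 'I_#|edge O|.
    by rewrite -[RHS]valK.
  have E1 : insub (enum_rank e : nat) = Some (Ordinal i1) :> option 'I_#|edge O1|.
    by rewrite -[RHS]valK.
  have := tab (Ordinal iM); rewrite !ffunE /= E0 E1 /= enum_rankK nthE.
  move=> -[/vinj s /vinj t h o l].
  by split.
exists th, ps; split.
  split=> //.
  - by move=> [e []]; have [] := tabE e.
  - by move=> e; have [] := tabE e.
  - by move=> e; have [_ _ h o l] := tabE e; split; [exact: o|rewrite -l h].
move=> e; have i1 : (enum_rank e < #|edge O1|)%N by rewrite -eE.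
have E1 : insub (enum_rank e : nat) = Some (Ordinal i1) :> option 'I_#|edge O1|.
  by rewrite -[RHS]valK.
by rewrite /nth_off /nth_len E1 nthE.
Qed.

Let B : R := \sum_(e : edge G) len e.

Lemma len_le_total (e : edge G) : len e <= B.
Proof.
by rewrite /B (bigD1 e)//= lerDl; apply: sumr_ge0 => i _; exact/ltW/len_gt0.
Qed.

Lemma nth_off_bound O j : nth_off O j \in `[0, B].
Proof.
have B0 : 0 <= B by apply: sumr_ge0 => e _; exact/ltW/len_gt0.
rewrite /nth_off in_itv/=; case: insub => [i|]; last by rewrite lexx.
set e := enum_val i; rewrite off_ge0 /=; apply: le_trans (len_le_total (host e)).
by apply: le_trans (off_le e); rewrite lerDl ltW// len_gt0.
Qed.

Lemma nth_len_bound O j : nth_len O j \in `[0, B].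
Proof.
have B0 : 0 <= B by apply: sumr_ge0 => e _; exact/ltW/len_gt0.
rewrite /nth_len in_itv/=; case: insub => [i|]; last by rewrite lexx.
set e := enum_val i; rewrite ltW ?len_gt0//=; apply: le_trans (len_le_total (host e)).
by apply: le_trans (off_le e); rewrite lerDr off_ge0.
Qed.

End Codes.

Section Ultra.
Context {R : realType} (U : set_system nat).
Hypothesis uU : UltraFilter U.

Lemma ultra_const (T : finType) (F : nat -> T) : exists t, U [set n | F n = t].
Proof.
apply: contrapT => no.
have h : U [set n | forall t, F n <> t].
  apply: (@filter_forall _ _ (fun t n => F n <> t) U) => t.
  have [h|//] := in_ultra_setVsetC [set n | F n = t] uU.
  by case: no; exists t.
by have [n /(_ (F n))] := filter_ex h.
Qed.

Lemma ultra_lim (x : nat -> R) (b : R) : (forall n, x n \in `[0, b]) ->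
  exists y, forall d, 0 < d -> U [set n | `|x n - y| < d].
Proof.
move=> xb; have xU : (x @ U) `[0, b]%classic.
  by apply: (@filterS _ U _ setT) => [n _|]; [have := xb n|exact: filterT].
have [] := @segment_compact R 0 b (x @ U) _ xU.
move=> y [_ cy]; exists y => d d0.
have [//|h] := in_ultra_setVsetC [set n | `|x n - y| < d] uU.
have := cy [set z | ~ (`|z - y| < d)] (ball y d) h (nbhsx_ballx y d d0).
by case=> z [] /=; rewrite /ball/= distrC => nz.
Qed.

End Ultra.

Section Existence.
Context {R : realType} {G : mgraph R}.
Implicit Types (a r : R).

Lemma normal_partition k (P : 'I_k -> subgraph G) : is_partition P ->
  exists P' : 'I_k -> subgraph G, [/\ is_partition P', forall i, nform (P' i),
    forall i, gconn (P' i) &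
    forall a i, 0 <= a -> lambda1 a (P' i) <= lambda1 a (P i)].
Proof.
move=> /is_partitionP[cP nP].
have /choice[P' hP'] : forall i, exists O', [/\ nform O', gconn O',
    forall Q, nov (P i) Q -> nov O' Q & forall a, 0 <= a -> lambda1 a O' <= lambda1 a (P i)].
  by move=> i; apply: normal_form; exact: connected_gconn.
exists P'; split=> [|i|i|a i a0].
- apply/is_partitionP; split=> [i|i j ij].
    by apply: gconn_connected; have [] := hP' i.
  have [_ _ hi _] := hP' i; have [_ _ hj _] := hP' j.
  by apply: hi; apply: nov_sym; apply: hj; apply: nov_sym; exact: nP.
- by have [] := hP' i.
- by have [] := hP' i.
- by have [_ _ _] := hP' i; apply.
Qed.

(** Compactness: along an ultrafilter the pieces of a minimizing sequence of
partitions in normal form have constant combinatorial types, and the positions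
of their free ends converge. *)
Lemma minimizing_limit k a r : 0 < a ->
  (forall d, 0 < d -> exists2 P : 'I_k -> subgraph G, is_partition P &
     forall i, lambda1 a (P i) < r + d) ->
  exists2 P : 'I_k -> subgraph G, is_partition P & forall i, lambda1 a (P i) <= r.
Proof.
move=> a0 hmin.
have /choice[P hP] : forall n : nat, exists P : 'I_k -> subgraph G,
    [/\ is_partition P, forall i, nform (P i), forall i, gconn (P i) &
        forall i, lambda1 a (P i) < r + n.+1%:R^-1].
  move=> n; have [|P0 pP0 lP0] := hmin n.+1%:R^-1; first by rewrite invr_gt0.
  have [P [pP nP gP lP]] := normal_partition pP0.
  exists P; split=> // i; exact: le_lt_trans (lP a i (ltW a0)) (lP0 i).
have [U [uU oU]] := ultraFilterLemma eventually_filter.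
have [c Uc] := ultra_const uU (fun n => [ffun i => code (P n i)]).
have [m mc] := filter_ex Uc.
pose O i := P m i.
have Ucode : U [set n | forall i, code (O i) = code (P n i)].
  apply: filterS Uc => n /= nc i.
  by move: mc; rewrite /= -nc => /ffunP/(_ i); rewrite !ffunE.
have /choice[yo hyo] : forall ij : 'I_k * nat, exists y, forall d, 0 < d ->
    U [set n | `|nth_off (P n ij.1) ij.2 - y| < d].
  by move=> ij; apply: ultra_lim => // n; exact: nth_off_bound.
have /choice[yl hyl] : forall ij : 'I_k * nat, exists y, forall d, 0 < d ->
    U [set n | `|nth_len (P n ij.1) ij.2 - y| < d].
  by move=> ij; apply: ultra_lim => // n; exact: nth_len_bound.
pose ofs i (e : edge (O i)) := yo (i, enum_rank e : nat).
pose ln i (e : edge (O i)) := yl (i, enum_rank e : nat).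
have [_ nfm gcm _] := hP m.
have near_d d : 0 < d -> U [set n | forall i, near_type (@ofs i) (@ln i) d (P n i) /\
    lambda1 a (P n i) < r + d].
  move=> d0.
  have Uo : U [set n | forall i (e : edge (O i)),
      `|nth_off (P n i) (enum_rank e) - ofs i e| < d].
    apply: (@filter_forall _ _ (fun i n => forall e : edge (O i),
      `|nth_off (P n i) (enum_rank e) - ofs i e| < d) U) => i.
    apply: (@filter_forall _ _ (fun e n =>
      `|nth_off (P n i) (enum_rank e) - ofs i e| < d) U) => e.
    exact: (hyo (i, enum_rank e : nat)).
  have Ul : U [set n | forall i (e : edge (O i)),
      `|nth_len (P n i) (enum_rank e) - ln i e| < d].
    apply: (@filter_forall _ _ (fun i n => forall e : edge (O i),
      `|nth_len (P n i) (enum_rank e) - ln i e| < d) U) => i.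
    apply: (@filter_forall _ _ (fun e n =>
      `|nth_len (P n i) (enum_rank e) - ln i e| < d) U) => e.
    exact: (hyl (i, enum_rank e : nat)).
  have Ud : U [set n | n.+1%:R^-1 < d :> R].
    by apply: oU; exact: (near_infty_natSinv_lt (PosNum d0)).
  apply: filterS (filterI (filterI Uo Ul) (filterI Ucode Ud)) => n [[no nl] [nc nd]] i.
  have [_ nfn gcn ln_] := hP n; split; last first.
    by apply: lt_trans (ln_ i) _; rewrite ltrD2l.
  have [th [ps [st ht]]] := code_same_type (nfm i) (gcm i) (nfn i) (gcn i) (nc i).
  by exists th, ps; split=> // e; have [-> ->] := ht e; split; [exact: no|exact: nl].
have /choice[Q hQ] : forall i, exists Ol : subgraph G, exists f : edge Ol -> edge (O i),
   [/\ gconn Ol, lambda1 a Ol <= r &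
     forall x, [/\ host x = host (f x), off x = ofs i (f x) & len x = ln i (f x)]].
  move=> i; apply: (limit_subgraph (nfm i) (gcm i) a0) => d d0.
  have [n hn] := filter_ex (near_d d d0).
  by exists (P n i); have [] := hn i.
exists Q; last by move=> i; have [f []] := hQ i.
apply/is_partitionP; split=> [i|i j ij].
  by apply: gconn_connected; have [f []] := hQ i.
have [f [_ _ hf]] := hQ i; have [g [_ _ hg]] := hQ j.
move=> x y xy; have [hx ox lx] := hf x; have [hy oy ly] := hg y.
have hh : host (f x) = host (g y) by rewrite -hx -hy.
have x0 := len_gt0 x; have y0 := len_gt0 y; rewrite ox oy lx ly in x0 y0 *.
have [h1|h1] := leP (ofs i (f x) + ln i (f x)) (ofs j (g y)); first by left.
have [h2|h2] := leP (ofs j (g y) + ln j (g y)) (ofs i (f x)); first by right.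
exfalso; pose d := Num.min ((ofs i (f x) + ln i (f x) - ofs j (g y)) / 3)
  ((ofs j (g y) + ln j (g y) - ofs i (f x)) / 3).
have d0 : 0 < d by rewrite lt_min !divr_gt0// subr_gt0.
have dA : d <= (ofs i (f x) + ln i (f x) - ofs j (g y)) / 3 by rewrite ge_min lexx.
have dB : d <= (ofs j (g y) + ln j (g y) - ofs i (f x)) / 3 by rewrite ge_min lexx orbT.
have [n hn] := filter_ex (near_d d d0).
have [[th [ps [[_ _ _ hs _] cl]]] _] := hn i.
have [[th' [ps' [[_ _ _ hs' _] cl']]] _] := hn j.
have [/is_partitionP[_ /(_ i j ij) no] _ _ _] := hP n.
have [c1 c2] := cl (f x); have [c3 c4] := cl' (g y).
have := no (th (f x)) (th' (g y)); rewrite hs hs' => /(_ hh).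
exact: overlap_stable h1 h2 dA dB c1 c2 c3 c4.
Qed.

End Existence.

(** * Strict monotonicity of lambda1 *)

Section Shift.
Context {R : realType}.
Implicit Types (s : seq (R * R)) (c t : R).

(** A lower bound for the integral of a nonnegative piecewise linear
function, of the same kind as pmass. *)
Fixpoint pint c s : R :=
  if s is q :: s' then q.1 * Num.min c q.2 + pint q.2 s' else 0.

Definition shift t s : seq (R * R) := [seq (q.1, q.2 + t) | q <- s].

Lemma shift_wf t s : 0 <= t -> plwf s -> plwf (shift t s).
Proof.
by move=> t0; elim: s => //= q s IH /andP[/andP[-> q0] /IH ->]; rewrite addr_ge0.
Qed.

Lemma shift_len t s : plen (shift t s) = plen s.
Proof. by elim: s => //= q s ->. Qed.

Lemma shift_last t c s : plast (c + t) (shift t s) = plast c s + t.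
Proof. by rewrite /plast; elim: s c => //= q s IH c. Qed.

Lemma shift_energy t c s : penergy (c + t) (shift t s) = penergy c s.
Proof.
elim: s c => //= q s IH c; rewrite IH; congr ((_ ^+ 2) / _ + _).
by rewrite opprD addrACA subrr addr0.
Qed.

(** Expand the square on each cell, and drop the term in t ^+ 2. *)
Lemma shift_mass t c s : plwf s -> pmass c s + 2 * t * pint c s <= pmass (c + t) (shift t s).
Proof.
elim: s c => [|[h d] s IH] c /=; first by rewrite mulr0 addr0.
move=> /andP[/andP[/= h0 d0] ws]; rewrite -addr_minl.
have := IH d ws; move: (Num.min c d) => m.
have : 0 <= h * t ^+ 2 by rewrite mulr_ge0 ?sqr_ge0// ltW.
by nra.
Qed.

Lemma pmass_le_pint c s (x T E K : R) : plwf s -> 0 <= c -> 0 <= T -> 0 <= E ->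
  (c - x) ^+ 2 <= T * E ->
  (forall y, 0 <= y -> (y - x) ^+ 2 <= (T + plen s) * (E + penergy c s) -> y <= K) ->
  pmass c s <= K * pint c s.
Proof.
elim: s c T E => [|[h d] s IH] c T E /=; first by rewrite mulr0.
move=> /andP[/andP[/= h0 d0] ws] c0 T0 E0 cx.
have A0 := @step_energy_ge0 _ h c d h0; have l0 := plen_ge0 ws.
have e0 := penergy_ge0 d ws; set A := (d - c) ^+ 2 / h in A0 *.
rewrite !addrA => hK.
have dx : (d - x) ^+ 2 <= (T + h) * (E + A).
  have -> : d - x = (c - x) + (d - c) by ring.
  by apply: sqr_addr_le => //; [exact: ltW|exact: step_energy].
have H := IH d (T + h) (E + A) ws d0 (addr_ge0 T0 (ltW h0)) (addr_ge0 E0 A0) dx hK.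
rewrite mulrDr; apply: lerD => //.
have m0 : 0 <= Num.min c d by rewrite le_min c0.
have cK : c <= K.
  apply: hK => //; apply: le_trans cx _; apply: ler_pM => //; rewrite -addrA lerDl addr_ge0//.
  exact: ltW.
have mK : Num.min c d <= K by rewrite ge_min cK.
rewrite [leRHS]mulrCA; apply: ler_wpM2l; first exact: ltW.
by rewrite expr2; apply: ler_wpM2r.
Qed.

End Shift.

Section Strict.
Context {R : realType} {G : mgraph R} (O : subgraph G).
Hypothesis gc : gconn O.
Context (v0 : vertex O).
Hypothesis v0P : (0 < effdeg (inl v0 : gpoint O))%N.

Let w (v : vertex O) : R := (effdeg (inl v : gpoint O))%:R.
Let w_ge0 v : 0 <= w v. Proof. exact: ler0n. Qed.

Let penergy_le_gnum (b : R) phi s (e : edge O) : 0 <= b -> plok phi s ->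
  penergy (phi (src e)) (s e) <= gnum (@bweight _ _ b O) phi s.
Proof.
move=> b0 ok; rewrite /gnum (bigD1 e)//= -addrA lerDl.
apply: addr_ge0; apply: sumr_ge0 => i _; first by apply: penergy_ge0; have [] := ok.2 i.
by apply: mulr_ge0; [exact: bweight_ge0|exact: sqr_ge0].
Qed.

(** Poincare inequality: starting from a boundary vertex, the energy controls
the values at all the vertices, by connectedness. *)
Lemma vertex_value_bound (b : R) : 0 < b -> forall v : vertex O, exists C : R, 0 <= C /\
  forall phi s, plok phi s -> phi v ^+ 2 <= C * gnum (@bweight _ _ b O) phi s.
Proof.
move=> b0; pose X (v : vertex O) := exists C : R, 0 <= C /\
  forall phi s, plok phi s -> phi v ^+ 2 <= C * gnum (@bweight _ _ b O) phi s.
move=> v; change (X v); apply: (gc (X := X) _ (u := v0)) => [e|]; last first.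
  exists b^-1; split=> [|phi s ok]; first by rewrite invr_ge0 ltW.
  rewrite mulrC ler_pdivlMr// /gnum (bigD1 v0)//=.
  have w1 : 1 <= w v0 by rewrite ler1n.
  have h1 : phi v0 ^+ 2 * b <= bweight b v0 * phi v0 ^+ 2.
    by rewrite mulrC ler_wpM2r ?sqr_ge0// ler_peMr ?(ltW b0).
  apply: le_trans h1 _; rewrite addrCA lerDl; apply: addr_ge0; apply: sumr_ge0 => i _.
    by apply: penergy_ge0; have [] := ok.2 i.
  by apply: mulr_ge0; [apply: bweight_ge0; exact: ltW|exact: sqr_ge0].
have l0 := ltW (len_gt0 e).
have step (x y C N E : R) : 0 <= C -> (y - x) ^+ 2 <= len e * E -> E <= N ->
    x ^+ 2 <= C * N -> y ^+ 2 <= (2 * C + 2 * len e) * N.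
  move=> C0 h1 h2 h3; have := ler_wpM2l l0 h2; have := sqr_ge0 (y - 2 * x); nra.
split=> -[C [C0 hC]]; exists (2 * C + 2 * len e); split; rewrite ?addr_ge0 ?mulr_ge0//.
  move=> phi s ok; have [ws ls es] := ok.2 e.
  apply: (step (phi (src e)) _ _ _ (penergy (phi (src e)) (s e))) (hC _ _ ok) => //.
    by rewrite -ls -es; exact: penergy_plast.
  by apply: penergy_le_gnum => //; exact: ltW.
move=> phi s ok; have [ws ls es] := ok.2 e.
apply: (step (phi (tgt e)) _ _ _ (penergy (phi (src e)) (s e))) (hC _ _ ok) => //.
  by rewrite -sqrrN opprB -ls -es; exact: penergy_plast.
by apply: penergy_le_gnum => //; exact: ltW.
Qed.

Lemma lambda1_gt0 (b : R) : 0 < b -> 0 < lambda1 b O.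
Proof.
move=> b0; have /choice[C hC] := vertex_value_bound b0.
pose k e := len e * (2 * C (src e) + 2 * len e).
have k0 (e : edge O) : 0 <= k e.
  have l0 := ltW (len_gt0 e); have [C0 _] := hC (src e).
  by rewrite mulr_ge0// addr_ge0// mulr_ge0.
pose K := 1 + \sum_e k e.
have K0 : 0 < K by rewrite ltr_wpDr// sumr_ge0.
have bound phi s : plok phi s -> gmass phi s <= K * gnum (@bweight _ _ b O) phi s.
  move=> ok; have N0 : 0 <= gnum (@bweight _ _ b O) phi s.
    by apply: gnum_ge0 => // v; apply: bweight_ge0; exact: ltW.
  apply: (@le_trans _ _ ((\sum_e k e) * gnum (@bweight _ _ b O) phi s)); last first.
    by rewrite ler_wpM2r// lerDr.
  rewrite mulr_suml; apply: ler_sum => e _; have [ws ls _] := ok.2 e.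
  have l0 := ltW (len_gt0 e); have [C0 h1] := hC (src e).
  have h2 := penergy_le_gnum e (ltW b0) ok.
  have := @pmass_le_from _ (phi (src e)) (s e) (phi (src e)) 0 0 ws (ok.1 _) (lexx _) (lexx _).
  rewrite subrr expr0n mul0r !add0r ls => /(_ (lexx _))/le_trans; apply.
  rewrite /k -mulrA; apply: ler_wpM2l => //.
  set N := gnum _ _ _ in h1 h2 *.
  have -> : (2 * C (src e) + 2 * len e) * N = 2 * (C (src e) * N) + 2 * (len e * N) by ring.
  by apply: lerD; apply: ler_wpM2l => //; [exact: h1|exact: ler_wpM2l].
apply: (@lt_le_trans _ _ K^-1); first by rewrite invr_gt0.
rewrite leNgt; apply/negP => lt.
have [phi [s [ok m0 N]]] := lambda1_approx (ltW b0) lt.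
have := bound _ _ ok; rewrite leNgt => /negP; apply.
by rewrite mulrC -ltr_pdivlMr// mulrC.
Qed.

(** Otherwise a near-minimizer for b has almost no boundary term, since lowering
the parameter to a does not pay. Adding a constant t to it then increases the
boundary term by little more than a multiple of t ^+ 2, but the mass by a
multiple of t, because nonnegative functions with bounded values have an
integral controlled by their mass. As lambda1 is positive, this lowers the
Rayleigh quotient below lambda1. *)
Lemma lambda1_strict (a b : R) : 0 < a -> a < b -> lambda1 a O < lambda1 b O.
Proof.
move=> a0 ab; have b0 := lt_trans a0 ab; set L := lambda1 b O.
have L0 : 0 < L by exact: lambda1_gt0.
rewrite ltNge; apply/negP => La.
pose W := \sum_v w v.
have W1 : 0 < W.
  rewrite /W (bigD1 v0)//= ltr_wpDr ?ltr0n//; apply: sumr_ge0 => v _; exact: w_ge0.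
(* the square of any value of a trial function of mass m is at most C * m *)
pose C := \sum_(e : edge O) (2 / len e + 8 * len e * (L + 1)).
have C0e (e : edge O) : 0 < 2 / len e + 8 * len e * (L + 1).
  by rewrite addr_gt0 ?divr_gt0 ?mulr_gt0 ?len_gt0// ltr_wpDr.
have C0 : 0 < C.
  have /card_gt0P[e _] := edge_ex O.
  by rewrite /C (bigD1 e)//= ltr_wpDr// sumr_ge0// => i _; exact: ltW.
pose D := 2 * b * W * C.
have D0 : 0 < D by rewrite !mulr_gt0.
(* balances the linear gain 2 * L * tau against the quadratic cost D * tau ^+ 2 *)
pose tau := L / D; have tau0 : 0 < tau by rewrite divr_gt0.
pose A := 1 + b / (b - a).
have ba0 : 0 < b - a by rewrite subr_gt0.
have A0 : 0 < A by rewrite ltr_wpDr// divr_ge0// ltW.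
pose eta := Num.min 1 (L * tau / (2 * A)).
have eta0 : 0 < eta by rewrite lt_min ltr01 /=; apply: divr_gt0; apply: mulr_gt0.
have eta1 : eta <= 1 by rewrite ge_min lexx.
have etaA : eta * A <= L * tau / 2.
  have : eta <= L * tau / (2 * A) by rewrite ge_min lexx orbT.
  by rewrite ler_pdivlMr ?mulr_gt0//; lra.
have [phi [s [ok m0 N]]] : exists (phi : vertex O -> R) s, [/\ plok phi s, 0 < gmass phi s &
    gnum (@bweight _ _ b O) phi s < (L + eta) * gmass phi s].
  by apply: lambda1_approx; [exact: ltW|rewrite ltrDl].
set m := gmass phi s in m0 N.
pose E := \sum_(e : edge O) penergy (phi (src e)) (s e).
pose S := \sum_(v : vertex O) w v * phi v ^+ 2.
have gE c : gnum (@bweight _ _ c O) phi s = E + c * S.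
  rewrite /gnum; congr (_ + _); rewrite mulr_sumr; apply: eq_bigr => v _.
  by rewrite /bweight mulrA.
rewrite gE in N.
have hS : (b - a) * S <= eta * m.
  have := lambda1_le (ltW a0) ok; rewrite gE -/m.
  have := ler_wpM2r (ltW m0) La; nra.
have E0 (e : edge O) : 0 <= penergy (phi (src e)) (s e).
  by apply: penergy_ge0; have [] := ok.2 e.
have S0 : 0 <= S by apply: sumr_ge0 => v _; rewrite mulr_ge0 ?sqr_ge0.
have EL (e : edge O) : penergy (phi (src e)) (s e) <= (L + 1) * m.
  have h1 : penergy (phi (src e)) (s e) <= E.
    by rewrite /E (bigD1 e)//= lerDl sumr_ge0.
  apply: le_trans h1 _; have := mulr_ge0 (ltW b0) S0.
  have := ler_wpM2r (ltW m0) eta1; nra.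
pose K := Num.sqrt (C * m).
have K2 : K ^+ 2 = C * m by rewrite sqr_sqrtr// mulr_ge0// ltW.
have K0 : 0 < K by rewrite sqrtr_gt0 mulr_gt0.
pose F := \sum_(e : edge O) pint (phi (src e)) (s e).
have mKF : m <= K * F.
  rewrite /m /gmass /F mulr_sumr; apply: ler_sum => e _.
  have [ws ls es] := ok.2 e; have c0 := ok.1 (src e); have l0 := len_gt0 e.
  apply: (@pmass_le_pint _ _ _ (phi (src e)) 0 0) => //; first by rewrite subrr expr0n mul0r.
  move=> y y0; rewrite !add0r ls => hy.
  rewrite -(ler_pXn2r (n := 2)) ?nnegrE ?(ltW K0)// K2.
  have := @pmass_ge_from _ (phi (src e)) (s e) y (len e) (penergy (phi (src e)) (s e)) ws c0
    (ltW l0) (E0 e); rewrite -sqrrN opprB => /(_ hy); rewrite ls => h.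
  have me : pmass (phi (src e)) (s e) <= m.
    rewrite /m /gmass (bigD1 e)//= lerDl; apply: sumr_ge0 => i _.
    by apply: pmass_ge0; have [] := ok.2 i.
  have : y ^+ 2 <= (2 / len e + 8 * len e * (L + 1)) * m.
    rewrite -(ler_pM2l l0); apply: le_trans h _.
    have -> : len e * ((2 / len e + 8 * len e * (L + 1)) * m) =
       2 * m + 8 * len e ^+ 2 * ((L + 1) * m) by field; exact: lt0r_neq0.
    have -> : 2 * len e * ((len e + len e) * (penergy (phi (src e)) (s e) + penergy (phi (src e)) (s e)))
      = 8 * len e ^+ 2 * penergy (phi (src e)) (s e) by ring.
    apply: lerD; first by rewrite ler_wpM2l.
    by rewrite ler_wpM2l ?EL// mulr_ge0 ?sqr_ge0.
  move=> /le_trans; apply; rewrite ler_wpM2r ?(ltW m0)//.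
  by rewrite /C (bigD1 e)//= lerDl sumr_ge0// => i _; exact: ltW.
pose t := tau * K; have t0 : 0 < t by rewrite mulr_gt0.
pose phit v := phi v + t; pose st e := shift t (s e).
have okt : plok phit st.
  split=> [v|e]; first by rewrite addr_ge0 ?(ltW t0)//; exact: ok.1.
  have [ws ls es] := ok.2 e; split; first by apply: shift_wf => //; exact: ltW.
    by rewrite shift_len.
  by rewrite shift_last es.
have mt : m + 2 * t * F <= gmass phit st.
  rewrite /m /gmass /F mulr_sumr -big_split; apply: ler_sum => e _.
  by apply: shift_mass; have [] := ok.2 e.
have Nt : gnum (@bweight _ _ b O) phit st <= E + 2 * b * S + 2 * b * t ^+ 2 * W.
  rewrite /gnum -addrA; apply: lerD.
    by apply: ler_sum => e _; rewrite shift_energy.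
  rewrite /S /W !mulr_sumr -big_split; apply: ler_sum => v _; rewrite /bweight -/(w v) /phit.
  have h : (phi v + t) ^+ 2 <= 2 * phi v ^+ 2 + 2 * t ^+ 2 by have := sqr_ge0 (phi v - t); nra.
  apply: le_trans (ler_wpM2l (mulr_ge0 (ltW b0) (w_ge0 v)) h) _.
  rewrite le_eqVlt; apply/orP; left; apply/eqP; rewrite /=; ring.
have := lambda1_le (ltW b0) okt; rewrite -/L => H.
have H1 : L * (m + 2 * t * F) <= E + 2 * b * S + 2 * b * t ^+ 2 * W.
  by apply: le_trans Nt; apply: le_trans H; rewrite ler_wpM2l ?(ltW L0).
have H2 : L * (2 * t * F) <= eta * m + b * S + 2 * b * t ^+ 2 * W.
  by move: H1 N; rewrite mulrDr mulrDl; lra.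
have H3 : 2 * L * tau * m <= L * (2 * t * F).
  have c0 : 0 <= 2 * L * tau by apply/ltW; rewrite mulr_gt0// mulr_gt0.
  apply: le_trans (ler_wpM2l c0 mKF) _.
  by rewrite le_eqVlt; apply/orP; left; apply/eqP; rewrite /t; ring.
have H4 : 2 * b * t ^+ 2 * W = L * tau * m.
  rewrite /t exprMn K2.
  have -> : 2 * b * (tau ^+ 2 * (C * m)) * W = (tau * D) * tau * m by rewrite /D; ring.
  by rewrite /tau divfK// gt_eqF.
have H5 : eta * m + b * S <= eta * A * m.
  have : S <= eta * m / (b - a) by rewrite ler_pdivlMr// mulrC.
  move=> /(ler_wpM2l (ltW b0)).
  have -> : eta * A * m = eta * m + b * (eta * m / (b - a)) by rewrite /A; field; exact: lt0r_neq0.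
  lra.
have := ler_wpM2r (ltW m0) etaA.
have : 0 < L * tau * m by rewrite mulr_gt0// mulr_gt0.
lra.
Qed.

End Strict.

(** * The optimal energy *)

Section Boundary.
Context {R : realType} {G : mgraph R}.
Implicit Types O Q : subgraph G.

(** A connected subgraph all of whose effective degrees vanish contains, with
each vertex, all the edges at this vertex: it fills the connected graph G, and
leaves no room for another one. *)
Lemma boundary_vertex_ex O Q : gconn G -> nform O -> nov O Q ->
  exists v : vertex O, (0 < effdeg (inl v : gpoint O))%N.
Proof.
move=> gG nf no; apply: contrapT => none.
have eff0 v : effdeg (inl v : gpoint O) = 0%N.
  by apply/eqP; rewrite -leqn0 leqNgt; apply/negP => h; apply: none; exists v.
have degv0 (v : vertex O) : (0 < deg (inl v : gpoint O))%N.
  have [z zv] := vertex_endv v; rewrite deg_ends; apply/card_gt0P.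
  by exists z; rewrite inE zv.
have overv (v : vertex O) : exists u, sproj (inl v : gpoint O) = inl u.
  case E : (sproj (inl v : gpoint O)) => [u|q]; first by exists u.
  by have := eff0 v; rewrite effdeg_inl (nf _ _ E) E.
have full (e : edge O) : off e = 0 /\ len e = len (host e).
  have l0 := len_gt0 e; have o0 := off_ge0 e; have o1 := off_le e.
  have o2 : off e = 0.
    have [u] := overv (endv (e, false)); rewrite sproj_endv /endx /= addr0 => /loc_inl[|[]|[]] //.
      by apply/andP; split; lra.
    by move=> E _; exfalso; clear -l0 o1 E; move: o1; rewrite E gerDl leNgt l0.
  split=> //; have [u] := overv (endv (e, true)); rewrite sproj_endv /endx /= o2 add0r.
  move=> /loc_inl[|[]|[]] //; first by rewrite o2 add0r in o1; rewrite o1 ltW.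
  by move=> E; rewrite E ltxx in l0.
have host_inj : injective (@host _ _ O).
  move=> e e' hh; apply: contrapT => ee.
  have [q l] := full e; have [q' l'] := full e'.
  by have := nov_self ee hh; rewrite q q' !add0r !leNgt !len_gt0 => -[].
pose X u := exists v : vertex O, sproj (inl v : gpoint O) = inl u.
have hosts u Z : X u -> endv Z = u -> exists z : edge O * bool, (host z.1, z.2) = Z.
  move=> [v vu] Zu.
  pose g (z : edge O * bool) := (host z.1, z.2).
  have g_inj : injective g by move=> [x b] [y c] [/host_inj -> ->].
  have sub : image_mem g (mem [pred z | endv z == v]) \subset [pred Z | endv Z == u].
    apply/fintype.subsetP => _ /fintype.imageP[z /eqP zv ->]; rewrite inE.
    have [q l] := full z.1.
    have := vu; rewrite -zv sproj_endv q add0r /endx l => E.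
    by have := loc_endx (g z); rewrite /endx /= E => -[->].
  have := eff0 v; rewrite effdeg_inl vu => /eqP.
  rewrite -leqn0 geq_min leqn0 eqn0Ngt degv0 orFb leqn0 subn_eq0 !deg_ends.
  rewrite -(fintype.card_image g_inj) => le.
  have eqc : #|image_mem g (mem [pred z | endv z == v])| = #|[pred Z | endv Z == u]|.
    by apply/eqP; rewrite eqn_leq le subset_leq_card.
  have /fintype.imageP[z _ ->] : Z \in image_mem g (mem [pred z | endv z == v]).
    by rewrite (subset_cardP eqc sub) inE Zu.
  by exists z.
have over_end (z : edge O * bool) : X (endv (host z.1, z.2)).
  exists (endv z); rewrite sproj_endv; have [-> l] := full z.1.
  by rewrite add0r /endx l -(loc_endx (host z.1, z.2)).
have hX e : X (src e) <-> X (tgt e).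
  split=> Xe.
    have [[x b] [<- _]] := hosts _ (e, false) Xe erefl.
    exact: (over_end (x, true)).
  have [[x b] [<- _]] := hosts _ (e, true) Xe erefl.
  exact: (over_end (x, false)).
have /card_gt0P[e0 _] := edge_ex O.
have /card_gt0P[f _] := edge_ex Q.
have Xf : X (src (host f)) := gG _ hX _ _ (over_end (e0, false)).
have [[x b] [hx _]] := hosts _ (host f, false) Xf erefl.
have [q l] := full x; have := no x f hx; rewrite q l add0r hx.
have := off_ge0 f; have := off_le f; have := len_gt0 f => l0 l1 l2.
by case=> h; [have := le_trans l1 h; rewrite gerDl leNgt l0|
  have := lt_le_trans (ltr_wpDl l2 l0) h; rewrite ltxx].
Qed.

(** Subdivide one edge into k equal intervals. *)
Lemma partition_ex (k : nat) : exists P : 'I_k -> subgraph G, is_partition P.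
Proof.
have /card_gt0P[e0 _] := edge_ex G; have l0 := len_gt0 e0.
have k0 (i : 'I_k) : 0 < k%:R :> R by rewrite ltr0n (leq_ltn_trans _ (ltn_ord i)).
have h0 (i : 'I_k) : 0 < len e0 / k%:R by rewrite divr_gt0// (k0 i).
pose o (i : 'I_k) := i%:R * (len e0 / k%:R).
have oS i : o i + len e0 / k%:R = i.+1%:R * (len e0 / k%:R).
  by rewrite /o -natr1 mulrDl mul1r.
have piece (i : 'I_k) : exists Q : subgraph G, gconn Q /\
    forall x : edge Q, [/\ host x = e0, off x = o i & len x = len e0 / k%:R].
  have E_ex : (0 < #|{: unit}|)%N by rewrite card_unit.
  have o_ge0 (x : unit) : 0 <= o i by rewrite mulr_ge0// ltW// (h0 i).
  have o_le (x : unit) : o i + len e0 / k%:R <= len e0.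
    rewrite oS mulrCA ler_piMr ?(ltW l0)//.
    by rewrite ler_pdivrMr ?(k0 i)// mul1r ler_nat ltn_ord.
  pose pos (b : bool) := loc e0 (o i + if b then len e0 / k%:R else 0).
  pose Q := @glued R G unit bool (fun _ => e0) (fun _ => o i) (fun _ => len e0 / k%:R)
    snd pos E_ex (fun _ => h0 i) o_ge0 o_le (fun _ => erefl)
    (fun (x y : unit) (ne : x <> y) _ => False_ind _ (ne (match x, y with tt, tt => erefl end))).
  exists Q; split=> // X hX u v Xu.
  have all_ends (w : vertex Q) : X w <-> X (src (tt : edge Q)).
    have [[[] []] <-] := vertex_endv w; last by [].
    by rewrite (hX tt).
  by rewrite (all_ends v) -(all_ends u).
have /choice[P hP] := piece; exists P; apply/is_partitionP; split=> [i|i j ij x y _].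
  by apply: gconn_connected; have [] := hP i.
have [_ /(_ x)[_ ox lx]] := hP i; have [_ /(_ y)[_ oy ly]] := hP j.
rewrite ox lx oy ly !oS /o.
have hi := h0 i; case: (ltngtP i j) => [lt|lt|/val_inj E]; last by rewrite E eqxx in ij.
  by left; rewrite ler_pM2r// ler_nat.
by right; rewrite ler_pM2r// ler_nat.
Qed.

End Boundary.

Section Energy.
Context {R : realType} (G : mgraph R) (k : nat).
Hypothesis G_connected : connected [set: gpoint G].
Hypothesis k2 : (2 <= k)%N.
Local Notation L := (optimal_energy G k).
Implicit Types (a b : R).

(** The energy for b is at most b / a times the energy for a. *)
Lemma lambda1_scale (O : subgraph G) a b : 0 < a -> a <= b ->
  lambda1 b O <= b / a * lambda1 a O.
Proof.
move=> a0 ab; have b0 := lt_le_trans a0 ab.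
rewrite leNgt; apply/negP => lt.
have lt' : lambda1 a O < a / b * lambda1 b O.
  by rewrite mulrAC ltr_pdivlMr// mulrC -ltr_pdivrMl// mulrA [a^-1 * b]mulrC.
have [phi [s [ok m0 N]]] := lambda1_approx (ltW a0) lt'.
have := lambda1_le (ltW b0) ok; apply/negP; rewrite -ltNge.
have : gnum (@bweight _ _ b O) phi s <= b / a * gnum (@bweight _ _ a O) phi s.
  rewrite /gnum mulrDr; apply: lerD.
    apply: ler_peMl; last by rewrite ler_pdivlMr// mul1r.
    by apply: sumr_ge0 => e _; apply: penergy_ge0; have [] := ok.2 e.
  rewrite mulr_sumr; apply: ler_sum => v _; rewrite /bweight.
  by rewrite !mulrA divfK// gt_eqF.
move=> /le_lt_trans; apply.
have -> : lambda1 b O * gmass phi s = b / a * (a / b * lambda1 b O * gmass phi s).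
  by field; rewrite !lt0r_neq0.
by rewrite ltr_pM2l// divr_gt0.
Qed.

Lemma Lambda_ge a (P : 'I_k -> subgraph G) i : lambda1 a (P i) <= Lambda a P.
Proof. exact: (le_bigmax _ (fun i => lambda1 a (P i))). Qed.

Lemma optimal_has_inf a : 0 < a -> has_inf
  [set r | exists2 P : 'I_k -> subgraph G, is_partition P & r = Lambda a P].
Proof.
move=> a0; split; first by have [P pP] := partition_ex (G := G) k; exists (Lambda a P), P.
exists 0 => r [P _ ->]; apply: le_trans (Lambda_ge a P (Ordinal (ltnW k2))).
by apply: lambda1_ge0; exact: ltW.
Qed.

Lemma optimal_le a (P : 'I_k -> subgraph G) : 0 < a -> is_partition P -> L a <= Lambda a P.
Proof. by move=> a0 pP; apply: ge_inf; [have [] := optimal_has_inf a0|exists P]. Qed.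

Lemma optimal_ge0 a : 0 < a -> 0 <= L a.
Proof.
move=> a0; apply: lb_le_inf; first by have [] := optimal_has_inf a0.
move=> r [P _ ->]; apply: le_trans (Lambda_ge a P (Ordinal (ltnW k2))).
by apply: lambda1_ge0; exact: ltW.
Qed.

Lemma optimal_attained a : 0 < a -> exists2 P : 'I_k -> subgraph G, is_partition P &
  L a = Lambda a P.
Proof.
move=> a0; have [|P pP lP] := @minimizing_limit _ G k a (L a) a0.
  move=> d d0; have [_ [P pP ->] lt] := inf_adherent d0 (optimal_has_inf a0).
  by exists P => // i; apply: le_lt_trans (Lambda_ge a P i) lt.
exists P => //; apply/eqP; rewrite eq_le optimal_le//=.
by apply/bigmax_leP; split=> //; exact: optimal_ge0.
Qed.

(** Compare at a minimizer for the larger parameter: every piece has a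
boundary vertex, so that the energies of all of them drop. *)
Lemma optimal_strict a b : 0 < a -> a < b -> L a < L b.
Proof.
move=> a0 ab; have b0 := lt_trans a0 ab.
have [P0 pP0 LP0] := optimal_attained b0.
have [P [pP nP gP lP]] := normal_partition pP0.
have bd i : exists v : vertex (P i), (0 < effdeg (inl v : gpoint (P i)))%N.
  have [j ij] : exists j : 'I_k, i != j.
    have k0 : (0 < k)%N by exact: ltnW.
    have [->|ne] := eqVneq i (Ordinal k0); last by exists (Ordinal k0).
    by exists (Ordinal k2).
  apply: (@boundary_vertex_ex _ _ _ (P j) (connected_gconn G_connected) (nP i)).
  by have /is_partitionP[_] := pP; apply.
have le i : lambda1 b (P i) <= L b.
  by apply: le_trans (lP _ _ (ltW b0)) _; rewrite LP0; exact: Lambda_ge.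
apply: le_lt_trans (optimal_le a0 pP) _; apply/bigmax_ltP; split=> [|i _].
  apply: lt_le_trans (le (Ordinal (ltnW k2))).
  by have [v v0] := bd (Ordinal (ltnW k2)); apply: (lambda1_gt0 (gP _) v0).
have [v v0] := bd i.
exact: lt_le_trans (lambda1_strict (gP i) v0 a0 ab) (le i).
Qed.

Lemma optimal_scale a b : 0 < a -> a <= b -> L b <= b / a * L a.
Proof.
move=> a0 ab; have b0 := lt_le_trans a0 ab.
have [P pP LP] := optimal_attained a0.
have ba0 : 0 <= b / a by rewrite divr_ge0// ltW.
apply: le_trans (optimal_le b0 pP) _; apply/bigmax_leP; split=> [|i _].
  by rewrite mulr_ge0// optimal_ge0.
apply: le_trans (lambda1_scale _ a0 ab) _; rewrite ler_wpM2l// LP.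
exact: Lambda_ge.
Qed.

(** The energy is squeezed between monotonicity and optimal_scale. *)
Lemma optimal_continuous : {within [set a : R | 0 < a], continuous L}.
Proof.
apply: continuous_in_subspaceT => x; rewrite inE /= => x0.
apply/(@cvgrPdist_le _ _ _ (nbhs x) (nbhs_filter x)) => eps eps0.
have Lx := optimal_ge0 x0.
pose d := Num.min (x / 2) (eps * x / (2 * (L x + 1))).
have q0 : 0 < 2 * (L x + 1) by rewrite mulr_gt0// ltr_wpDl.
have d0 : 0 < d by rewrite lt_min !divr_gt0// mulr_gt0.
have dx : d <= x / 2 by rewrite ge_min lexx.
have de : d * (2 * (L x + 1)) <= eps * x.
  have : d <= eps * x / (2 * (L x + 1)) by rewrite ge_min lexx orbT.
  by rewrite ler_pdivlMr.
apply/nbhs_ballP; exists d => // y; rewrite /ball /= => xy.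
have y0 : x / 2 < y by move: xy; rewrite ltr_norml => /andP[_ ?]; lra.
have {}y0' : 0 < y by lra.
have key : `|x - y| * (2 * (L x + 1)) <= eps * x.
  by apply: le_trans de; rewrite ler_wpM2r ?(ltW q0)// ltW.
have [le|lt] := leP x y.
  have h1 : L x <= L y by move: le; rewrite le_eqVlt => /predU1P[->//|/(optimal_strict x0)/ltW].
  have h2 := optimal_scale x0 le.
  rewrite ler0_norm ?subr_le0// opprB.
  rewrite ler0_norm ?subr_le0// opprB in key.
  rewrite -(ler_pM2r x0); apply: le_trans key.
  have : L y * x <= y * L x by rewrite -ler_pdivlMr// mulrAC.
  nra.
have h1 : L y <= L x by apply/ltW/optimal_strict.
have h2 := optimal_scale y0' (ltW lt).
rewrite ger0_norm ?subr_ge0//.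
rewrite ger0_norm ?subr_ge0 ?(ltW lt)// in key.
have h3 : L x * y <= x * L y by rewrite -ler_pdivlMr// mulrAC.
have Ly := optimal_ge0 y0'.
rewrite -(ler_pM2r x0); apply: le_trans key.
nra.
Qed.

End Energy.

Theorem theorem3p3 (R : realType) (G : mgraph R)
    (G_connected : connected [set: gpoint G]) :
  (forall (k : nat) (a : R), (2 <= k)%N -> 0 < a ->
     exists2 P : 'I_k -> subgraph G, is_partition P &
       optimal_energy G k a = Lambda a P) /\
  (forall k : nat, (2 <= k)%N ->
     {within [set a : R | 0 < a], continuous (optimal_energy G k)} /\
     (forall a b : R, 0 < a -> a < b ->
        optimal_energy G k a < optimal_energy G k b)).
Proof.
split=> [k a k2 a0|k k2]; first exact: optimal_attained.
split; first exact: optimal_continuous.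
by move=> a b; exact: optimal_strict.
Qed.
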